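(* Let $\alpha\neq0$ and $\delta$ be real constants. Every $3$-$(\alpha,\delta)$-Sasaki manifold $(M,\varphi_i,\xi_i,\eta_i,g)$ of dimension $4n+3$, $n\ge1$, admits an underlying quaternionic contact structure which is qc-Einstein with $S=2\alpha\delta$, and its Riemannian Ricci curvature is given by $$\mathrm{Ric}^g=2\alpha\big(2\delta(n+2)-3\alpha\big)g+2(\alpha-\delta)\big((2n+3)\alpha-\delta\big)\sum_{i=1}^3\eta_i\otimes\eta_i.$$ In particular, a $3$-$(\alpha,\delta)$-Sasaki manifold of dimension $4n+3$ is Riemannian Einstein if and only if $\delta=\alpha$ or $\delta=(2n+3)\alpha$.
   Context: An almost contact metric structure $(\varphi,\xi,\eta,g)$ consists of a $(1,1)$-tensor field $\varphi$, a vector field $\xi$, a $1$-form $\eta$ and a Riemannian metric $g$ with $\varphi^2=-I+\eta\otimes\xi$, $\eta(\xi)=1$, $g(\varphi X,\varphi Y)=g(X,Y)-\eta(X)\eta(Y)$. Its fundamental form is $\Phi(X,Y)=g(X,\varphi Y)$. An almost $3$-contact metric manifold $(M,\varphi_i,\xi_i,\eta_i,g)$, $i=1,2,3$, is a manifold of dimension $4n+3$ with three almost contact metric structures with the same $g$ such that, for every even permutation $(i,j,k)$ of $(1,2,3)$, $\varphi_k=\varphi_i\varphi_j-\eta_j\otimes\xi_i=-\varphi_j\varphi_i+\eta_i\otimes\xi_j$, $\xi_k=\varphi_i\xi_j=-\varphi_j\xi_i$, $\eta_k=\eta_i\circ\varphi_j=-\eta_j\circ\varphi_i$. Set $\mathcal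 H=\bigcap_i\ker\eta_i$. It is $3$-$(\alpha,\delta)$-Sasaki if $d\eta_i=2\alpha\Phi_i+2(\alpha-\delta)\eta_j\wedge\eta_k$ for every even permutation $(i,j,k)$ of $(1,2,3)$, with real constants $\alpha\neq0$, $\delta$. Quaternionic contact (qc) structure on a $(4n+3)$-manifold: a codimension $3$ distribution $\mathcal H$, (locally) of the form $\bigcap_i\ker\tilde\eta_i$ for $1$-forms $\tilde\eta_1,\tilde\eta_2,\tilde\eta_3$, with a positive definite metric $g$ on $\mathcal H$ and almost complex structures $I_1,I_2,I_3$ on $\mathcal H$ such that $I_1I_2=I_3$ (quaternionic relations), $g(I_i\cdot,I_i\cdot)=g(\cdot,\cdot)$ and $2g(I_iX,Y)=d\tilde\eta_i(X,Y)$ for $X,Y\in\Gamma(\mathcal H)$. Its vertical distribution is spanned by Reeb vector fields $\tilde\xi_1,\tilde\xi_2,\tilde\xi_3$ characterized by $\tilde\eta_i(\tilde\xi_j)=\delta_{ij}$, $(\tilde\xi_i\lrcorner d\tilde\eta_i)|_{\mathcal H}=0$, $(\tilde\xi_i\lrcorner d\tilde\eta_j)|_{\mathcal H}=-(\tilde\xi_j\lrcorner d\tilde\eta_i)|_{\mathcal H}$ (their existence is automatic if $\dim\ge 11$ and is assumed if $\dim=7$). The qc structure is qc-Einstein if the Ricci tensor of its Biquard connection equals $\frac{\mathrm{Scal}}{4n}g$ on $\mathcal H$, where $\mathrm{Scal}$ is the qc scalar curvature; set $S=\frac{\mathrm{Scal}}{8n(n+2)}$. By a known characterization, which may be taken as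 the definition, the structure is qc-Einstein with constant $S$ iff $d\tilde\eta_i=2\omega_i+S\,\tilde\eta_j\wedge\tilde\eta_k$ for every even permutation $(i,j,k)$ of $(1,2,3)$, where $\omega_i$ is the $2$-form with $\tilde\xi_r\lrcorner\omega_i=0$ ($r=1,2,3$) and $2\omega_i(X,Y)=d\tilde\eta_i(X,Y)$ for $X,Y\in\Gamma(\mathcal H)$. The underlying qc structure of a $3$-$(\alpha,\delta)$-Sasaki manifold is the one given by $\mathcal H$, $g|_{\mathcal H}$, $I_i=\varphi_i|_{\mathcal H}$ and $\tilde\eta_i=-\frac1\alpha\eta_i$. Conventions: $d\eta(X,Y)=X(\eta(Y))-Y(\eta(X))-\eta([X,Y])$, $(\eta\wedge\zeta)(X,Y)=\eta(X)\zeta(Y)-\eta(Y)\zeta(X)$. *)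

(* Defs.v *)
From HB Require Import structures.
From mathcomp Require Import all_boot all_order all_fingroup all_algebra.
From mathcomp Require Import sesquilinear ring.
From mathcomp Require Import all_classical all_reals all_analysis.

Set Implicit Arguments.
Unset Strict Implicit.
Unset Printing Implicit Defensive.

Import Order.TTheory GRing.Theory Num.Theory.
Import numFieldNormedType.Exports.

Local Open Scope classical_set_scope.
Local Open Scope ring_scope.

(* Smooth manifolds are given by atlases.  Vector fields are the derivations of
   the R-algebra C^oo(M), and tensor fields are the C^oo(M)-multilinear maps on
   the C^oo(M)-module of vector fields. *)

(* Meant for A open and V finite-dimensional: f is C^k.+1 on A iff it is Frechet
   differentiable on A and x |-> 'd f x v is C^k on A for each fixed v. *)
Fixpoint Ck (R : realType) (V W : normedModType R) (k : nat) (A : set V)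
    (f : V -> W) : Prop :=
  if k is k'.+1 then
    (forall x, A x -> differentiable f x) /\ forall v, Ck k' A ('D_v f)
  else forall x, A x -> {for x, continuous f}.

Definition smooth_on (R : realType) (V W : normedModType R) (A : set V)
  (f : V -> W) : Prop := forall k, Ck k A f.

Section CkTheory.
Context {R : realType} {V : normedModType R}.
Implicit Types (A : set V).

Lemma near0_differentiable (W : normedModType R) (h : V -> W) x :
  {near x, h =1 \0} -> differentiable h x.
Proof.
move=> h0; have hx : h x = 0 by exact: (nbhs_singleton h0).
have E : h \o shift x = cst (h x) + \0 +o_ 0 id.
  apply/eqaddoP => e e0.
  have : \forall y \near (0 : V), h (y + x) = 0.
    have : \forall y \near x, h y = 0 by exact: h0.
    by rewrite (near_shift 0) subr0.
  apply: filterS => y hy.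
  rewrite /= !fctE /= hx hy !addr0 subrr normr0.
  by rewrite mulr_ge0 // ltW.
have c0 : continuous (\0 : V -> W) by move=> y; exact: cst_continuous.
have D := @diff_unique R V W h \0 x c0 E.
apply/diff_locallyP; rewrite D; split; first exact: c0.
exact: E.
Qed.

Lemma near_eq_differentiable (W : normedModType R) (f g : V -> W) x :
  {near x, f =1 g} -> differentiable f x -> differentiable g x.
Proof.
move=> fg df; rewrite -(subrK f g); apply: differentiableD => //.
apply: near0_differentiable.
by apply: filterS fg => y /= fgy; rewrite !fctE fgy subrr.
Qed.

Lemma near_open_eq (W : Type) A (f g : V -> W) x : open A -> A x ->
  (forall x, A x -> f x = g x) -> {near x, f =1 g}.
Proof.
by move=> oA Ax fg; apply: filterS fg _; apply: open_nbhs_nbhs; split.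
Qed.

Lemma eq_Ck (W : normedModType R) k A (f g : V -> W) : open A ->
  (forall x, A x -> f x = g x) -> Ck k A f -> Ck k A g.
Proof.
move=> oA; elim: k f g => [|k IH] f g fg /=.
  move=> cf x Ax; rewrite /prop_for /continuous_at -(fg x Ax).
  apply: cvg_trans (cf x Ax); apply: near_eq_cvg.
  exact: near_open_eq oA Ax fg.
move=> [df Df]; split=> [x Ax|v].
  by apply: near_eq_differentiable (df x Ax); exact: near_open_eq oA Ax fg.
apply: IH (Df v) => x Ax; apply: near_eq_derive.
exact: near_open_eq oA Ax fg.
Qed.

Lemma Ck_cst (W : normedModType R) k A (a : W) : Ck k A (cst a).
Proof.
elim: k a => [|k IH] a /=; first by move=> x _; exact: cst_continuous.
split=> [x _|v]; first exact: differentiable_cst.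
have -> : 'D_v (cst a : V -> W) = cst 0 by apply/funext => x; rewrite derive_cst.
exact: IH.
Qed.

Lemma Ck_D (W : normedModType R) k A (f g : V -> W) : open A ->
  Ck k A f -> Ck k A g -> Ck k A (f + g).
Proof.
move=> oA; elim: k f g => [|k IH] f g /=.
  by move=> cf cg x Ax; apply: continuousD; [exact: cf|exact: cg].
move=> [df Df] [dg Dg]; split=> [x Ax|v].
  by apply: differentiableD; [exact: df|exact: dg].
apply: (eq_Ck oA _ (IH _ _ (Df v) (Dg v))) => x Ax.
by rewrite deriveD //; apply: diff_derivable; [exact: df|exact: dg].
Qed.

Lemma Ck_leS (W : normedModType R) k A (f : V -> W) : Ck k.+1 A f -> Ck k A f.
Proof.
elim: k f => [|k IH] f; last by move=> [df Df]; split=> // v; exact: IH.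
by move=> [df _] x Ax; apply: differentiable_continuous; exact: df.
Qed.

Lemma Ck_M k A (f g : V -> R) : open A ->
  Ck k A f -> Ck k A g -> Ck k A (f * g).
Proof.
move=> oA; elim: k f g => [|k IH] f g.
  by move=> cf cg x Ax; apply: continuousM; [exact: cf|exact: cg].
move=> Cf Cg; have [df Df] := Cf; have [dg Dg] := Cg; split=> [x Ax|v].
  by apply: differentiableM; [exact: df|exact: dg].
apply: (@eq_Ck _ k A (f * 'D_v g + g * 'D_v f)) => // [x Ax|].
  by rewrite deriveM //; apply: diff_derivable; [exact: df|exact: dg].
apply: Ck_D => //; apply: IH; first [exact: Df|exact: Dg|exact: Ck_leS Cf|exact: Ck_leS Cg].
Qed.

End CkTheory.

Record chart (R : realType) (m : nat) (M : topologicalType) := Chart {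
  chart_dom : set M;
  chart_map : M -> 'rV[R]_m;
  chart_inv : 'rV[R]_m -> M;
  chart_dom_open : open chart_dom;
  chart_img_open : open (chart_map @` chart_dom);
  chart_mapK : {in chart_dom, cancel chart_map chart_inv};
  chart_map_continuous : {in chart_dom, continuous chart_map};
  chart_inv_continuous : {in chart_map @` chart_dom, continuous chart_inv} }.

Arguments chart_dom_open {R m M} c.
Arguments chart_img_open {R m M} c.
Arguments chart_mapK {R m M} c.
Arguments chart_map_continuous {R m M} c.
Arguments chart_inv_continuous {R m M} c.

(* Pointedness of the carrier only serves to exclude the empty manifold. *)
HB.mixin Record isSmoothManifold (R : realType) (m : nat) M
    of PointedTopological M := {
  atlas : set (chart R m M);
  atlas_cover : forall x : M, exists2 c, atlas c & chart_dom c x;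
  atlas_compatible : forall c c', atlas c -> atlas c' ->
    smooth_on (chart_map c @` (chart_dom c `&` chart_dom c'))
      (chart_map c' \o chart_inv c);
  manifold_hausdorff : hausdorff_space M;
  manifold_second_countable : @second_countable M }.

#[short(type="smoothManifold")]
HB.structure Definition SmoothManifold (R : realType) (m : nat) :=
  {M of isSmoothManifold R m M & PointedTopological M}.

Section SmoothFun.
Context {R : realType} {m : nat} (M : smoothManifold R m).
Implicit Types f g : M -> R.

Definition smooth f : Prop := forall c : chart R m M, atlas c ->
  smooth_on (chart_map c @` chart_dom c) (f \o chart_inv c).

Definition smooth_pred : {pred M -> R} := fun f => `[< smooth f >].

Lemma smooth_subring_closed : subring_closed smooth_pred.
Proof.
have sc a : smooth (cst a) by move=> c _ k; exact: Ck_cst.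
have sM f g : smooth f -> smooth g -> smooth (f * g).
  move=> sf sg c ac k; have oc := chart_img_open c.
  exact: (Ck_M oc (sf c ac k) (sg c ac k)).
have sD f g : smooth f -> smooth g -> smooth (f + g).
  move=> sf sg c ac k; have oc := chart_img_open c.
  exact: (Ck_D oc (sf c ac k) (sg c ac k)).
split; first exact/asboolP/sc.
  move=> f g /asboolP sf /asboolP sg; apply/asboolP.
  have -> : f - g = f + cst (- 1) * g.
    by apply/funext => x; rewrite !fctE mulN1r.
  by apply: sD => //; apply: sM.
by move=> f g /asboolP sf /asboolP sg; apply/asboolP; exact: sM.
Qed.

HB.instance Definition _ :=
  GRing.isSubringClosed.Build (M -> R) smooth_pred smooth_subring_closed.

Record smoothfun := SmoothFun {
  smoothfun_val :> M -> R;
  smoothfunP : smoothfun_val \in smooth_pred }.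

HB.instance Definition _ := [isSub for smoothfun_val].
HB.instance Definition _ := [Choice of smoothfun by <:].
HB.instance Definition _ := [SubChoice_isSubComNzRing of smoothfun by <:].

Lemma smooth_cst (a : R) : (cst a : M -> R) \in smooth_pred.
Proof. by apply/asboolP => c _ k; exact: Ck_cst. Qed.

Definition scst (a : R) : smoothfun := SmoothFun (smooth_cst a).

End SmoothFun.

Section VectorField.
Context {R : realType} {m : nat} (M : smoothManifold R m).
Local Notation C := (smoothfun M).

Definition derivation (D : C -> C) : Prop :=
  (forall (a : R) (f g : C), D (scst M a * f + g) = scst M a * D f + D g) /\
  (forall f g : C, D (f * g) = D f * g + f * D g).

Definition derivation_pred : {pred C -> C^o} := fun D => `[< derivation D >].

Lemma derivation_submod_closed : submod_closed derivation_pred.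
Proof.
split.
  have E0 (f : C) : (0 : C -> C^o) f = 0 :> C by [].
  by apply/asboolP; split=> [a f g|f g]; rewrite !E0; ring.
move=> h X Y /asboolP[X1 X2] /asboolP[Y1 Y2]; apply/asboolP.
have E (f : C) : (h *: X + Y) f = h * X f + Y f :> C by [].
by split=> [a f g|f g]; rewrite !E ?X1 ?Y1 ?X2 ?Y2; ring.
Qed.

HB.instance Definition _ := GRing.isSubmodClosed.Build C (C -> C^o)
  derivation_pred derivation_submod_closed.

Record vfield := VField {
  vfield_val :> C -> C^o;
  vfieldP : vfield_val \in derivation_pred }.

HB.instance Definition _ := [isSub for vfield_val].
HB.instance Definition _ := [Choice of vfield by <:].
HB.instance Definition _ := [SubChoice_isSubLmodule of vfield by <:].

Lemma bracket_derivation (X Y : vfield) :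
  (fun f => X (Y f) - Y (X f)) \in derivation_pred.
Proof.
have /asboolP[X1 X2] := vfieldP X; have /asboolP[Y1 Y2] := vfieldP Y.
apply/asboolP; split=> [a f g|f g].
  rewrite Y1 X1 X1 Y1 mulrBr opprD -!addrA; congr (_ + _).
  by rewrite addrCA.
have XD (u v : C) : X (u + v) = X u + X v.
  have := X1 1 u v; suff -> : scst M 1 = 1 by rewrite !mul1r.
  exact/val_inj.
have YD (u v : C) : Y (u + v) = Y u + Y v.
  have := Y1 1 u v; suff -> : scst M 1 = 1 by rewrite !mul1r.
  exact/val_inj.
rewrite X2 Y2 XD YD !X2 !Y2 mulrBl mulrBr !opprD.
ring.
Qed.

Definition bracket (X Y : vfield) : vfield := VField (bracket_derivation X Y).

End VectorField.

Section Tensors.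
Context {R : realType} {m : nat} (M : smoothManifold R m).
Local Notation C := (smoothfun M).
Local Notation X_M := (vfield M).

(* The convention is d eta(X, Y) = X(eta Y) - Y(eta X) - eta [X, Y], with no
   factor 1/2. *)
Definition extd (eta : {scalar X_M}) (X Y : X_M) : C :=
  X (eta Y) - Y (eta X) - eta (bracket X Y).

Definition wedge (eta zeta : {scalar X_M}) (X Y : X_M) : C :=
  eta X * zeta Y - eta Y * zeta X.

(* X_p <> 0 as a tangent vector *)
Definition nonzero_at (p : M) (X : X_M) : Prop := exists f : C, X f p != 0.

Definition riemannian_metric (g : {symmetric X_M}) : Prop :=
  forall (p : M) (X : X_M), nonzero_at p X -> 0 < g X X p.

Record levi_civita (g : {symmetric X_M}) (nabla : X_M -> X_M -> X_M) : Prop := {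
  lc_linear_l : forall (f : C) (X Y Z : X_M),
    nabla (f *: X + Y) Z = f *: nabla X Z + nabla Y Z;
  lc_additive_r : forall X Y Z : X_M, nabla X (Y + Z) = nabla X Y + nabla X Z;
  lc_leibniz : forall (f : C) (X Y : X_M),
    nabla X (f *: Y) = (X f : C) *: Y + f *: nabla X Y;
  lc_torsion_free : forall X Y : X_M, nabla X Y - nabla Y X = bracket X Y;
  lc_metric : forall X Y Z : X_M,
    X (g Y Z) = g (nabla X Y) Z + g Y (nabla X Z) }.

Definition curvature (nabla : X_M -> X_M -> X_M) (X Y Z : X_M) : X_M :=
  nabla X (nabla Y Z) - nabla Y (nabla X Z) - nabla (bracket X Y) Z.

(* m vector fields whose values at p form an orthonormal basis of T_p M *)
Definition orthonormal_at (g : {symmetric X_M}) (p : M) (E : 'I_m -> X_M) :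
  Prop := forall a b : 'I_m, g (E a) (E b) p = (a == b)%:R.

Definition frame_at (g : {symmetric X_M}) (p : M) : 'I_m -> X_M :=
  xget (fun=> 0) [set E : 'I_m -> X_M | orthonormal_at g p E].

(* Ric(X, Y) at p is the trace of Z |-> R(Z, X)Y on T_p M, computed in an
   orthonormal basis; the value does not depend on the chosen basis. *)
Definition ricci (g : {symmetric X_M}) (nabla : X_M -> X_M -> X_M)
    (X Y : X_M) (p : M) : R :=
  \sum_(a < m)
    g (curvature nabla (frame_at g p a) X Y) (frame_at g p a) p.

Definition einstein (g : {symmetric X_M}) (nabla : X_M -> X_M -> X_M) : Prop :=
  exists lambda : R, forall (X Y : X_M) (p : M),
    ricci g nabla X Y p = lambda * g X Y p.

End Tensors.

(* The indices 1, 2, 3 are the elements 0, 1, 2 of 'I_3. *)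
Definition even_triple (i j k : 'I_3) : Prop :=
  exists2 s : 'S_3, ~~ odd_perm s & [/\ i = s 0, j = s 1 & k = s 2].

Section Contact.
Context {R : realType} {m : nat} (M : smoothManifold R m).
Local Notation C := (smoothfun M).
Local Notation X_M := (vfield M).

Record almost_contact_metric (phi : {linear X_M -> X_M}) (xi : X_M)
    (eta : {scalar X_M}) (g : {symmetric X_M}) : Prop := {
  ac_phi2 : forall X, phi (phi X) = - X + eta X *: xi;
  ac_eta_xi : eta xi = 1;
  ac_compat : forall X Y, g (phi X) (phi Y) = g X Y - eta X * eta Y }.

Definition fundamental_form (phi : {linear X_M -> X_M}) (g : {symmetric X_M})
  (X Y : X_M) : C := g X (phi Y).

Variables (phi : 'I_3 -> {linear X_M -> X_M}) (xi : 'I_3 -> X_M).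
Variables (eta : 'I_3 -> {scalar X_M}) (g : {symmetric X_M}).

Record almost_3_contact_metric : Prop := {
  a3c_metric : riemannian_metric g;
  a3c_structure : forall i, almost_contact_metric (phi i) (xi i) (eta i) g;
  a3c_phi : forall i j k, even_triple i j k -> forall X,
    phi k X = phi i (phi j X) - eta j X *: xi i /\
    phi k X = - phi j (phi i X) + eta i X *: xi j;
  a3c_xi : forall i j k, even_triple i j k ->
    xi k = phi i (xi j) /\ xi k = - phi j (xi i);
  a3c_eta : forall i j k, even_triple i j k -> forall X,
    eta k X = eta i (phi j X) /\ eta k X = - eta j (phi i X) }.

Record sasaki_3_alpha_delta (alpha delta : R) : Prop := {
  s3_almost_3_contact : almost_3_contact_metric;
  s3_alpha : alpha != 0;
  s3_extd : forall i j k, even_triple i j k -> forall X Y,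
    extd (eta i) X Y =
      scst M (2 * alpha) * fundamental_form (phi i) g X Y
      + scst M (2 * (alpha - delta)) * wedge (eta j) (eta k) X Y }.

End Contact.

Section Horizontal.
Context {R : realType} {m : nat} (M : smoothManifold R m).
Variable eta : 'I_3 -> {scalar (vfield M)}.

Definition horizontal_pred : {pred vfield M} :=
  fun X => `[< forall i, eta i X = 0 >].

Lemma horizontal_submod_closed : submod_closed horizontal_pred.
Proof.
split; first by apply/asboolP => i; rewrite linear0.
move=> f X Y /asboolP X0 /asboolP Y0; apply/asboolP => i.
by rewrite linearP X0 Y0 addr0 mulr0.
Qed.

HB.instance Definition _ := GRing.isSubmodClosed.Build (smoothfun M) (vfield M)
  horizontal_pred horizontal_submod_closed.

(* The module of sections of the distribution H, the intersection of the
   kernels of the eta i. *)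
Record hsection := HSection {
  hsection_val :> vfield M;
  hsectionP : hsection_val \in horizontal_pred }.

HB.instance Definition _ := [isSub for hsection_val].
HB.instance Definition _ := [Choice of hsection by <:].
HB.instance Definition _ := [SubChoice_isSubLmodule of hsection by <:].

End Horizontal.

Section QC.
Context {R : realType} {m : nat} (M : smoothManifold R m).
Local Notation C := (smoothfun M).
Local Notation X_M := (vfield M).

Record reeb_fields (eta : 'I_3 -> {scalar X_M}) (xi : 'I_3 -> X_M) : Prop := {
  reeb_dual : forall i j, eta i (xi j) = (i == j)%:R;
  reeb_diag : forall i (X : hsection eta), extd (eta i) (xi i) X = 0;
  reeb_skew : forall i j (X : hsection eta),
    extd (eta j) (xi i) X = - extd (eta i) (xi j) X }.

(* The contact forms are global, and the Reeb fields, which are determined by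
   them, are part of the data: they exist automatically in dimension at least 11
   and are required to exist in dimension 7. *)
Record qcStructure := QCStructure {
  qc_eta : 'I_3 -> {scalar X_M};
  qc_g : {symmetric (hsection qc_eta)};
  qc_I : 'I_3 -> {linear hsection qc_eta -> hsection qc_eta};
  qc_xi : 'I_3 -> X_M;
  qc_codim3 : forall (p : M) (c : 'I_3 -> R),
    (forall X : X_M, \sum_i c i * qc_eta i X p = 0) -> forall i, c i = 0;
  qc_g_pos : forall (p : M) (X : hsection qc_eta),
    nonzero_at p X -> 0 < qc_g X X p;
  qc_I2 : forall i (X : hsection qc_eta), qc_I i (qc_I i X) = - X;
  qc_I123 : forall X : hsection qc_eta, qc_I 0 (qc_I 1 X) = qc_I 2 X;
  qc_I_isometry : forall i (X Y : hsection qc_eta),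
    qc_g (qc_I i X) (qc_I i Y) = qc_g X Y;
  qc_extd : forall i (X Y : hsection qc_eta),
    2 * qc_g (qc_I i X) Y = extd (qc_eta i) X Y;
  qc_reeb : reeb_fields qc_eta qc_xi }.

(* Characterization of qc-Einstein structures by their structure equations,
   taken as the definition; S is the normalized qc scalar curvature. *)
Definition qc_einstein (Q : qcStructure) (S : R) : Prop :=
  exists omega : 'I_3 -> {skew_symmetric X_M},
    [/\ forall i r (X : X_M), omega i (qc_xi Q r) X = 0,
        forall i (X Y : hsection (qc_eta Q)),
          2 * omega i X Y = extd (qc_eta Q i) X Y &
        forall i j k, even_triple i j k -> forall X Y : X_M,
          extd (qc_eta Q i) X Y =
            2 * omega i X Y + scst M S * wedge (qc_eta Q j) (qc_eta Q k) X Y].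

(* H is the horizontal distribution of Q, as -1/alpha is a nonzero constant. *)
Definition underlying_qc (alpha : R) (phi : 'I_3 -> {linear X_M -> X_M})
    (eta : 'I_3 -> {scalar X_M}) (g : {symmetric X_M}) (Q : qcStructure) :
    Prop :=
  [/\ forall i (X : X_M), qc_eta Q i X = scst M (- alpha^-1) * eta i X,
      forall X Y : hsection (qc_eta Q), qc_g Q X Y = g X Y &
      forall i (X : hsection (qc_eta Q)), qc_I Q i X = phi i X :> X_M].

End QC.

(* Main.v *)
Require Import Defs.
From HB Require Import structures.
From mathcomp Require Import all_boot all_order all_fingroup all_algebra.
From mathcomp Require Import sesquilinear ring.
From mathcomp Require Import all_classical all_reals all_analysis.
Import Order.TTheory GRing.Theory Num.Theory.

Set Implicit Arguments.
Unset Strict Implicit.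
Unset Printing Implicit Defensive.

Import numFieldNormedType.Exports.
Local Open Scope classical_set_scope.
Local Open Scope ring_scope.

(* The connection [D = nabla - deform] is metric.  The structure equations for
   [d eta_i], together with [d d eta_i = 0], say exactly that
   [g (D_X xi_i) Y] is symmetric in [X, Y] and that the cyclic sum of
   [g ((D_X phi_i) Y) Z] vanishes; as in Hitchin's lemma the quaternionic relations
   then force [D xi_i = 0] and [D phi_i = 0].  Hence the Riemannian curvature is
   that of [D] plus a term [Q] quadratic in [deform], which is computed on
   horizontal and vertical arguments.  The curvature of [D] kills the [xi_i] and
   commutes with the [phi_i], and the first Bianchi identity with the trace
   against [phi_i] gives, with [S = Ric_D - alpha delta (m - 1) g] on horizontal
   fields, the relation [S(X, phi_i Y) = S(Y, phi_i X)], that is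
   [S(phi_i X, phi_i Y) = - S(X, Y)].  Since [phi_3 = phi_1 phi_2] there, [S = 0].
   Traces are taken in frames orthonormal at a point.  A derivation of the algebra
   of smooth functions is, near a point, a combination of coordinate fields: this
   follows from Hadamard's lemma applied in a chart cut off by a bump function, and
   it yields both the frames and the Parseval identity.
   For the qc structure, [d eta_i = - 2 alpha omega_i - 2 delta (eta_j ^ eta_k)]
   with [omega_i] the horizontal part of [g (phi_i _) _]. *)

(** * Hadamard's lemma *)

(** The differentials [d eta_i] see only the skew part of [nabla xi_i] and a cyclic sum of
    [nabla phi_i]. Normality of the three structures is not among the data; the interplay of three
    anticommuting structures has to supply what is missing. The terms of [deform] encode the
    expected values of [nabla]: [- alpha phi_i X] for the derivative of [xi_i] along a horizontal
    [X], [delta phi_s xi_t] for that of [xi_t] along [xi_s], the vertical part of [nabla_X Y]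
    dictated by metricity, and a rotation [(delta - alpha) phi_s] of horizontal fields along [xi_s].
    The gain is that the curvature endomorphisms of [D] on the horizontal bundle are of type sp(n),
    hence trace-orthogonal to the [phi_i]. This lets the Bianchi identity determine the Ricci trace
    although the curvature itself stays unknown. Vector fields are derivations of global functions,
    so a tangent vector at a point is not an object: pointwise linear algebra is phrased by
    evaluating smooth functions at [p]. *)

Lemma diff_estimate (R : realType) (V W : normedModType R) (f : V -> W)
    (L : {linear V -> W}) (x : V) : continuous L ->
  (forall e, 0 < e -> \forall v \near (0 : V),
     `|f (v + x) - f x - L v| <= e * `|v|) ->
  differentiable f x /\ forall v, 'D_v f x = L v.
Proof.
move=> cL H.
have E : f \o shift x = cst (f x) + L +o_ 0 id.
  apply/eqaddoP => e e0; have := H e e0; apply: filterS => v.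
  by rewrite !fctE /= opprD addrA.
have D := diff_unique cL E.
have dfx : differentiable f x by apply/diff_locallyP; rewrite D.
by split=> // v; rewrite deriveE // D.
Qed.

Section LinearEstimate.
Context {R : realType} {m : nat}.
Implicit Types (f : 'rV[R]_m -> R) (x v : 'rV[R]_m).

Lemma coord_le_norm v i : `|v 0 i| <= `|v|.
Proof.
rewrite [leRHS]/Num.Def.normr /= mx_normrE.
exact: (le_bigmax _ (fun ij : 'I_1 * 'I_m => `|v ij.1 ij.2|) (0, i)).
Qed.

Definition row_form (c : 'I_m -> R) v : R := \sum_i v 0 i * c i.

Lemma row_form_linear c : linear (row_form c : 'rV[R]_m -> R).
Proof.
move=> a u v; rewrite /row_form scaler_sumr -big_split; apply: eq_bigr => i _.
by rewrite !mxE mulrDl -[a *: _]/(a * _) mulrA.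
Qed.

HB.instance Definition _ c :=
  @GRing.isLinear.Build _ _ _ _ (row_form c : 'rV[R]_m -> R)
    (row_form_linear c).

Lemma row_form_continuous c : continuous (row_form c).
Proof.
move=> x; apply: differentiable_continuous.
have -> : row_form c = \sum_i (fun v => v 0 i * c i).
  by apply/funext => v; rewrite fct_sumE.
apply: differentiable_sum => i.
by apply: differentiableM => //; exact: differentiable_coord.
Qed.

Lemma derive_estimate f x (c : 'I_m -> R) :
  (forall e, 0 < e -> \forall v \near (0 : 'rV[R]_m),
     `|f (v + x) - f x - row_form c v| <= e * `|v|) ->
  differentiable f x /\ forall v, 'D_v f x = row_form c v.
Proof. exact: (@diff_estimate _ _ _ _ (row_form c) x (@row_form_continuous c)). Qed.

End LinearEstimate.

Section Lines.
Context {R : realType} {V : normedModType R}.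
Implicit Types (h : V -> R) (y w : V).

Lemma is_derive_line h y w (s : R) : differentiable h (s *: w + y) ->
  is_derive s 1 (fun s => h (s *: w + y)) ('D_w h (s *: w + y)).
Proof.
move=> dh.
have E : (fun t : R => t^-1 *: (((fun s => h (s *: w + y)) \o shift s) (t *: 1)
    - h (s *: w + y))) =
  (fun t : R => t^-1 *: ((h \o shift (s *: w + y)) (t *: w) - h (s *: w + y))).
  apply/funext => t /=.
  by rewrite -[t *: 1]/(t * 1) mulr1 scalerDl addrA.
have dhw : derivable h (s *: w + y) w by exact: diff_derivable.
apply: DeriveDef; first by rewrite /derivable E.
by rewrite /derive E.
Qed.

Lemma line_mean_value h y w :
  (forall s : R, 0 <= s <= 1 -> differentiable h (s *: w + y)) ->
  exists2 s : R, 0 <= s <= 1 & h (w + y) - h y = 'D_w h (s *: w + y).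
Proof.
move=> dh.
have dF (s : R) : 0 <= s <= 1 ->
    is_derive s 1 (fun s => h (s *: w + y)) ('D_w h (s *: w + y)).
  by move=> /dh; exact: is_derive_line.
have [||s s01] := @MVT_segment _ (fun s => h (s *: w + y))
    (fun s => 'D_w h (s *: w + y)) 0 1 ler01.
- by move=> s; rewrite in_itv /= => /andP[s0 s1]; apply: dF; rewrite !ltW.
- apply: derivable_within_continuous => s; rewrite in_itv /= => /dF.
  by case.
- rewrite scale1r scale0r add0r subr0 mulr1 => ->; exists s => //.
Qed.

End Lines.

(** * Weighted integrals along segments issuing from a fixed point *)

Section SegmentIntegral.
Context {R : realType} {m : nat}.
Local Notation V := 'rV[R]_m.
Local Notation mu := (@lebesgue_measure R).
Variables (B : set V) (q : V).
Hypothesis oB : open B.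
Hypothesis starB : forall x (t : R), B x -> 0 <= t <= 1 -> B (t *: (x - q) + q).
Implicit Types (h : V -> R) (x v : V).

(** The Hadamard coefficients have [k = 0] and a partial derivative for [h]. The weight makes the
    family stable: each differentiation in [x] produces one more factor [t]. *)
Definition segint (k : nat) h x : R :=
  \int[mu]_(t in `[0, 1]) (t ^+ k * h (t *: (x - q) + q)).

Lemma segint_integrable k h x : Ck 0 B h -> B x ->
  mu.-integrable `[0, 1] (EFin \o (fun t => t ^+ k * h (t *: (x - q) + q))).
Proof.
move=> ch Bx; apply: continuous_compact_integrable; first exact: segment_compact.
apply: continuous_in_subspaceT => t /set_mem; rewrite /= in_itv /= => t01.
apply: (@continuousM _ _ (fun t : R => t ^+ k) (fun t => h (t *: (x - q) + q))).
  exact: exprn_continuous.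
apply: (@continuous_comp _ _ _ (fun t : R => t *: (x - q) + q) h).
  apply: (@continuousD _ _ _ (fun t : R => t *: (x - q)) (cst q)).
    exact: scalel_continuous.
  exact: cst_continuous.
by apply: ch; exact: starB.
Qed.

Lemma near_ball_sub h (y : V) (e : R) : Ck 1 B h -> B y -> 0 < e ->
  exists2 r : R, 0 < r & forall z, `|z - y| < r ->
    B z /\ forall j, `|'D_('e_j) h z - 'D_('e_j) h y| < e.
Proof.
move=> [_ Dh] By e0.
have : \forall z \near y, B z /\ forall j, `|'D_('e_j) h z - 'D_('e_j) h y| < e.
  apply: filterI; first exact: open_nbhs_nbhs.
  apply: (@filter_forall _ _
    (fun j z => `|'D_('e_j) h z - 'D_('e_j) h y| < e) (nbhs y)) => j.
  have /cvgrPdist_lt/(_ _ e0) := Dh 'e_j _ By.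
  by apply: filterS => z; rewrite distrC.
move=> /nbhs_normP[r r0 H]; exists r => // z zr; apply: H => /=.
by rewrite /ball_ /= distrC.
Qed.

Lemma deriveE_row_form h y v : differentiable h y ->
  'D_v h y = row_form (fun j => 'D_('e_j) h y) v.
Proof.
move=> dh; rewrite deriveE // {1}(row_sum_delta v) linear_sum.
by apply: eq_bigr => j _; rewrite linearZ /= deriveE.
Qed.

Lemma row_form_le (c : 'I_m -> R) v (e : R) : 0 <= e -> (forall j, `|c j| <= e) ->
  `|row_form c v| <= m%:R * e * `|v|.
Proof.
move=> e0 ce; rewrite /row_form (le_trans (ler_norm_sum _ _ _))//.
have -> : m%:R * e * `|v| = \sum_(j < m) (e * `|v|).
  by rewrite sumr_const card_ord -mulrA mulr_natl.
apply: ler_sum => j _; rewrite normrM mulrC.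
by apply: ler_pM => //; exact: coord_le_norm.
Qed.

(** A first-order expansion in [v] that is uniform in [t], so that it can be integrated. *)
Lemma segment_estimate k h x (e : R) : Ck 1 B h -> B x -> 0 < e ->
  \forall v \near (0 : V), forall t : R, 0 <= t <= 1 ->
    `|t ^+ k * h (t *: (v + x - q) + q) - t ^+ k * h (t *: (x - q) + q) -
      row_form (fun j => t ^+ k.+1 * 'D_('e_j) h (t *: (x - q) + q)) v|
      <= e * `|v|.
Proof.
move=> Ch Bx e0.
(* By compactness of the segment it is enough to treat [t] near a fixed [t0]. *)
have := (compact_near_coveringP `[(0 : R), 1]).1 (segment_compact (a:=0) (b:=1)).
move=> /(_ V (nbhs (0 : V)) (fun v t => 0 <= t <= 1 ->
    `|t ^+ k * h (t *: (v + x - q) + q) - t ^+ k * h (t *: (x - q) + q) -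
      row_form (fun j => t ^+ k.+1 * 'D_('e_j) h (t *: (x - q) + q)) v|
      <= e * `|v|) _) H.
have {H} : \forall v \near (0 : V), `[(0 : R), 1] `<=` (fun t => 0 <= t <= 1 ->
    `|t ^+ k * h (t *: (v + x - q) + q) - t ^+ k * h (t *: (x - q) + q) -
      row_form (fun j => t ^+ k.+1 * 'D_('e_j) h (t *: (x - q) + q)) v|
      <= e * `|v|).
  apply: H => t0; rewrite /= in_itv /= => t01.
  set y0 := t0 *: (x - q) + q; have By0 : B y0 by exact: starB.
  (* The factor 2 pays for comparing two partial derivatives through their value at [y0], and the
     other for summing [m] coordinates; [m.+1] keeps the divisor nonzero when [m] is 0. *)
  pose e' := e / (2 * m.+1%:R).
  have e'0 : 0 < e' by rewrite divr_gt0// mulr_gt0.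
  have [r r0 Hr] := near_ball_sub Ch By0 e'0.
  pose d := r / 2 / (`|x - q| + 1).
  have d0 : 0 < d by rewrite !divr_gt0// ltr_wpDl.
  exists ([set t | `|t - t0| < d], [set v | `|v| < r / 2]).
    split => /=.
      apply/nbhs_normP; exists d => //= t; by rewrite /ball_ /= distrC.
    have : \forall v \near (0 : V), `|v| < r / 2.
      by apply: nbhs0_lt; rewrite divr_gt0.
    by [].
  move=> [t v] /= [td vr] tin.
  (* Used for the intermediate point of the mean value theorem and, with [s = 0], for the base
     point. *)
  have close (s : R) : 0 <= s <= 1 ->
      `|s *: (t *: v) + (t *: (x - q) + q) - y0| < r.
    move=> s01.
    have -> : s *: (t *: v) + (t *: (x - q) + q) - y0 =
        (s * t) *: v + (t - t0) *: (x - q).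
      rewrite /y0 scalerBl scalerA -!addrA; congr (_ + (_ + _)).
      by rewrite opprD addrCA subrr addr0.
    rewrite (le_lt_trans (ler_normD _ _))// [ltRHS](splitr r) ltrD//.
      rewrite normrZ (le_lt_trans _ vr)// ler_piMl// ger0_norm.
        by move: s01 tin => /andP[? ?] /andP[? ?]; rewrite mulr_ile1.
      by move: s01 tin => /andP[? ?] /andP[? ?]; rewrite mulr_ge0.
    rewrite normrZ.
    have : `|t - t0| * (`|x - q| + 1) < r / 2.
      by rewrite -ltr_pdivlMr// ltr_wpDl.
    by apply: le_lt_trans; rewrite ler_wpM2l// lerDl.
  set y := t *: (x - q) + q.
  have yE : t *: (v + x - q) + q = t *: v + y by rewrite -addrA scalerDr -addrA.
  have dh (s : R) : 0 <= s <= 1 -> differentiable h (s *: (t *: v) + y).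
    by move=> s01; apply: Ch.1; exact: (Hr _ (close s s01)).1.
  have [s s01 hE] := line_mean_value dh.
  rewrite yE -mulrBr hE deriveE_row_form; last exact: dh.
  have -> : t ^+ k * row_form (fun j => 'D_('e_j) h (s *: (t *: v) + y)) (t *: v) -
      row_form (fun j => t ^+ k.+1 * 'D_('e_j) h y) v =
      row_form (fun j => t ^+ k.+1 *
        ('D_('e_j) h (s *: (t *: v) + y) - 'D_('e_j) h y)) v.
    rewrite /row_form mulr_sumr -sumrB; apply: eq_bigr => j _.
    by rewrite !mxE exprS; ring.
  have bnd j : `|t ^+ k.+1 * ('D_('e_j) h (s *: (t *: v) + y) - 'D_('e_j) h y)|
      <= 2 * e'.
    rewrite normrM (le_trans (ler_piMl _ _))//.
      rewrite normrX exprn_ile1//.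
      by rewrite ger0_norm//; case/andP: tin.
    have /Hr[_ /(_ j) D1] := close s s01.
    have : `|0 *: (t *: v) + (t *: (x - q) + q) - y0| < r.
      by apply: close; rewrite lexx ler01.
    rewrite scale0r add0r => /Hr[_ /(_ j) D2].
    rewrite -(subrKA ('D_('e_j) h y0)) (le_trans (ler_normD _ _))//.
    rewrite mulr_natl mulr2n ltW// ltrD// distrC //.
  apply: (le_trans (row_form_le _ _ bnd)); first by rewrite mulr_ge0// ltW.
  have -> : m%:R * (2 * e') = e * (m%:R / m.+1%:R).
    have : m.+1%:R != 0 :> R by rewrite pnatr_eq0.
    by rewrite /e'; move: m.+1%:R => N N0; field.
  rewrite ler_wpM2r// ler_piMr//; first exact: ltW.
  by rewrite ler_pdivrMr// mul1r ler_nat.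
by apply: filterS => v Hv t t01; apply: Hv => //=; rewrite in_itv.
Qed.

(** Differentiation under the integral sign: the uniform estimate is integrated over the unit
    interval, where its bound is constant in [t]. *)
Lemma segint_derive k h x : Ck 1 B h -> B x ->
  differentiable (segint k h) x /\
  forall v, 'D_v (segint k h) x = row_form (fun j => segint k.+1 ('D_('e_j) h) x) v.
Proof.
move=> Ch Bx; apply: derive_estimate => e e0.
have nB : \forall v \near (0 : V), B (v + x).
  have : \forall y \near x, B y by exact: open_nbhs_nbhs.
  by rewrite (near_shift 0) subr0.
apply: filterS2 nB (segment_estimate k Ch Bx e0) => v Bvx est.
have int1 : measurable (`[(0 : R), 1] : set (measurableTypeR R)) by [].
have Ch0 : Ck 0 B h by exact: Ck_leS.
have I1 := segint_integrable k Ch0 Bvx.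
have I2 := segint_integrable k Ch0 Bx.
have I3 j := segint_integrable k.+1 (Ch.2 'e_j) Bx.
have I4 j : mu.-integrable `[0, 1] (fun t => (v 0 j)%:E *
    (t ^+ k.+1 * 'D_('e_j) h (t *: (x - q) + q))%:E)%E.
  exact: (integrableZl int1 (v 0 j) (I3 j)).
pose F t := row_form (fun j => t ^+ k.+1 * 'D_('e_j) h (t *: (x - q) + q)) v.
have FE : EFin \o F = (fun t => (\sum_(j < m) (v 0 j)%:E *
    (t ^+ k.+1 * 'D_('e_j) h (t *: (x - q) + q))%:E)%E).
  by apply/funext => t /=; rewrite /F /row_form -sumEFin; apply: eq_bigr.
have IF : mu.-integrable `[0, 1] (EFin \o F).
  by rewrite FE; apply: integrable_sum.
have EF : row_form (fun j => segint k.+1 ('D_('e_j) h) x) v =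
    \int[mu]_(t in `[0, 1]) F t.
  rewrite /Rintegral.
  have -> : (\int[mu]_(t in `[0%R, 1%R]) (F t)%:E = \sum_(j < m)
      \int[mu]_(t in `[0%R, 1%R]) ((v 0%R j)%:E *
        (t ^+ k.+1 * 'D_('e_j) h (t *: (x - q) + q))%:E))%E.
    have -> : (fun t => (F t)%:E) = EFin \o F by [].
    by rewrite FE integral_sum.
  rewrite -sum_fine => [|j _].
    apply: eq_bigr => j _; rewrite (integralZl int1 (I3 j)) fineM//.
    exact: (integrable_fin_num int1 (I3 j)).
  exact: (integrable_fin_num int1 (I4 j)).
have I12 : mu.-integrable `[0, 1] (EFin \o (fun t =>
    t ^+ k * h (t *: (v + x - q) + q) - t ^+ k * h (t *: (x - q) + q))).
  exact: (integrableB int1 I1 I2).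
have I12F : mu.-integrable `[0, 1] (EFin \o (fun t =>
    t ^+ k * h (t *: (v + x - q) + q) - t ^+ k * h (t *: (x - q) + q) - F t)).
  exact: (integrableB int1 I12 IF).
rewrite EF /segint -(RintegralB int1 I1 I2) -(RintegralB int1 I12 IF).
rewrite (le_trans (le_normr_Rintegral int1 I12F))//.
have -> : e * `|v| = \int[mu]_(t in `[0, 1]) (e * `|v|).
  by rewrite Rintegral_cst//= lebesgue_measure_itv /= lte01 sube0 mulr1.
apply: le_Rintegral => //.
- exact: (integrable_norm I12F).
- apply: continuous_compact_integrable; first exact: segment_compact.
  by apply: continuous_subspaceT => ?; exact: cst_continuous.
Qed.

Lemma Ck_sum (V' : normedModType R) (W : normedModType R) n k (A : set V')
    (F : 'I_n -> V' -> W) : open A ->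
  (forall j, Ck k A (F j)) -> Ck k A (\sum_j F j).
Proof.
move=> oA CF; apply: (big_ind (fun f => Ck k A f)) => //.
  exact: (@Ck_cst _ _ _ k A 0).
by move=> f g; exact: Ck_D.
Qed.

(** The induction on the order must keep [k] and [h] general, since a derivative raises the weight
    and differentiates [h]. *)
Lemma segint_smooth k h : smooth_on B h -> smooth_on B (segint k h).
Proof.
move=> sh r; elim: r k h sh => [|r IH] k h sh /=.
  move=> x Bx; apply: differentiable_continuous.
  by have [] := segint_derive k (sh 1%N) Bx.
split=> [x Bx|v]; first by have [] := segint_derive k (sh 1%N) Bx.
apply: (@eq_Ck _ _ _ r B (\sum_j cst (v 0 j) * segint k.+1 ('D_('e_j) h))) => //.
  move=> x Bx; rewrite (segint_derive k (sh 1%N) Bx).2 fct_sumE.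
  by apply: eq_bigr.
apply: Ck_sum => // j; apply: Ck_M => //; first exact: Ck_cst.
by apply: IH => r'; exact: (sh r'.+1).2.
Qed.

Lemma hadamard h x : Ck 1 B h -> B x ->
  h x = h q + \sum_j (x - q) 0 j * segint 0 ('D_('e_j) h) x.
Proof.
move=> Ch Bx.
have dh (t : R) : 0 <= t <= 1 -> is_derive t 1 (fun t => h (t *: (x - q) + q))
    ('D_(x - q) h (t *: (x - q) + q)).
  by move=> t01; apply: is_derive_line; apply: Ch.1; exact: starB.
have cF (t : R) : 0 <= t <= 1 ->
    {for t, continuous (fun t : R => h (t *: (x - q) + q))}.
  move=> /dh[dF _]; apply: differentiable_continuous.
  exact/derivable1_diffP.
have FTC := @continuous_FTC2 R (fun t => 'D_(x - q) h (t *: (x - q) + q))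
  (fun t => h (t *: (x - q) + q)) 0 1 ltr01.
have int1 : measurable (`[(0 : R), 1] : set (measurableTypeR R)) by [].
have C0 := segint_integrable 0 (Ch.2 (x - q)) Bx.
have {}FTC : segint 0 ('D_(x - q) h) x = h x - h q.
  rewrite /segint /Rintegral.
  under eq_integral do rewrite expr0 mul1r.
  rewrite FTC /=.
  - by rewrite scale1r scale0r add0r subrK.
  - apply: continuous_in_subspaceT => t /set_mem; rewrite /= in_itv /= => t01.
    apply: (@continuous_comp _ _ _ (fun t : R => t *: (x - q) + q) ('D_(x - q) h)).
      apply: (@continuousD _ _ _ (fun t : R => t *: (x - q)) (cst q)).
        exact: scalel_continuous.
      exact: cst_continuous.
    by apply: Ch.2; exact: starB.
  - split.
    + move=> t; rewrite in_itv /= => /andP[t0 t1].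
      by have /dh[] : 0 <= t <= 1 by rewrite !ltW.
    + by apply: cvg_at_right_filter; apply: cF; rewrite lexx ler01.
    + by apply: cvg_at_left_filter; apply: cF; rewrite lexx ler01.
  - move=> t; rewrite in_itv /= => /andP[t0 t1].
    rewrite derive1E; have /dh[_ ->//] : 0 <= t <= 1 by rewrite !ltW.
rewrite addrC -[LHS](subrK (h q)) -FTC; congr (_ + _).
have -> : segint 0 ('D_(x - q) h) x =
    fine (\int[mu]_(t in `[0%R, 1%R]) \sum_(j < m) (((x - q) 0 j)%:E *
      (t ^+ 0 * 'D_('e_j) h (t *: (x - q) + q))%:E)).
  rewrite /segint /Rintegral; congr fine; apply: eq_integral => t.
  rewrite inE /= in_itv /= => t01.
  rewrite deriveE_row_form; last by apply: Ch.1; exact: starB.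
  rewrite /row_form mulr_sumr -sumEFin; apply: eq_bigr => j _.
  by rewrite mulrCA.
have I3 j := segint_integrable 0 (Ch.2 'e_j) Bx.
have I4 j : mu.-integrable `[0, 1] (fun t => ((x - q) 0 j)%:E *
    (t ^+ 0 * 'D_('e_j) h (t *: (x - q) + q))%:E)%E.
  exact: (integrableZl int1 ((x - q) 0 j) (I3 j)).
rewrite integral_sum// -sum_fine => [|j _]; last exact: (integrable_fin_num int1 (I4 j)).
apply: eq_bigr => j _; rewrite (integralZl int1 (I3 j)) fineM//.
exact: (integrable_fin_num int1 (I3 j)).
Qed.

End SegmentIntegral.

(** * Cutoff functions *)

Section Flat.
Context {R : realType}.

(* The junk value [0^-1 = 0] plays no role, as [flat k] vanishes on [t <= 0]. *)
Definition flat (k : nat) (t : R) : R :=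
  if 0 < t then t^-1 ^+ k * expR (- t^-1) else 0.

(** Quadratic decay gives differentiability at 0 with derivative 0. It comes from keeping the single
    term of degree [k.+2] in the exponential series at [t^-1]. *)
Lemma flat_le_sqr k (t : R) : `|flat k t| <= k.+2`!%:R * t ^+ 2.
Proof.
rewrite /flat; case: ltP => t0; last by rewrite normr0 mulr_ge0// sqr_ge0.
have u0 : 0 < t^-1 by rewrite invr_gt0.
rewrite ger0_norm; last by rewrite mulr_ge0 ?expR_ge0// exprn_ge0// ltW.
rewrite expRN.
rewrite ler_pdivrMr ?expR_gt0//.
have E := expR_ge1Dxn k.+1 (ltW u0).
have {}E : t^-1 ^+ k.+2 / k.+2`!%:R <= expR t^-1.
  by apply: le_trans E; rewrite lerDr ler01.
apply: (@le_trans _ _ (k.+2`!%:R * t ^+ 2 * (t^-1 ^+ k.+2 / k.+2`!%:R))).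
  have f0 : k.+2`!%:R != 0 :> R by rewrite pnatr_eq0 -lt0n fact_gt0.
  have -> : k.+2`!%:R * t ^+ 2 * (t^-1 ^+ k.+2 / k.+2`!%:R) = t^-1 ^+ k.
    rewrite mulrACA mulrC mulrA mulrAC !exprS.
    by field; rewrite f0 gt_eqF.
  by [].
by rewrite ler_wpM2l// mulr_ge0// sqr_ge0.
Qed.

(** The powers of [t^-1] are carried along precisely to close the family under differentiation;
    smoothness is then one induction for all [k] at once. *)
Lemma flat_is_derive k (t : R) :
  is_derive t 1 (flat k) (flat k.+2 t - k%:R * flat k.+1 t).
Proof.
have [t0|t0|t0] := ltgtP t 0.
- have -> : flat k.+2 t - k%:R * flat k.+1 t = 0.
    by rewrite /flat ltNge (ltW t0) /= mulr0 subrr.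
  apply: (@near_eq_is_derive _ _ _ (cst 0)).
  have := lt_nbhsl t0; apply: filterS => y y0.
  by rewrite /flat ltNge (ltW y0).
- have tn0 : t != 0 by rewrite gt_eqF.
  apply: (@near_eq_is_derive R R R (fun t : R => t^-1 ^+ k * expR (- t^-1))).
    by have := lt_nbhsr t0; apply: filterS => y y0; rewrite /flat y0.
  have D1 : is_derive t 1 (fun y : R => y^-1) (- t ^- 2).
    have := @is_deriveV _ id t 1 1 tn0 _; rewrite -[_ *: 1]/(_ * 1) mulr1; exact.
  have D2 : is_derive t 1 (fun y : R => expR (- y^-1)) (expR (- t^-1) * - (- t ^- 2)).
    exact: (@is_derive1_comp _ expR (fun y => - y^-1)).
  have D3 := is_deriveX k D1.
  have D4 := is_deriveM D3 D2.
  have -> : (fun t : R => t^-1 ^+ k * expR (- t^-1)) =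
      (fun y : R => y^-1) ^+ k * (fun y : R => expR (- y^-1)).
    by apply/funext => y; rewrite !fctE.
  apply: (is_derive_eq D4); rewrite /flat t0 -![_ *: _]/(_ * _).
  rewrite fctE -exprVn.
  by case: k {D3 D4} => [|k] /=; rewrite ?mul0r ?mulr0 ?expr0 ?exprS; ring.
- rewrite t0 [flat k.+2 0 - _](_ : _ = 0); last first.
    by rewrite /flat ltxx mulr0 subrr.
  have [||d D] := @diff_estimate R R R (flat k) \0 0.
  + by move=> x; exact: cst_continuous.
  + move=> e e0.
    have M0 : 0 < k.+2`!%:R :> R by rewrite ltr0n fact_gt0.
    have : \forall v \near (0 : R), `|v| < e / k.+2`!%:R.
      by apply: nbhs0_lt; rewrite divr_gt0.
    apply: filterS => v ve; rewrite addr0 /= subr0.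
    have -> : flat k 0 = 0 by rewrite /flat ltxx.
    rewrite subr0 (le_trans (flat_le_sqr _ _))//.
    rewrite -real_normK ?num_real// expr2 mulrA ler_wpM2r//.
    by rewrite mulrC -ler_pdivlMr// ltW.
  by apply: DeriveDef; [exact: diff_derivable|rewrite D].
Qed.

Lemma flat_comp_smooth (V : normedModType R) (A : set V) (s : V -> R) k :
  open A -> smooth_on A s -> smooth_on A (flat k \o s).
Proof.
move=> oA ss r; elim: r k => [|r IH] k.
  move=> x Ax; apply: continuous_comp; first exact: (ss 0%N).
  apply: differentiable_continuous; apply/derivable1_diffP.
  by have [] := flat_is_derive k (s x).
have df y : differentiable (flat k) y.
  by apply/derivable1_diffP; have [] := flat_is_derive k y.
have ds x : A x -> differentiable s x by exact: (ss 1%N).1.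
split=> [x Ax|v]; first by apply: differentiable_comp => //; exact: ds.
apply: (@eq_Ck _ _ _ r A ('D_v s *
    (flat k.+2 \o s + cst (- k%:R) * (flat k.+1 \o s)))) => //.
  move=> x Ax.
  rewrite [RHS]deriveE; last by apply: differentiable_comp => //; exact: ds.
  rewrite diff_comp//; last exact: ds.
  rewrite /= -(deriveE v (ds x Ax)).
  rewrite -['D_v s x in RHS]mulr1 -[_ * 1]/(_ *: 1) linearZ /= -deriveE//.
  have [_ ->] := flat_is_derive k (s x).
  by rewrite !fctE /= -[_ *: _]/(_ * _) mulNr.
apply: Ck_M => //; first exact: (ss r.+1).2.
by apply: Ck_D => //; apply: Ck_M => //; exact: Ck_cst.
Qed.

End Flat.

Section CkMore.
Context {R : realType}.

Lemma sub_Ck (V W : normedModType R) k (A B : set V) (f : V -> W) :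
  B `<=` A -> Ck k A f -> Ck k B f.
Proof.
move=> BA; elim: k f => [|k IH] f /=; first by move=> cf x /BA; exact: cf.
by move=> [df Df]; split=> [x /BA|v]; [exact: df|exact: IH].
Qed.

Lemma Ck_setU (V W : normedModType R) k (A B : set V) (f : V -> W) :
  Ck k A f -> Ck k B f -> Ck k (A `|` B) f.
Proof.
elim: k f => [|k IH] f /=.
  by move=> cA cB x [Ax|Bx]; [exact: cA|exact: cB].
move=> [dA DA] [dB DB]; split=> [x [Ax|Bx]|v]; [exact: dA|exact: dB|exact: IH].
Qed.

Lemma derive_row_form (V : normedModType R) m (c : 'I_m -> R)
    (psi : V -> 'rV[R]_m) x v : differentiable psi x ->
  'D_v (row_form c \o psi) x = row_form c ('D_v psi x).
Proof.
move=> dpsi.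
have dL y : differentiable (row_form c) y.
  by apply: linear_differentiable; exact: row_form_continuous.
rewrite deriveE; last exact: differentiable_comp.
by rewrite diff_comp//= diff_lin ?deriveE//; exact: row_form_continuous.
Qed.

Lemma Ck_row_form (V : normedModType R) m k (A : set V) (c : 'I_m -> R)
    (psi : V -> 'rV[R]_m) : open A -> Ck k A psi -> Ck k A (row_form c \o psi).
Proof.
move=> oA; elim: k psi => [|k IH] psi /=.
  move=> cpsi x Ax; apply: continuous_comp; first exact: cpsi.
  exact: row_form_continuous.
move=> [dpsi Dpsi]; split=> [x Ax|v].
  apply: differentiable_comp; first exact: dpsi.
  by apply: linear_differentiable; exact: row_form_continuous.
apply: (eq_Ck oA _ (IH _ (Dpsi v))) => x Ax.
by rewrite derive_row_form //; exact: dpsi.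
Qed.

Lemma row_form_delta m (v : 'rV[R]_m) j : row_form (fun i => (i == j)%:R) v = v 0 j.
Proof.
rewrite /row_form (bigD1 j)//= eqxx mulr1 big1 ?addr0// => i /negPf ->.
by rewrite mulr0.
Qed.

Lemma Ck_coord (V : normedModType R) m k (A : set V) (psi : V -> 'rV[R]_m) j :
  open A -> Ck k A psi -> Ck k A (fun x => psi x 0 j).
Proof.
move=> oA /(Ck_row_form (fun i => (i == j)%:R) oA).
by apply: eq_Ck => // x _ /=; exact: row_form_delta.
Qed.

Lemma Ck_id (V : normedModType R) k (A : set V) : Ck k A (id : V -> V).
Proof.
case: k => [|k]; first by move=> x _.
split=> [x _|v]; first by [].
have -> : 'D_v (id : V -> V) = cst v by apply/funext => x; rewrite derive_id.
exact: Ck_cst.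
Qed.

Lemma smooth_comp (V : normedModType R) m (A : set V) (B : set 'rV[R]_m)
    (f : 'rV[R]_m -> R) (psi : V -> 'rV[R]_m) : open A ->
  (forall x, A x -> B (psi x)) -> smooth_on B f -> smooth_on A psi ->
  smooth_on A (f \o psi).
Proof.
move=> oA AB sf spsi r; elim: r f sf => [|r IH] f sf.
  move=> x Ax; apply: continuous_comp; first exact: (spsi 0%N).
  by apply: (sf 0%N); exact: AB.
have df x : A x -> differentiable f (psi x).
  by move=> /AB; exact: (sf 1%N).1.
have dpsi x : A x -> differentiable psi x by exact: (spsi 1%N).1.
split=> [x Ax|v].
  by apply: differentiable_comp; [exact: dpsi|exact: df].
apply: (@eq_Ck _ _ _ r A
  (\sum_j (fun x => 'D_v psi x 0 j) * ('D_('e_j) f \o psi))) => //.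
  move=> x Ax; rewrite [RHS]deriveE; last first.
    by apply: differentiable_comp; [exact: dpsi|exact: df].
  rewrite diff_comp; [|exact: dpsi|exact: df].
  rewrite /= -(deriveE v (dpsi x Ax)) -(deriveE _ (df x Ax)).
  by rewrite deriveE_row_form ?fct_sumE//; exact: df.
apply: Ck_sum => // j; apply: Ck_M => //.
  by apply: Ck_coord => //; exact: (spsi r.+1).2.
by apply: IH => r'; exact: (sf r'.+1).2.
Qed.

End CkMore.

(** * Extension by zero of functions with compact support in a chart *)

Section ChartExtension.
Context {R : realType} {m : nat} (M : smoothManifold R m).
Implicit Types c : chart R m M.

Lemma chart_open_image c (O : set M) : open O ->
  open (chart_map c @` (chart_dom c `&` O)).
Proof.
move=> oO; rewrite openE => _ [x [dx Ox] <-].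
have ix : (chart_map c @` chart_dom c) (chart_map c x) by exists x.
have ci := chart_inv_continuous c _ (mem_set ix).
have nO : nbhs (chart_inv c (chart_map c x)) O.
  by rewrite (chart_mapK c _ (mem_set dx)); exact: open_nbhs_nbhs.
have nI : nbhs (chart_map c x) (chart_map c @` chart_dom c).
  by apply: open_nbhs_nbhs; split => //; exact: chart_img_open.
apply: filterS2 nI (ci _ nO) => _ [y dy <-].
rewrite /= (chart_mapK c _ (mem_set dy)) => Oy.
by exists y.
Qed.

Lemma chart_open_preimage c (B : set 'rV[R]_m) : open B ->
  open (chart_dom c `&` chart_map c @^-1` B).
Proof.
move=> oB; rewrite openE => x [dx Bx].
apply: filterI; first exact: (open_nbhs_nbhs (conj (chart_dom_open c) dx)).
by apply: (chart_map_continuous c _ (mem_set dx)); exact: open_nbhs_nbhs.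
Qed.

Definition chart_ext c (u : 'rV[R]_m -> R) (x : M) : R :=
  if x \in chart_dom c then u (chart_map c x) else 0.

(** The Hausdorff property enters here: the compact support is closed in [M], so the image of any
    other chart is covered by two open sets, one where the transition map to [c] is smooth into [B]
    and one where the extension vanishes. *)
Lemma chart_ext_smooth c (B K : set 'rV[R]_m) (u : 'rV[R]_m -> R) : atlas c ->
  open B -> B `<=` chart_map c @` chart_dom c -> smooth_on B u ->
  compact K -> K `<=` B -> (forall y, ~ K y -> u y = 0) ->
  chart_ext c u \in @smooth_pred R m M.
Proof.
move=> ac oB Bi su cK KB u0; apply/asboolP => c' ac' r.
have clK : closed (chart_inv c @` K).
  apply: compact_closed; first exact: manifold_hausdorff.
  apply: continuous_compact => //.
  apply: continuous_in_subspaceT => y /set_mem Ky.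
  by apply: chart_inv_continuous; apply/mem_set/Bi/KB.
pose U1 := chart_map c' @` (chart_dom c' `&` (chart_dom c `&` chart_map c @^-1` B)).
pose U2 := chart_map c' @` (chart_dom c' `&` ~` (chart_inv c @` K)).
apply: (@sub_Ck _ _ _ _ (U1 `|` U2)).
  move=> _ [x dx <-].
  have [Kx|nKx] := pselect ((chart_inv c @` K) x); last by right; exists x.
  left; exists x => //; split=> //.
  case: Kx => y Ky <-; have [z dz zy] := Bi _ (KB _ Ky).
  rewrite -zy (chart_mapK c _ (mem_set dz)); split => //=.
  by rewrite zy; exact: KB.
have oU1 : open U1 by apply/chart_open_image/chart_open_preimage.
have oU2 : open U2 by apply/chart_open_image/closed_openC.
apply: Ck_setU.
  have st : smooth_on U1 (chart_map c \o chart_inv c').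
    move=> k; apply: (sub_Ck _ (atlas_compatible _ _ ac' ac k)).
    by move=> _ [x [dx' [dx Bx]] <-]; exists x.
  have : Ck r U1 (u \o (chart_map c \o chart_inv c')).
    apply: (@smooth_comp _ _ _ U1 B) => //.
    by move=> _ [x [dx' [dx Bx]] <-] /=; rewrite (chart_mapK c' _ (mem_set dx')).
  apply: eq_Ck => // _ [x [dx' [dx Bx]] <-] /=.
  by rewrite (chart_mapK c' _ (mem_set dx')) /chart_ext (mem_set dx).
apply: (@eq_Ck _ _ _ r U2 (cst 0)) => //; last exact: Ck_cst.
move=> _ [x [dx' nK] <-] /=.
rewrite (chart_mapK c' _ (mem_set dx')) /chart_ext.
case: ifPn => // /set_mem dx; rewrite u0// => Kx; apply: nK.
by exists (chart_map c x) => //; rewrite (chart_mapK c _ (mem_set dx)).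
Qed.

End ChartExtension.

(** * Bump functions on coordinate space *)

Section Bump.
Context {R : realType} {m : nat}.
Local Notation V := 'rV[R]_m.
Implicit Types (a y : V).

(** The Euclidean square is smooth, unlike the sup norm of ['rV[R]_m]; since it dominates the square
    of the sup norm, the support still lies in the closed ball of radius [r]. *)
Definition radial_bump a (r : R) (y : V) : R :=
  flat 0 (r ^+ 2 - \sum_j (y 0 j - a 0 j) ^+ 2).

Lemma radial_bump_smooth a r (A : set V) : open A -> smooth_on A (radial_bump a r).
Proof.
move=> oA; apply: flat_comp_smooth => // k.
pose d j := (fun y : V => y 0 j) + cst (- a 0 j).
apply: (@eq_Ck _ _ _ k A (cst (r ^+ 2) + cst (- 1) * \sum_j d j * d j)) => //.
  move=> y _; rewrite !fctE; congr (_ + _); rewrite mulN1r; congr (- _).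
  by rewrite !fct_sumE; apply: eq_bigr => j _; rewrite /d !fctE expr2.
have Cd j : Ck k A (d j).
  by apply: Ck_D => //; [apply: Ck_coord => //; exact: Ck_id|exact: Ck_cst].
apply: Ck_D => //; first exact: Ck_cst.
apply: Ck_M => //; first exact: Ck_cst.
by apply: Ck_sum => // j; exact: Ck_M.
Qed.

Lemma radial_bump_center a r : 0 < r -> radial_bump a r a != 0.
Proof.
move=> r0; rewrite /radial_bump big1 => [|j _]; last by rewrite subrr expr0n.
by rewrite subr0 /flat exprn_gt0// expr0 mul1r gt_eqF// expR_gt0.
Qed.

Lemma radial_bump_support a r y : 0 < r -> ~ closed_ball a r y -> radial_bump a r y = 0.
Proof.
move=> r0; rewrite closed_ballE// => nK; rewrite /radial_bump /flat.
case: ltP => // s0; exfalso; apply: nK.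
rewrite /closed_ball_ /= [leLHS]/Num.Def.normr /= mx_normrE.
apply: bigmax_le => [|[i j] _] /=; first exact: ltW.
have rn : r \in Num.nneg by rewrite nnegrE ltW.
rewrite ord1 !mxE -ler_sqr ?nnegrE// real_normK ?num_real//.
rewrite -[X in X ^+ 2]opprB sqrrN ltW//.
apply: (le_lt_trans _ (_ : \sum_j (y 0 j - a 0 j) ^+ 2 < _)); last first.
  by rewrite -subr_gt0.
by rewrite [leRHS](bigD1 j)//= lerDl sumr_ge0// => *; exact: sqr_ge0.
Qed.

Lemma closed_ball_compact a r : 0 < r -> compact (closed_ball a r).
Proof.
move=> r0; apply: bounded_closed_compact; last exact: closed_ball_closed.
rewrite closed_ballE//; exists (`|a| + r); split; first exact: num_real.
move=> x /ltW ax y /=; rewrite /closed_ball_ /= => ay.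
rewrite (le_trans _ ax)// -[y](subrK a) addrC (le_trans (ler_normD _ _))//.
by rewrite lerD2l distrC.
Qed.

Lemma ball_segment a r q x (t : R) : ball a r q -> ball a r x -> 0 <= t <= 1 ->
  ball a r (t *: (x - q) + q).
Proof.
rewrite -ball_normE /ball_ /= => qr xr /andP[t0 t1].
have -> : a - (t *: (x - q) + q) = t *: (a - x) + (1 - t) *: (a - q).
  by apply/rowP => i; rewrite !mxE; ring.
apply: (le_lt_trans (ler_normD _ _)); rewrite !normrZ.
rewrite ger0_norm// [`|1 - t|]ger0_norm ?subr_ge0//.
have [->|tn0] := eqVneq t 0; first by rewrite mul0r add0r subr0 mul1r.
have tp : 0 < t by rewrite lt_neqAle eq_sym tn0.
apply: (@lt_le_trans _ _ (t * r + (1 - t) * r)).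
  by rewrite ltr_leD ?ltr_pM2l// ler_wpM2l ?subr_ge0// ltW.
by rewrite -mulrDl addrC subrK mul1r.
Qed.

End Bump.

(** * Vector fields and orthonormal frames *)

Section VectorFieldTheory.
Context {R : realType} {m : nat} {M : smoothManifold R m}.
Local Notation C := (smoothfun M).
Implicit Types (X Y : vfield M) (f g : C) (a : R).

Lemma scst1 : scst M 1 = 1 :> C. Proof. exact/val_inj. Qed.
Lemma scst0 : scst M 0 = 0 :> C. Proof. exact/val_inj. Qed.
Lemma scstD a b : scst M (a + b) = scst M a + scst M b :> C.
Proof. exact/val_inj. Qed.
Lemma scstM a b : scst M (a * b) = scst M a * scst M b :> C.
Proof. exact/val_inj. Qed.
Lemma scstN a : scst M (- a) = - scst M a :> C.
Proof. exact/val_inj. Qed.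

Lemma scst_nat n : scst M n%:R = n%:R :> C.
Proof.
elim: n => [|n IH]; first exact: scst0.
by rewrite -natr1 scstD IH scst1 natr1.
Qed.

(** Smooth functions do not form a domain in general; cancellation is available for nonzero
    constants because they are units. *)
Lemma scst_mulI (a : R) : a != 0 -> injective (fun f : C => scst M a * f).
Proof.
move=> a0 f f' /(congr1 (fun u => scst M a^-1 * u)).
by rewrite !mulrA -scstM mulVf// scst1 !mul1r.
Qed.

Lemma smoothfun_double_eq0 (f : C) : f + f = 0 -> f = 0.
Proof.
have n2 : 2%:R != 0 :> R by rewrite pnatr_eq0.
move=> f0; apply: (scst_mulI n2); rewrite scst_nat mulr0 -f0; ring.
Qed.

Lemma vfieldM X f g : X (f * g) = X f * g + f * X g :> C.
Proof. by have /asboolP[_] := vfieldP X. Qed.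

Lemma vfieldD X f g : X (f + g) = X f + X g :> C.
Proof.
have /asboolP[/(_ 1 f g)] := vfieldP X.
by rewrite scst1 !mul1r.
Qed.

Lemma vfield_scst X a : X (scst M a) = 0 :> C.
Proof.
have /asboolP[H _] := vfieldP X.
have X1 : X 1 = 0.
  have := vfieldM X 1 1; rewrite !mulr1 mul1r => /eqP.
  by rewrite -subr_eq subrr => /eqP.
have X0 : X 0 = 0.
  by have := vfieldD X 0 0; rewrite addr0 => /eqP; rewrite -subr_eq subrr => /eqP.
by have := H a 1 0; rewrite mulr1 !addr0 X1 X0 mulr0 addr0.
Qed.

Lemma vfield0 X : X 0 = 0 :> C.
Proof. exact: etrans (congr1 X (esym scst0)) (vfield_scst X 0). Qed.

Lemma vfieldN X f : X (- f) = - X f :> C.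
Proof. by apply/eqP; rewrite -addr_eq0 -vfieldD addNr vfield0. Qed.

Lemma vfieldB X f g : X (f - g) = X f - X g :> C.
Proof. by rewrite vfieldD vfieldN. Qed.

Lemma vfield_sum X I r (P : pred I) (F : I -> C) :
  X (\sum_(i <- r | P i) F i) = \sum_(i <- r | P i) X (F i) :> C.
Proof.
apply: (big_morph X (vfieldD X)); exact: vfield0.
Qed.

Lemma vfieldDE X Y f : (X + Y) f = X f + Y f :> C. Proof. by []. Qed.
Lemma vfieldZE f X g : (f *: X) g = f * X g :> C. Proof. by []. Qed.
Lemma vfieldNE X f : (- X) f = - X f :> C. Proof. by []. Qed.
Lemma vfield_sumE I r (P : pred I) (F : I -> vfield M) f :
  (\sum_(i <- r | P i) F i) f = \sum_(i <- r | P i) F i f :> C.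
Proof. by apply: (big_morph (fun X : vfield M => X f)). Qed.

Lemma vfield_ext X Y : (forall f, X f = Y f) -> X = Y.
Proof. by move=> XY; apply/val_inj/funext. Qed.

Lemma smoothfun_ext f g : (forall p, f p = g p) -> f = g.
Proof. by move=> fg; apply/val_inj/funext. Qed.

Lemma smoothfunDE f g p : (f + g) p = f p + g p. Proof. by []. Qed.
Lemma smoothfunME f g p : (f * g) p = f p * g p. Proof. by []. Qed.
Lemma smoothfunNE f p : (- f) p = - f p. Proof. by []. Qed.
Lemma smoothfun_sumE I r (P : pred I) (F : I -> C) p :
  (\sum_(i <- r | P i) F i) p = \sum_(i <- r | P i) F i p.
Proof. by apply: (big_morph (fun f : C => f p)). Qed.

Lemma scalar_formZ (L : {scalar vfield M}) f X : L (f *: X) = f * L X.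
Proof. by rewrite linearZ. Qed.

End VectorFieldTheory.

(** * Coordinate functions and coordinate fields cut off to global objects *)

Section CutoffFrame.
Context {R : realType} {m : nat} (M : smoothManifold R m).
Local Notation C := (smoothfun M).
Local Notation V := 'rV[R]_m.
Variables (c : chart R m M) (a : V) (r : R).
Hypothesis ac : atlas c.
Hypothesis r0 : 0 < r.
Hypothesis rc : ball a r `<=` chart_map c @` chart_dom c.

Let B := ball a r.
(** Half the radius keeps the closed support of the bump inside the open ball [B]. *)
Let b := radial_bump a (r / 2).

Let oB : open B. Proof. exact: ball_open. Qed.

Let sb : smooth_on B b. Proof. exact: radial_bump_smooth. Qed.

Lemma cutoff_smooth u : smooth_on B u -> chart_ext c (b * u) \in @smooth_pred R m M.
Proof.
move=> su; apply: (@chart_ext_smooth _ _ _ _ B (closed_ball a (r / 2))) => //.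
- by move=> k; apply: Ck_M.
- by apply: closed_ball_compact; rewrite divr_gt0.
- exact: subset_closure_half.
- by move=> y /radial_bump_support bs; rewrite fctE /b bs ?divr_gt0// mul0r.
Qed.

Definition cutoff u (su : smooth_on B u) : C := SmoothFun (cutoff_smooth su).

Lemma cutoff_in u (su : smooth_on B u) x : chart_dom c x ->
  cutoff su x = b (chart_map c x) * u (chart_map c x).
Proof. by move=> dx; rewrite /cutoff /= /chart_ext (mem_set dx). Qed.

Lemma cutoff_out u (su : smooth_on B u) x : ~ chart_dom c x -> cutoff su x = 0.
Proof.
by move=> dx; rewrite /cutoff /= /chart_ext; case: ifPn => // /set_mem.
Qed.

Let s1 : smooth_on B (cst 1 : V -> R). Proof. by move=> k; exact: Ck_cst. Qed.

Let sx j : smooth_on B (fun y : V => y 0 j).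
Proof. by move=> k; apply: Ck_coord => //; exact: Ck_id. Qed.

Let sf (f : C) : smooth_on B (f \o chart_inv c).
Proof.
move=> k; apply: (sub_Ck rc).
by have /asboolP := smoothfunP f; exact.
Qed.

Let sd (f : C) j : smooth_on B ('D_('e_j) (f \o chart_inv c)).
Proof. by move=> k; exact: (sf f k.+1).2. Qed.

Let dB (f : C) y : B y -> differentiable (f \o chart_inv c) y.
Proof. exact: (sf f 1).1. Qed.

Let b_out y : ~ B y -> b y = 0.
Proof.
move=> nB; apply: radial_bump_support; first by rewrite divr_gt0.
by move=> K; apply: nB; exact: subset_closure_half.
Qed.

Definition cutoff1 : C := cutoff s1.
Definition cutoff_coord j : C := cutoff (sx j).
Definition cutoff_derive j (f : C) : C := cutoff (sd f j).

Lemma cutoff_derive_derivation j :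
  (cutoff_derive j : C -> C^o) \in @derivation_pred R m M.
Proof.
have E (F G : C) : (forall x, chart_dom c x -> B (chart_map c x) -> F x = G x) ->
    (forall x, chart_dom c x -> ~ B (chart_map c x) -> F x = G x) ->
    (forall x, ~ chart_dom c x -> F x = G x) -> F = G.
  move=> H1 H2 H3; apply: smoothfun_ext => x.
  have [dx|dx] := pselect (chart_dom c x); last exact: H3.
  by have [Bx|Bx] := pselect (B (chart_map c x)); [exact: H1|exact: H2].
apply/asboolP; split=> [k f g|f g].
- apply: E => x dx; rewrite ?smoothfunDE ?smoothfunME.
  + move=> Bx; rewrite !cutoff_in//.
    have -> : (scst M k * f + g : C) \o chart_inv c =
        cst k * (f \o chart_inv c) + (g \o chart_inv c) by [].
    have D (h : C) : derivable (h \o chart_inv c) (chart_map c x) 'e_j.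
      by apply: diff_derivable; exact: (@dB h).
    rewrite deriveD; last exact: D; last by apply: derivableM;
      [exact: derivable_cst|exact: D].
    rewrite deriveM; [|exact: derivable_cst|exact: D].
    rewrite derive_cst scaler0 addr0 /= -[_ *: _]/(_ * _).
    by ring.
  + by move=> Bx; rewrite !cutoff_in// b_out// !mul0r mulr0 addr0.
  + by rewrite !cutoff_out// mulr0 addr0.
- apply: E => x dx; rewrite ?smoothfunDE ?smoothfunME.
  + move=> Bx; rewrite !cutoff_in//.
    have -> : (f * g : C) \o chart_inv c =
        (f \o chart_inv c) * (g \o chart_inv c) by [].
    have D (h : C) : derivable (h \o chart_inv c) (chart_map c x) 'e_j.
      by apply: diff_derivable; exact: (@dB h).
    rewrite deriveM; [|exact: D|exact: D].
    rewrite /= -![_ *: _]/(_ * _) (chart_mapK c _ (mem_set dx)).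
    by ring.
  + by move=> Bx; rewrite !cutoff_in// b_out// !mul0r mulr0 addr0.
  + by rewrite !cutoff_out// mulr0 mul0r addr0.
Qed.

Definition cutoff_field j : vfield M := VField (cutoff_derive_derivation j).

(* With [chi = cutoff1] and [y_j = cutoff_coord j], Hadamard's lemma gives
   [chi^3 f = chi^3 f(q) + sum_j (y_j - x_j(q) chi) chi (chi g_j)] globally; apply
   [X] and evaluate at [q]. *)
Lemma cutoff_decomposition (X : vfield M) :
  (cutoff1 * cutoff1 * cutoff1) *: X = \sum_j
    (cutoff1 * X (cutoff_coord j) - cutoff_coord j * X cutoff1) *: cutoff_field j.
Proof.
apply: vfield_ext => f; rewrite vfieldZE vfield_sumE; apply: smoothfun_ext => q.
under eq_bigr do rewrite vfieldZE.
rewrite smoothfun_sumE !smoothfunME.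
have triv : cutoff1 q = 0 -> (forall j, cutoff_derive j f q = 0) ->
    cutoff1 q * cutoff1 q * cutoff1 q * X f q = \sum_j
      ((cutoff1 * X (cutoff_coord j) - cutoff_coord j * X cutoff1) *
        cutoff_field j f) q.
  move=> -> d0; rewrite !mul0r big1// => j _; rewrite smoothfunME.
  by rewrite [cutoff_field j f q]d0 mulr0.
have [dq|dq] := pselect (chart_dom c q); last first.
  by apply: triv => [|j]; rewrite cutoff_out.
have [Bq|Bq] := pselect (B (chart_map c q)); last first.
  by apply: triv => [|j]; rewrite cutoff_in// b_out// mul0r.
set Q := chart_map c q; pose h := f \o chart_inv c.
have star x (t : R) : B x -> 0 <= t <= 1 -> B (t *: (x - Q) + Q).
  exact: ball_segment.
have sg j : smooth_on B (segint Q 0 ('D_('e_j) h)).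
  exact: (segint_smooth oB star 0 (sd f j)).
pose G j := cutoff (sg j).
have GQ j : G j q = cutoff_derive j f q.
  (* At the base point the segment is degenerate and the integrand constant. *)
  rewrite !cutoff_in//; congr (_ * _); rewrite /segint -/Q subrr.
  under eq_Rintegral do rewrite expr0 mul1r scaler0 add0r.
  by rewrite Rintegral_cst//= lebesgue_measure_itv /= lte01 sube0 mulr1.
have id3 : cutoff1 * cutoff1 * cutoff1 * f =
    cutoff1 * cutoff1 * cutoff1 * scst M (h Q) +
    \sum_j (cutoff_coord j - scst M (Q 0 j) * cutoff1) * (cutoff1 * G j).
  apply: smoothfun_ext => x; rewrite smoothfunDE smoothfun_sumE !smoothfunME.
  have [dx|dx] := pselect (chart_dom c x); last first.
    rewrite !cutoff_out// !mul0r add0r big1// => j _.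
    by rewrite !smoothfunME cutoff_out// mul0r mulr0.
  have [Bx|Bx] := pselect (B (chart_map c x)); last first.
    rewrite !cutoff_in// b_out// !mul0r add0r big1// => j _.
    by rewrite !smoothfunME cutoff_in// b_out// !mul0r mulr0.
  have fx : f x = h (chart_map c x) by rewrite /h /= (chart_mapK c _ (mem_set dx)).
  rewrite fx [h (chart_map c x)](hadamard star (sf f 1%N) Bx).
  rewrite mulrDr; congr (_ + _); rewrite mulr_sumr; apply: eq_bigr => j _.
  rewrite !smoothfunME smoothfunDE smoothfunNE !smoothfunME !cutoff_in// !mxE.
  by rewrite -[scst M _ x]/(Q 0 j) -[cst 1 _]/1; ring.
(* In each summand the first factor vanishes at [q], so only the Leibniz term where [X] hits it
   survives; the terms differentiating the cube of the cutoff cancel because [h Q] is the value of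
   [f] at [q]. *)
have /(congr1 (fun u : C => X u q)) := id3.
rewrite vfieldD vfield_sum !vfieldM vfield_scst mulr0 addr0 !smoothfunDE smoothfun_sumE.
rewrite !smoothfunME !smoothfunDE !smoothfunME !smoothfunDE !smoothfunME.
have -> : (f q : R) = scst M (h Q) q by rewrite /= /h /= (chart_mapK c _ (mem_set dq)).
move=> /addrI ->; apply: eq_bigr => j _.
rewrite vfieldM vfieldB vfieldM vfield_scst mul0r add0r.
rewrite !smoothfunDE !smoothfunME !smoothfunDE !smoothfunNE !smoothfunME.
rewrite -[cutoff_field j f q]GQ.
have -> : cutoff_coord j q = scst M (Q 0 j) q * cutoff1 q.
  by rewrite !cutoff_in// -[cst 1 _]/1 mulr1 mulrC.
by ring.
Qed.

(** The subtracted term cancels the one in which the bump is differentiated. What remains is an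
    invertible diagonal matrix, which gives the linear independence of the cut-off fields at [p]. *)
Lemma cutoff_coord_derive p i j : chart_dom c p -> chart_map c p = a ->
  cutoff_field j (cutoff_coord i) p - a 0 i * cutoff_field j cutoff1 p =
    (i == j)%:R * b a ^+ 2.
Proof.
move=> dp pa; rewrite !cutoff_in// pa.
have Ba : B a by exact: ballxx.
have nB : \forall y \near a, B y by apply: open_nbhs_nbhs.
have db : derivable b a 'e_j by apply: diff_derivable; exact: (sb 1).1.
have -> : 'D_('e_j) (cutoff1 \o chart_inv c) a = 'D_('e_j) b a.
  apply: near_eq_derive; apply: filterS nB => y /rc[x dx <-].
  rewrite -[LHS]/(cutoff1 (chart_inv c (chart_map c x))).
  by rewrite (chart_mapK c _ (mem_set dx)) cutoff_in// -[cst 1 _]/1 mulr1.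
have -> : 'D_('e_j) (cutoff_coord i \o chart_inv c) a =
    'D_('e_j) (b * (fun y : V => y 0 i)) a.
  apply: near_eq_derive; apply: filterS nB => y /rc[x dx <-].
  rewrite -[LHS]/(cutoff_coord i (chart_inv c (chart_map c x))).
  by rewrite (chart_mapK c _ (mem_set dx)) cutoff_in.
have dx : derivable (fun y : V => y 0 i) a 'e_j.
  by apply: diff_derivable; exact: (sx i 1).1.
have Dx : 'D_('e_j) (fun y : V => y 0 i) a = (i == j)%:R.
  have -> : (fun y : V => y 0 i) = row_form (fun k => (k == i)%:R) \o id.
    by apply/funext => y /=; rewrite row_form_delta.
  by rewrite derive_row_form// derive_id row_form_delta mxE eqxx.
by rewrite deriveM// Dx -![_ *: _]/(_ * _); ring.
Qed.

End CutoffFrame.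

(** A basis of the tangent space at [p], expressed through fields: spanning means that one
    coefficient vector serves all linear forms at once. The coefficients are those of the
    decomposition above, divided by the cube of the cutoff, which is nonzero at [p]. *)
Lemma local_frame (R : realType) (m : nat) (M : smoothManifold R m) (p : M) :
  exists d : 'I_m -> vfield M,
    (forall v : 'I_m -> R, (exists j, v j != 0) ->
      nonzero_at p (\sum_j scst M (v j) *: d j)) /\
    (forall X : vfield M, exists v : 'I_m -> R, forall L : {scalar vfield M},
      L X p = \sum_j v j * L (d j) p).
Proof.
have [c ac dp] := atlas_cover p.
have : nbhs (chart_map c p) (chart_map c @` chart_dom c).
  by apply: open_nbhs_nbhs; split; [exact: chart_img_open|exists p].
move=> /nbhs_ballP[r r0 rc].
have b0 : radial_bump (chart_map c p) (r / 2) (chart_map c p) != 0.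
  by apply: radial_bump_center; rewrite divr_gt0.
exists (cutoff_field ac r0 rc); split=> [v [i vi]|X].
  have [H|H] := pselect (nonzero_at p (\sum_j scst M (v j) *: cutoff_field ac r0 rc j)).
    by [].
  have {}H f : (\sum_j scst M (v j) *: cutoff_field ac r0 rc j) f p = 0.
    by apply/eqP/negP => /negP nz; apply: H; exists f.
  exfalso; move/eqP: vi; apply.
  (* A combination vanishing at [p] is tested on the [i]-th cut-off coordinate recentred at [p];
     this isolates [v i]. *)
  have : \sum_j v j * (cutoff_field ac r0 rc j (cutoff_coord ac r0 rc i) p -
      chart_map c p 0 i * cutoff_field ac r0 rc j (cutoff1 ac r0 rc) p) = 0.
    have Hf f : \sum_j v j * cutoff_field ac r0 rc j f p = 0.
      by rewrite -[RHS](H f) vfield_sumE smoothfun_sumE.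
    transitivity (\sum_j v j * cutoff_field ac r0 rc j (cutoff_coord ac r0 rc i) p -
      chart_map c p 0 i *
        \sum_j v j * cutoff_field ac r0 rc j (cutoff1 ac r0 rc) p); last first.
      by rewrite !Hf mulr0 subrr.
    rewrite mulr_sumr -sumrB; apply: eq_bigr => j _.
    by rewrite mulrBr; congr (_ - _); rewrite mulrCA.
  rewrite (bigD1 i)//= big1 => [|j ji].
    rewrite addr0 cutoff_coord_derive// eqxx mul1r => /eqP.
    by rewrite mulf_eq0 expf_eq0 /= (negPf b0) orbF => /eqP.
  by rewrite cutoff_coord_derive// eq_sym (negPf ji) mul0r mulr0.
pose chi := cutoff1 ac r0 rc.
have chi0 : chi p * chi p * chi p != 0.
  by rewrite /chi cutoff_in// -[cst 1 _]/1 mulr1 !mulf_neq0.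
exists (fun j => (chi p * chi p * chi p)^-1 *
  (chi * X (cutoff_coord ac r0 rc j) - cutoff_coord ac r0 rc j * X chi) p) => L.
apply: (mulfI chi0).
have /(congr1 (fun Y => L Y p)) := cutoff_decomposition ac r0 rc X.
rewrite scalar_formZ !smoothfunME => ->.
rewrite linear_sum smoothfun_sumE mulr_sumr; apply: eq_bigr => j _.
by rewrite scalar_formZ smoothfunME !mulrA mulfV// mul1r.
Qed.

(** * Orthonormal frames at a point and the Parseval identity *)

Section OrthonormalFrame.
Context {R : realType}.

(** Gram-Schmidt by counting ranks instead of projecting: while there are fewer than [m] rows, some
    nonzero vector is [G]-orthogonal to all of them, and it only has to be normalised. *)
Lemma posdef_orthonormalization m (G : 'M[R]_m) : G^T = G ->
  (forall v : 'rV[R]_m, v != 0 -> 0 < (v *m G *m v^T) 0 0) ->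
  exists A : 'M[R]_m, A *m G *m A^T = 1%:M.
Proof.
move=> symG posG.
suff H k : (k <= m)%N -> exists A : 'M[R]_(k, m), A *m G *m A^T = 1%:M by exact: H.
elim: k => [_|k IH km]; first by exists 0; rewrite [LHS]flatmx0 [RHS]flatmx0.
have [A AG] := IH (ltnW km).
have : kermx (A *m G)^T != 0.
  rewrite -mxrank_eq0 mxrank_ker subn_eq0 -ltnNge mxrank_tr.
  exact: leq_ltn_trans (rank_leq_row _) km.
move=> /rowV0Pn[u /sub_kermxP uker u0].
have uGA : u *m G *m A^T = 0.
  by rewrite -uker trmx_mul symG mulmxA.
have AGu : A *m G *m u^T = 0.
  by apply: (can_inj trmxK); rewrite !trmx_mul trmxK symG trmx0 mulmxA.
have s0 := posG _ u0; set s := (u *m G *m u^T) 0 0 in s0.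
pose w := (Num.sqrt s)^-1 *: u.
have ss : Num.sqrt s != 0 by rewrite gt_eqF// sqrtr_gt0.
have ww : w *m G *m w^T = 1%:M.
  rewrite /w linearZ /= -!scalemxAl -scalemxAr scalerA.
  rewrite [u *m G *m u^T]mx11_scalar -/s scale_scalar_mx; congr (_%:M).
  by rewrite -invfM -expr2 sqr_sqrtr ?ltW// mulVf// gt_eqF.
suff E : col_mx w A *m G *m (col_mx w A)^T = 1%:M by exists (col_mx w A).
rewrite mul_col_mx tr_col_mx mul_col_row ww AG.
rewrite {1}/w -!scalemxAl uGA scaler0 /w linearZ /= -scalemxAr AGu scaler0.
by rewrite -scalar_mx_block.
Qed.

Context {m : nat} {M : smoothManifold R m}.
Variable g : {symmetric (vfield M)}.

Lemma metricC X Y : g X Y = g Y X.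
Proof. by rewrite hermC expr0 mul1r. Qed.

Lemma metricZl X Y f : g (f *: X) Y = f * g X Y.
Proof. by rewrite linearZl_LR. Qed.

Lemma metricDl X Y Z : g (X + Y) Z = g X Z + g Y Z.
Proof. exact: linearDl. Qed.

Lemma metricNl X Y : g (- X) Y = - g X Y.
Proof. exact: linearNl. Qed.

Lemma metric0l Y : g 0 Y = 0.
Proof. exact: linear0l. Qed.

Lemma metric_suml I r (P : pred I) (F : I -> vfield M) Y :
  g (\sum_(i <- r | P i) F i) Y = \sum_(i <- r | P i) g (F i) Y.
Proof.
apply: (big_morph (fun X => g X Y)) => [X Z|]; [exact: metricDl|exact: metric0l].
Qed.

Lemma metricZr X Y f : g X (f *: Y) = f * g X Y.
Proof. by rewrite metricC metricZl metricC. Qed.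

Lemma metricDr X Y Z : g X (Y + Z) = g X Y + g X Z.
Proof. by rewrite !(metricC X) metricDl. Qed.

Lemma metricNr X Y : g X (- Y) = - g X Y.
Proof. by rewrite !(metricC X) metricNl. Qed.

Lemma metric0r X : g X 0 = 0.
Proof. by rewrite metricC metric0l. Qed.

Lemma metric_sumr I r (P : pred I) (F : I -> vfield M) X :
  g X (\sum_(i <- r | P i) F i) = \sum_(i <- r | P i) g X (F i).
Proof. by rewrite metricC metric_suml; under eq_bigr do rewrite metricC. Qed.

Definition metric_lform (Y : vfield M) : vfield M -> smoothfun M := fun X => g X Y.

Lemma metric_lform_linear Y : scalar (metric_lform Y).
Proof. by move=> f X Z; rewrite /metric_lform metricDl metricZl. Qed.

HB.instance Definition _ Y := @GRing.isLinear.Build _ _ _ _ (metric_lform Y)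
  (metric_lform_linear Y).

(** Existence matters because [frame_at] would otherwise return the zero family. The frame combines
    a local frame with constant coefficients, orthonormalised for its Gram matrix at [p]. *)
Lemma frame_at_orthonormal p : riemannian_metric g ->
  orthonormal_at g p (frame_at g p).
Proof.
move=> posg; have [d [ind _]] := local_frame p.
pose G := \matrix_(i, j) g (d i) (d j) p.
have gE (u v : 'rV[R]_m) : g (\sum_j scst M (u 0 j) *: d j)
    (\sum_j scst M (v 0 j) *: d j) p = (u *m G *m v^T) 0 0.
  rewrite metric_sumr smoothfun_sumE mxE; apply: eq_bigr => j _.
  rewrite metricZr smoothfunME metric_suml smoothfun_sumE !mxE mulrC.
  congr (_ * _); apply: eq_bigr => i _; rewrite metricZl smoothfunME.
  by rewrite !mxE.
have [||A AG] := @posdef_orthonormalization m G.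
- by apply/matrixP => i j; rewrite !mxE metricC.
- move=> v /eqP v0; rewrite -gE; apply: posg; apply: ind.
  have [//|nv] := pselect (exists j, v 0 j != 0).
  exfalso; apply: v0; apply/rowP => j; rewrite mxE.
  by apply/eqP/negP => /negP vj; apply: nv; exists j.
apply: (@xgetPex _ 0 [set E | orthonormal_at g p E]).
exists (fun a => \sum_j scst M (A a j) *: d j) => a b.
have -> : (a == b)%:R = (1%:M : 'M[R]_m) a b by rewrite mxE.
have rA i : \sum_j scst M (A i j) *: d j = \sum_j scst M (row i A 0 j) *: d j.
  by apply: eq_bigr => j _; rewrite mxE.
rewrite !rA gE -AG -row_mul mxE [RHS]mxE; apply: eq_bigr => j _.
by rewrite !mxE.
Qed.

(** Orthonormality of [m] fields says that [A] and [G *m A^T] are inverse in one order; for square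
    matrices they are then inverse in the other order, which is completeness. *)
Lemma parseval p (E : 'I_m -> vfield M) (L : {scalar (vfield M)}) X :
  orthonormal_at g p E ->
  L X p = \sum_a g X (E a) p * L (E a) p.
Proof.
move=> oE; have [d [_ dec]] := local_frame p.
have [v vE] := choice dec.
pose G := \matrix_(i, j) g (d i) (d j) p.
pose A := \matrix_(a, j) v (E a) j.
pose l := \col_j L (d j) p.
have gE Y a : g Y (E a) p = (\row_j v Y j *m G *m A^T) 0 a.
  have gd X' Y' : g X' Y' p = \sum_j v X' j * g (d j) Y' p.
    exact: (vE X' (metric_lform Y')).
  rewrite gd -mulmxA mxE; apply: eq_bigr => i _; rewrite mxE; congr (_ * _).
  rewrite metricC gd mxE.
  by apply: eq_bigr => j _; rewrite !mxE mulrC metricC.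
have AG : A *m (G *m A^T) = 1%:M.
  apply/matrixP => a b; rewrite [RHS]mxE -oE gE mulmxA.
  have -> : \row_j v (E a) j = row a A by apply/rowP => j; rewrite !mxE.
  by rewrite -!row_mul [RHS]mxE.
have GA := mulmx1C AG.
have -> : L X p = (\row_j v X j *m l) 0 0.
  by rewrite vE mxE; apply: eq_bigr => j _; rewrite !mxE.
rewrite -[l]mul1mx -GA -!mulmxA mulmxA mulmxA mxE; apply: eq_bigr => a _.
rewrite gE; congr (_ * _).
by rewrite vE mxE; apply: eq_bigr => j _; rewrite !mxE.
Qed.

End OrthonormalFrame.

(** * Almost 3-contact metric structures *)

Section EvenTriples.
Implicit Types i j k r : 'I_3.

Lemma even_triple_cycle i j k : even_triple i j k -> even_triple j k i.
Proof.
pose c : 'S_3 := (tperm 0%R 1%R * tperm 0%R 2%R)%g.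
have [c0 c1 c2] : [/\ c 0 = 1, c 1 = 2 & c 2 = 0].
  by split; rewrite /c permM !permE /=; exact/val_inj.
move=> [s es [-> -> ->]]; exists (c * s)%g.
  by rewrite odd_permM /c odd_permM !odd_tperm.
by split; rewrite permM ?c0 ?c1 ?c2.
Qed.

Lemma even_triple_exists r : exists j k, even_triple r j k.
Proof.
have T0 : even_triple 0 1 2 by exists (1%g : 'S_3); rewrite ?odd_perm1// !perm1.
have T1 := even_triple_cycle T0; have T2 := even_triple_cycle T1.
case: r => [[|[|[|//]]] r3]; [exists 1, 2|exists 2, 0|exists 0, 1].
- by rewrite (_ : Ordinal r3 = 0)//; exact/val_inj.
- by rewrite (_ : Ordinal r3 = 1)//; exact/val_inj.
- by rewrite (_ : Ordinal r3 = 2)//; exact/val_inj.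
Qed.

Lemma even_triple_neq i j k : even_triple i j k ->
  [/\ (i == j) = false, (j == k) = false & (k == i) = false].
Proof.
by move=> [s _ [-> -> ->]]; rewrite !(inj_eq perm_inj).
Qed.

Lemma even_triple_sum (V : zmodType) i j k (F : 'I_3 -> V) : even_triple i j k ->
  \sum_r F r = F i + F j + F k.
Proof.
move=> /even_triple_neq[ij jk ki].
rewrite (bigD1 i)//= (bigD1 j)/=; last by rewrite eq_sym ij.
rewrite (bigD1 k)/=; last by rewrite ki eq_sym jk.
rewrite big1 ?addr0 ?addrA// => r /andP[/andP[ri rj] rk].
move: ri rj rk ij jk ki.
by move: r i j k => [[|[|[|]]]//?] [[|[|[|]]]//?] [[|[|[|]]]//?] [[|[|[|]]]//?].
Qed.

Lemma even_tripleP i j k r : even_triple i j k -> [\/ r = i, r = j | r = k].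
Proof.
move=> /even_triple_neq[ij jk ki].
have [->|ri] := eqVneq r i; first by constructor 1.
have [->|rj] := eqVneq r j; first by constructor 2.
constructor 3; apply/eqP; have [//|rk] := eqVneq r k; move: ri rj rk ij jk ki.
by move: r i j k => [[|[|[|]]]//?] [[|[|[|]]]//?] [[|[|[|]]]//?] [[|[|[|]]]//?].
Qed.

End EvenTriples.

Section AlmostContact.
Context {R : realType} {m : nat} {M : smoothManifold R m}.
Local Notation C := (smoothfun M).
Variables (phi : {linear vfield M -> vfield M}) (xi : vfield M).
Variables (eta : {scalar (vfield M)}) (g : {symmetric (vfield M)}).

Lemma smoothfun_sqr_eq0 (f : C) : f * f = 0 -> f = 0.
Proof.
move=> ff; apply: smoothfun_ext => p.
have : f p * f p = 0 by exact: (congr1 (fun h : C => h p) ff).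
by move=> /eqP; rewrite mulf_eq0 orbb => /eqP.
Qed.

Lemma metric_nondeg : riemannian_metric g ->
  forall X, (forall Z, g X Z = 0) -> X = 0.
Proof.
move=> posg X X0; apply: vfield_ext => f; apply: smoothfun_ext => p.
apply/eqP/negP => /negP Xfp.
have : 0 < g X X p by apply: posg; exists f.
by rewrite X0 ltxx.
Qed.

Lemma metric_eq : riemannian_metric g ->
  forall X Y, (forall Z, g X Z = g Y Z) -> X = Y.
Proof.
move=> posg X Y XY; apply/eqP; rewrite -subr_eq0; apply/eqP.
by apply: metric_nondeg => // Z; rewrite metricDl metricNl XY subrr.
Qed.

Hypothesis H : almost_contact_metric phi xi eta g.

(** Since [phi (phi xi) = 0], applying the formula for the square to [phi xi] gives
    [phi xi = c *: xi] with [c * c = 0], and real-valued functions have no nilpotents. *)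
Lemma phi_xi0 : phi xi = 0.
Proof.
have p2 : phi (phi xi) = 0 by rewrite (ac_phi2 H) (ac_eta_xi H) scale1r addNr.
have [c pc] : exists c, phi xi = c *: xi.
  exists (eta (phi xi)); have := ac_phi2 H (phi xi).
  by rewrite p2 linear0 => /esym/eqP; rewrite addrC subr_eq0 => /eqP.
have c0 : c = 0.
  apply: smoothfun_sqr_eq0; have := p2.
  rewrite pc linearZ /= pc scalerA => /(congr1 eta).
  by rewrite scalar_formZ (ac_eta_xi H) mulr1 linear0.
by rewrite pc c0 scale0r.
Qed.

Lemma eta_phi0 X : eta (phi X) = 0.
Proof.
have := ac_phi2 H (phi X); rewrite (ac_phi2 H X) linearD linearN linearZ /= phi_xi0.
rewrite scaler0 addr0 -[LHS]addr0 => /addrI /esym /(congr1 eta).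
by rewrite scalar_formZ (ac_eta_xi H) mulr1 linear0.
Qed.

Lemma metric_xi X : g X xi = eta X.
Proof.
have := ac_compat H X xi; rewrite phi_xi0 metric0r (ac_eta_xi H) mulr1.
by move=> /esym/eqP; rewrite subr_eq0 => /eqP.
Qed.

Lemma metric_phi X Y : g X (phi Y) = - g (phi X) Y.
Proof.
have := ac_compat H X (phi Y).
rewrite (ac_phi2 H) metricDr metricNr metricZr metric_xi !eta_phi0 !mulr0 addr0 subr0.
by move=> <-.
Qed.

End AlmostContact.

Section ThreeContact.
Context {R : realType} {m : nat} {M : smoothManifold R m}.
Local Notation C := (smoothfun M).
Local Notation X_M := (vfield M).
Variables (phi : 'I_3 -> {linear X_M -> X_M}) (xi : 'I_3 -> X_M).
Variables (eta : 'I_3 -> {scalar X_M}) (g : {symmetric X_M}).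
Hypothesis H : almost_3_contact_metric phi xi eta g.
Implicit Types (i j k r s : 'I_3) (X Y Z : X_M).

Lemma phiD r X Y : phi r (X + Y) = phi r X + phi r Y. Proof. exact: linearD. Qed.
Lemma phiN r X : phi r (- X) = - phi r X. Proof. exact: linearN. Qed.
Lemma phiZ r f X : phi r (f *: X) = f *: phi r X. Proof. exact: linearZ. Qed.
Lemma phi0 r : phi r 0 = 0. Proof. exact: linear0. Qed.
Lemma etaD r X Y : eta r (X + Y) = eta r X + eta r Y. Proof. exact: linearD. Qed.
Lemma etaN r X : eta r (- X) = - eta r X. Proof. exact: linearN. Qed.
Lemma etaZ r f X : eta r (f *: X) = f * eta r X. Proof. exact: scalar_formZ. Qed.
Lemma eta0 r : eta r 0 = 0. Proof. exact: linear0. Qed.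

Definition multilinE :=
  (phiD, phiN, phiZ, phi0, etaD, etaN, etaZ, eta0,
   (@metricDl _ _ _ g), (@metricDr _ _ _ g), (@metricNl _ _ _ g),
   (@metricNr _ _ _ g), (@metricZl _ _ _ g), (@metricZr _ _ _ g),
   (@metric0l _ _ _ g), (@metric0r _ _ _ g)).

Lemma metric_xil r X : g (xi r) X = eta r X.
Proof. by rewrite metricC (metric_xi (a3c_structure H r)). Qed.

Lemma metric_xir r X : g X (xi r) = eta r X.
Proof. exact: (metric_xi (a3c_structure H r)). Qed.

Lemma metric_phir r X Y : g X (phi r Y) = - g (phi r X) Y.
Proof. exact: (metric_phi (a3c_structure H r)). Qed.

Lemma phi_phi r X : phi r (phi r X) = - X + eta r X *: xi r.
Proof. exact: (ac_phi2 (a3c_structure H r)). Qed.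

Lemma phi_xi r : phi r (xi r) = 0.
Proof. exact: (phi_xi0 (a3c_structure H r)). Qed.

Lemma eta_phi r X : eta r (phi r X) = 0.
Proof. exact: (eta_phi0 (a3c_structure H r)). Qed.

Lemma eta_xi_same r : eta r (xi r) = 1.
Proof. exact: (ac_eta_xi (a3c_structure H r)). Qed.

Section Triple.
Variables i j k : 'I_3.
Hypothesis T : even_triple i j k.

Lemma phi_ij X : phi i (phi j X) = phi k X + eta j X *: xi i.
Proof. by have [-> _] := a3c_phi H T X; rewrite subrK. Qed.

Lemma phi_ji X : phi j (phi i X) = - phi k X + eta i X *: xi j.
Proof. by have [_ ->] := a3c_phi H T X; rewrite opprD opprK subrK. Qed.

Lemma phi_xi_ij : phi i (xi j) = xi k.
Proof. by have [-> _] := a3c_xi H T. Qed.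

Lemma phi_xi_ji : phi j (xi i) = - xi k.
Proof. by have [_ ->] := a3c_xi H T; rewrite opprK. Qed.

Lemma eta_phi_ij X : eta i (phi j X) = eta k X.
Proof. by have [-> _] := a3c_eta H T X. Qed.

Lemma eta_phi_ji X : eta j (phi i X) = - eta k X.
Proof. by have [_ ->] := a3c_eta H T X; rewrite opprK. Qed.

Lemma eta_xi_kj : eta k (xi j) = 0.
Proof. by rewrite -eta_phi_ij phi_xi linear0. Qed.

Lemma eta_xi_ki : eta k (xi i) = 0.
Proof. by have [_ ->] := a3c_eta H T (xi i); rewrite phi_xi linear0 oppr0. Qed.

End Triple.

Lemma eta_xi r s : eta r (xi s) = (r == s)%:R.
Proof.
have [<-|] := eqVneq r s; first exact: eta_xi_same.
have [j [k T]] := even_triple_exists r.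
have T' := even_triple_cycle T.
case: (even_tripleP s T) => ->; rewrite ?eqxx//.
  by rewrite (eta_xi_ki T').
by rewrite (eta_xi_kj T').
Qed.

Section TripleRules.
Variables i j k : 'I_3.
Hypothesis T : even_triple i j k.
Let T1 := even_triple_cycle T.
Let T2 := even_triple_cycle T1.

(** Products of structure tensors for all three rotations of the triple are brought to normal form,
    leaving polynomial identities for [ring]. *)
Definition tripleE :=
  (phi_phi, phi_ij T, phi_ji T, phi_ij T1, phi_ji T1, phi_ij T2, phi_ji T2,
   phi_xi, phi_xi_ij T, phi_xi_ji T, phi_xi_ij T1, phi_xi_ji T1, phi_xi_ij T2,
   phi_xi_ji T2,
   eta_phi, eta_phi_ij T, eta_phi_ji T, eta_phi_ij T1, eta_phi_ji T1,
   eta_phi_ij T2, eta_phi_ji T2,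
   eta_xi_same, eta_xi_kj T, eta_xi_ki T, eta_xi_kj T1, eta_xi_ki T1,
   eta_xi_kj T2, eta_xi_ki T2).

Definition metricE := (tripleE, multilinE, metric_xil, metric_xir, metric_phir).

Definition horizontal_part X : X_M := X - \sum_r eta r X *: xi r.

Local Notation hor := horizontal_part.

Lemma horE X : hor X = X - (eta i X *: xi i + eta j X *: xi j + eta k X *: xi k).
Proof. by rewrite /horizontal_part (even_triple_sum _ T). Qed.

(** Projecting one argument suffices because [phi r] preserves horizontality. With [phi] in the
    first slot the sign is opposite to [fundamental_form], as suits the contact forms
    [- eta / alpha]. *)
Definition horizontal_form r X Y : C := g (phi r (hor X)) Y.

Lemma omegaE X Y : horizontal_form i X Y = g (phi i X) Y - wedge (eta j) (eta k) X Y.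
Proof. by rewrite /horizontal_form horE /wedge !metricE; ring. Qed.

End TripleRules.
End ThreeContact.

(** * The canonical connection *)

Section Structure.
Context {R : realType} {m : nat} {M : smoothManifold R m}.
Local Notation C := (smoothfun M).
Local Notation X_M := (vfield M).
Variables (phi : 'I_3 -> {linear X_M -> X_M}) (xi : 'I_3 -> X_M).
Variables (eta : 'I_3 -> {scalar X_M}) (g : {symmetric X_M}).
Variables (alpha delta : R).
Hypothesis hM : sasaki_3_alpha_delta phi xi eta g alpha delta.
Implicit Types (i j k r s : 'I_3) (X Y Z W : X_M).

Let H : almost_3_contact_metric phi xi eta g := s3_almost_3_contact hM.
Local Notation omega := (horizontal_form phi xi eta g).
Local Notation hor := (horizontal_part xi eta).
Local Notation al := (scst M alpha : C).
Local Notation de := (scst M delta : C).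
Local Notation metricE T := (metricE H T).

Lemma extd_eta i j k : even_triple i j k -> forall X Y,
  extd (eta i) X Y = - 2 * al * g (phi i X) Y
    + 2 * (al - de) * wedge (eta j) (eta k) X Y.
Proof.
move=> T X Y; rewrite (s3_extd hM T) /fundamental_form (metric_phir H).
by rewrite !scstM !scst_nat scstD scstN; ring.
Qed.

(* [nabla - deform] is the connection making all structure tensors parallel. *)
Definition deform X Y : X_M :=
  \sum_r ((al * omega r X Y) *: xi r - (al * eta r Y) *: phi r (hor X)
    + eta r X *: (de *: phi r Y - al *: phi r (hor Y))).

Definition deform_form X Y Z : C :=
  \sum_r (al * (omega r X Y * eta r Z - omega r X Z * eta r Y
    - eta r X * omega r Y Z) + de * eta r X * g (phi r Y) Z).

Lemma metric_deform X Y Z : g (deform X Y) Z = deform_form X Y Z.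
Proof.
rewrite metric_suml; apply: eq_bigr => r _.
rewrite !(metricDl, metricNl, metricZl) (metric_xil H) /horizontal_form.
by ring.
Qed.

Lemma metric_phiC r X Y : g (phi r Y) X = - g (phi r X) Y.
Proof. by rewrite metricC (metric_phir H). Qed.

Lemma deform_form_skew X Y Z : deform_form X Z Y = - deform_form X Y Z.
Proof.
have [j [k T]] := even_triple_exists 0.
have T1 := even_triple_cycle T; have T2 := even_triple_cycle T1.
rewrite /deform_form !(even_triple_sum _ T).
rewrite !(omegaE H T, omegaE H T1, omegaE H T2) /wedge.
by rewrite !(metric_phiC _ Y Z); ring.
Qed.

(** As [d eta_i] is twice the skew part of [nabla xi_i], this leaves a symmetric [D xi_i]. *)
Lemma deform_form_xi i X Y :
  deform_form X (xi i) Y - deform_form Y (xi i) X = extd (eta i) X Y.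
Proof.
have [j [k T]] := even_triple_exists i.
have T1 := even_triple_cycle T; have T2 := even_triple_cycle T1.
rewrite (extd_eta T) /deform_form !(even_triple_sum _ T).
rewrite !(omegaE H T, omegaE H T1, omegaE H T2) /wedge.
by rewrite !(metric_phiC _ X Y, metricE T); ring.
Qed.

(** Cartan's formula for the exterior derivative of a 2-form. *)
Definition extd2 (F : X_M -> X_M -> C) X Y Z : C :=
  X (F Y Z) + Y (F Z X) + Z (F X Y)
  - F (bracket X Y) Z - F (bracket Y Z) X - F (bracket Z X) Y.

Lemma vfield1 X : X 1 = 0 :> C.
Proof. by rewrite -scst1 vfield_scst. Qed.

Lemma bracketE X Y f : bracket X Y f = X (Y f) - Y (X f) :> C.
Proof. by []. Qed.

Lemma jacobi X Y Z : bracket (bracket X Y) Z + bracket (bracket Y Z) X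
  + bracket (bracket Z X) Y = 0.
Proof.
apply: vfield_ext => f; rewrite !vfieldDE !bracketE !vfieldB.
by rewrite -[RHS]/(0 : C); ring.
Qed.

Lemma extd2_extd (e : {scalar X_M}) X Y Z : extd2 (extd e) X Y Z = 0.
Proof.
rewrite /extd2 /extd !vfieldB !bracketE.
have : e (bracket (bracket X Y) Z) + e (bracket (bracket Y Z) X)
    + e (bracket (bracket Z X) Y) = 0.
  by rewrite -!linearD jacobi linear0.
move: (e (bracket (bracket X Y) Z)) (e (bracket (bracket Y Z) X)).
move: (e (bracket (bracket Z X) Y)) => w u v /eqP.
by rewrite addrC addr_eq0 => /eqP ->; ring.
Qed.

Lemma extd2_wedge (e f : {scalar X_M}) X Y Z : extd2 (wedge e f) X Y Z =
  extd e X Y * f Z + extd e Y Z * f X + extd e Z X * f Y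
  - (extd f X Y * e Z + extd f Y Z * e X + extd f Z X * e Y).
Proof. by rewrite /extd2 /extd /wedge !vfieldB !vfieldM; ring. Qed.

(** This is [d d eta_i = 0] solved for the derivative of the form of [phi i], which uses
    [alpha != 0]. The triple wedge terms drop out, as each repeats a factor. *)
Lemma extd2_phi i j k : even_triple i j k -> forall X Y Z,
  extd2 (fun X Y => g (phi i X) Y) X Y Z = 2 * (al - de) *
    (g (phi k X) Y * eta j Z + g (phi k Y) Z * eta j X + g (phi k Z) X * eta j Y
     - (g (phi j X) Y * eta k Z + g (phi j Y) Z * eta k X + g (phi j Z) X * eta k Y)).
Proof.
move=> T X Y Z.
have T1 := even_triple_cycle T; have T2 := even_triple_cycle T1.
have a2 : 2 * alpha != 0 by rewrite mulf_neq0 ?(s3_alpha hM)// pnatr_eq0.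
apply: (scst_mulI a2).
have -> : scst M (2 * alpha) * extd2 (fun X Y => g (phi i X) Y) X Y Z =
    2 * (al - de) * extd2 (wedge (eta j) (eta k)) X Y Z
    - extd2 (extd (eta i)) X Y Z.
  rewrite /extd2 !(extd_eta T) scstM scst_nat.
  by rewrite !(vfieldD, vfieldM, vfieldN, vfield_scst, vfield1); ring.
rewrite extd2_extd extd2_wedge !(extd_eta T1, extd_eta T2) /wedge.
by rewrite scstM scst_nat; ring.
Qed.

Variable nabla : X_M -> X_M -> X_M.
Hypothesis LC : levi_civita g nabla.

Lemma extd_nabla i X Y :
  extd (eta i) X Y = g (nabla X (xi i)) Y - g (nabla Y (xi i)) X.
Proof.
rewrite /extd -!(metric_xil H) !(lc_metric LC) -(lc_torsion_free LC).
by rewrite metricDr metricNr; ring.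
Qed.

Definition canonical_connection X Y : X_M := nabla X Y - deform X Y.

Local Notation D := canonical_connection.

Lemma D_xi_sym i X Y : g (D X (xi i)) Y = g (D Y (xi i)) X.
Proof.
apply/eqP; rewrite -subr_eq0 /canonical_connection !metricDl !metricNl !metric_deform.
have := deform_form_xi i X Y; rewrite extd_nabla => /eqP; rewrite -subr_eq0 => /eqP E.
by rewrite -[0]oppr0 -E; apply/eqP; ring.
Qed.

Definition nabla_phi i X Y : X_M := D X (phi i Y) - phi i (D X Y).

Lemma deform_form_cyclic i j k : even_triple i j k -> forall X Y Z,
  (deform_form X (phi i Y) Z + deform_form X Y (phi i Z))
  + (deform_form Y (phi i Z) X + deform_form Y Z (phi i X))
  + (deform_form Z (phi i X) Y + deform_form Z X (phi i Y)) =
    2 * (al - de) *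
    (g (phi k X) Y * eta j Z + g (phi k Y) Z * eta j X + g (phi k Z) X * eta j Y
     - (g (phi j X) Y * eta k Z + g (phi j Y) Z * eta k X + g (phi j Z) X * eta k Y)).
Proof.
move=> T X Y Z.
have T1 := even_triple_cycle T; have T2 := even_triple_cycle T1.
have Ei U W : g (phi i (phi i U)) W = - g U W + eta i U * eta i W.
  by rewrite !(metricE T).
have Ej U W : g (phi j (phi i U)) W = - g (phi k U) W + eta i U * eta j W.
  by rewrite !(metricE T).
have Ek U W : g (phi k (phi i U)) W = g (phi j U) W + eta i U * eta k W.
  by rewrite !(metricE T).
have Er r U W : g (phi r U) (phi i W) = - g (phi r (phi i W)) U.
  exact: metric_phiC.
rewrite /deform_form !(even_triple_sum _ T).
rewrite !(omegaE H T, omegaE H T1, omegaE H T2) /wedge.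
rewrite !(Er, Ei, Ej, Ek, eta_phi H i, eta_phi_ji H T, eta_phi_ij H T2).
rewrite !(metricC g Y X, metricC g Z X, metricC g Z Y)
  !(metric_phiC _ X Y, metric_phiC _ X Z, metric_phiC _ Y Z).
by ring.
Qed.

(** For the torsion-free [nabla] the cyclic sum is the exterior derivative of the form of [phi i];
    the cyclic sum of [deform_form] is exactly equal to it. *)
Lemma nabla_phi_cyclic i X Y Z : g (nabla_phi i X Y) Z + g (nabla_phi i Y Z) X
  + g (nabla_phi i Z X) Y = 0.
Proof.
have [j [k T]] := even_triple_exists i.
have E X' Y' Z' : g (nabla_phi i X' Y') Z' =
    X' (g (phi i Y') Z') + g (phi i Z') (nabla X' Y') - g (phi i Y') (nabla X' Z')
    - (deform_form X' (phi i Y') Z' + deform_form X' Y' (phi i Z')).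
  rewrite /nabla_phi /canonical_connection (phiD phi) (phiN phi)
    !(metricDl g, metricNl g) metric_deform.
  rewrite -!(metric_phir H) metric_deform !(lc_metric LC) (metric_phir H).
  by rewrite (metric_phiC _ (nabla X' Y') Z'); ring.
rewrite !E; have D1 := deform_form_cyclic T X Y Z; have D2 := extd2_phi T X Y Z.
have {D1 D2} := etrans D2 (esym D1) => /eqP.
rewrite -subr_eq0 /extd2 -!(lc_torsion_free LC) => /eqP D.
apply: etrans D; rewrite !(phiD phi, phiN phi, metricDl g, metricNl g).
rewrite !(metric_phiC _ (nabla _ _) _).
by ring.
Qed.

End Structure.

(** * Hitchin's argument for an abstract metric connection *)

Section Parallel.
Context {R : realType} {m : nat} {M : smoothManifold R m}.
Local Notation C := (smoothfun M).
Local Notation X_M := (vfield M).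
Variables (phi : 'I_3 -> {linear X_M -> X_M}) (xi : 'I_3 -> X_M).
Variables (eta : 'I_3 -> {scalar X_M}) (g : {symmetric X_M}).
Hypothesis H : almost_3_contact_metric phi xi eta g.
Implicit Types (i j k r s : 'I_3) (X Y Z W : X_M).
Variable D : X_M -> X_M -> X_M.
Hypothesis D_linear_l : forall f X Y Z, D (f *: X + Y) Z = f *: D X Z + D Y Z.
Hypothesis D_additive_r : forall X Y Z, D X (Y + Z) = D X Y + D X Z.
Hypothesis D_leibniz : forall f X Y, D X (f *: Y) = (X f : C) *: Y + f *: D X Y.
Hypothesis D_metric : forall X Y Z, X (g Y Z) = g (D X Y) Z + g Y (D X Z).
Local Notation b i X := (D X (xi i)).
Local Notation N i X Y := (D X (phi i Y) - phi i (D X Y)).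
Hypothesis D_xi_symmetric : forall i X Y, g (b i X) Y = g (b i Y) X.
Hypothesis D_phi_cyclic : forall i X Y Z,
  g (N i X Y) Z + g (N i Y Z) X + g (N i Z X) Y = 0.

Let neq := metric_eq (a3c_metric H).
Let mE := (metricDl g, metricNl g, metricZl g, metricDr g, metricNr g, metricZr g,
  phiD phi, phiN phi, phiZ phi).

Lemma DDl X Y Z : D (X + Y) Z = D X Z + D Y Z.
Proof. by have := D_linear_l 1 X Y Z; rewrite !scale1r. Qed.

Lemma D0l Z : D 0 Z = 0.
Proof.
have := DDl 0 0 Z; rewrite addr0 => /eqP.
by rewrite -subr_eq subrr => /eqP.
Qed.

Lemma DZl f X Z : D (f *: X) Z = f *: D X Z.
Proof. by have := D_linear_l f X 0 Z; rewrite D0l !addr0. Qed.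

Lemma DNl X Z : D (- X) Z = - D X Z.
Proof. by rewrite -scaleN1r DZl scaleN1r. Qed.

Lemma D0r X : D X 0 = 0.
Proof.
have := D_additive_r X 0 0; rewrite addr0 => /eqP.
by rewrite -subr_eq subrr => /eqP.
Qed.

Lemma DNr X Y : D X (- Y) = - D X Y.
Proof. by apply/eqP; rewrite -addr_eq0 -D_additive_r addNr D0r. Qed.

Lemma D_eta X i Y : X (eta i Y) = g (D X (xi i)) Y + eta i (D X Y).
Proof. by rewrite -!(metric_xil H) D_metric. Qed.

Lemma D_phi_skew i X Y Z : g (N i X Y) Z = - g (N i X Z) Y.
Proof.
have : X (g (phi i Y) Z + g Y (phi i Z)) = 0.
  by rewrite (metric_phir H) subrr vfield0.
rewrite vfieldD !D_metric (metricC g (phi i Y)) (metricC g Y) => E.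
apply/eqP; rewrite -addr_eq0 !mE -!(metric_phir H); apply/eqP.
by apply: etrans E; ring.
Qed.

Lemma D_xi_skew i j X : eta j (D X (xi i)) = - eta i (D X (xi j)).
Proof.
have : X (g (xi i) (xi j)) = 0.
  by rewrite (metric_xil H) (eta_xi H) -scst_nat vfield_scst.
rewrite D_metric (metric_xil H) (metric_xir H) => /eqP.
by rewrite addr_eq0 => /eqP.
Qed.

Lemma D_xi_swap i r : D (xi r) (xi i) = - D (xi i) (xi r).
Proof.
apply: neq => Z; rewrite D_xi_symmetric (metric_xir H) D_xi_skew.
by rewrite metricNl (D_xi_symmetric r) (metric_xir H).
Qed.

Lemma phi_xi_cases i r : (exists s, phi i (xi r) = xi s) \/
  (exists s, phi i (xi r) = - xi s) \/ phi i (xi r) = 0.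
Proof.
have [j [k T]] := even_triple_exists i.
have T1 := even_triple_cycle T; have T2 := even_triple_cycle T1.
case: (even_tripleP r T) => ->.
- by right; right; exact: (phi_xi H i).
- by left; exists k; exact: (phi_xi_ij H T).
- by right; left; exists j; exact: (phi_xi_ji H T2).
Qed.

(** The cyclic identity with [xi r] as third argument. As [phi i (xi r)] is zero or some [xi s] up
    to sign, its derivative is symmetric and cancels, so that the derivative of [phi i] along [xi r]
    is governed by [D xi_r]. *)
Lemma D_phi_xi_l i r X :
  D (xi r) (phi i X) - phi i (D (xi r) X) =
    - (phi i (D X (xi r)) + D (phi i X) (xi r)).
Proof.
apply: neq => Y.
have S : g (D X (phi i (xi r))) Y = g (D Y (phi i (xi r))) X.
  case: (phi_xi_cases i r) => [[s ->]|[[s ->]|->]]; rewrite ?DNr ?D0r ?metricNl.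
  - exact: D_xi_symmetric.
  - by rewrite D_xi_symmetric.
  - by rewrite !metric0l.
have P : g (phi i (D Y (xi r))) X = - g (D (phi i X) (xi r)) Y.
  by rewrite -[LHS]opprK -(metric_phir H) D_xi_symmetric.
have := D_phi_cyclic i X Y (xi r).
rewrite (D_phi_skew i X Y) !mE S P => E.
by apply/eqP; rewrite -subr_eq0; apply/eqP; apply: etrans E; ring.
Qed.

Section TripleLeibniz.
Variables i j k : 'I_3.
Hypothesis T : even_triple i j k.

Lemma D_phi_leibniz X Y : N i X (phi j Y) + phi i (N j X Y) =
  N k X Y + g (D X (xi j)) Y *: xi i + eta j Y *: D X (xi i).
Proof.
rewrite (phiD phi) (phiN phi) addrA subrK !(phi_ij H T) D_additive_r D_leibniz D_eta.
by rewrite !(opprD, scalerDl) !addrA; apply: neq => Z; rewrite !mE; ring.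
Qed.

Lemma D_phi_leibniz_rev X Y : N j X (phi i Y) + phi j (N i X Y) =
  - N k X Y + g (D X (xi i)) Y *: xi j + eta i Y *: D X (xi j).
Proof.
rewrite (phiD phi) (phiN phi) addrA subrK !(phi_ji H T) D_additive_r D_leibniz D_eta DNr.
by apply: neq => Z; rewrite !mE; ring.
Qed.

(** The Leibniz rule for [phi_i phi_j] is taken along [xi r], with all derivatives of [phi]
    expressed through [D xi_r]. The vertical terms cancel by [D_xi_swap], leaving twice the stated
    term. *)
Lemma phi_D_xi_phi r Y : phi i (D (phi j Y) (xi r)) = 0.
Proof.
apply: (metric_nondeg (a3c_metric H)) => Z.
have := D_phi_leibniz (xi r) Y; rewrite !D_phi_xi_l.
rewrite (phi_ij H T) DDl DZl (phiN phi) (phiD phi) (phi_ij H T).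
rewrite (D_xi_swap i r) (D_xi_swap j r) metricNl D_xi_symmetric (metric_xir H).
move=> /(congr1 (fun W => g W Z)); rewrite !mE => E.
apply: smoothfun_double_eq0; apply/eqP; rewrite -oppr_eq0; apply/eqP.
move/eqP: E; rewrite -subr_eq0 => /eqP E; rewrite -[RHS]E; ring.
Qed.

Lemma phi_D_xi_phi_rev r Y : phi j (D (phi i Y) (xi r)) = 0.
Proof.
apply: (metric_nondeg (a3c_metric H)) => Z.
have := D_phi_leibniz_rev (xi r) Y; rewrite !D_phi_xi_l.
rewrite (phi_ji H T) DDl DZl DNl (phiN phi) (phiD phi) (phi_ji H T).
rewrite (D_xi_swap i r) (D_xi_swap j r) metricNl D_xi_symmetric (metric_xir H).
move=> /(congr1 (fun W => g W Z)); rewrite !mE => E.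
apply: smoothfun_double_eq0; apply/eqP; rewrite -oppr_eq0; apply/eqP.
move/eqP: E; rewrite -subr_eq0 => /eqP E; rewrite -[RHS]E; ring.
Qed.

End TripleLeibniz.

(** For [X] in the image of [phi j] the derivative is killed by [phi i] and [phi k]. The kernel of
    [phi i] is spanned by [xi i], which [phi k] sends to [xi j], so it vanishes. Images of the [phi]
    span: [xi 0] is itself [phi j (xi k)]. *)
Lemma D_xi_eq0 r X : D X (xi r) = 0.
Proof.
have key j Y : D (phi j Y) (xi r) = 0.
  have [k [i T1]] := even_triple_exists j.
  have T2 := even_triple_cycle T1; have T := even_triple_cycle T2.
  have Zi := phi_D_xi_phi T r Y; have Zk := phi_D_xi_phi_rev T1 r Y.
  move: (D (phi j Y) (xi r)) Zi Zk => Z Zi Zk.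
  have ZE : Z = eta i Z *: xi i.
    have /esym/eqP := phi_phi H i Z; rewrite Zi (phi0 phi) addrC subr_eq0.
    by move=> /eqP.
  have : eta j (phi k Z) = 0 by rewrite Zk linear0.
  rewrite ZE (phiZ phi) (phi_xi_ij H T2) (etaZ eta) (eta_xi_same H) mulr1 => ->.
  by rewrite scale0r.
have [j [k T]] := even_triple_exists 0.
have -> : X = - phi 0 (phi 0 X) + eta 0 X *: phi j (xi k).
  by rewrite (phi_phi H) (phi_xi_ij H (even_triple_cycle T)) opprD opprK subrK.
by rewrite DDl DNl DZl !key oppr0 scaler0 addr0.
Qed.

Definition deriv_phi i X Y : X_M := N i X Y.

Lemma deriv_phi_skew i X Y Z : g (deriv_phi i X Y) Z = - g (deriv_phi i X Z) Y.
Proof. exact: D_phi_skew. Qed.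

Lemma deriv_phi_cyclic i X Y Z :
  g (deriv_phi i X Y) Z + g (deriv_phi i Y Z) X + g (deriv_phi i Z X) Y = 0.
Proof. exact: D_phi_cyclic. Qed.

Lemma deriv_phi_xi_r i r X : deriv_phi i X (xi r) = 0.
Proof.
rewrite /deriv_phi D_xi_eq0 (phi0 phi) subr0.
by case: (phi_xi_cases i r) => [[s ->]|[[s ->]|->]];
  rewrite ?DNr ?D0r ?D_xi_eq0 ?oppr0.
Qed.

Lemma eta_deriv_phi i r X Y : eta r (deriv_phi i X Y) = 0.
Proof.
by rewrite -(metric_xir H) deriv_phi_skew deriv_phi_xi_r metric0l oppr0.
Qed.

Lemma deriv_phi_xi_l i r X : deriv_phi i (xi r) X = 0.
Proof. by rewrite /deriv_phi D_phi_xi_l !D_xi_eq0 (phi0 phi) addr0 oppr0. Qed.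

Lemma deriv_phi_anti i X Y : deriv_phi i X (phi i Y) = - phi i (deriv_phi i X Y).
Proof.
apply/eqP; rewrite -addr_eq0 /deriv_phi; apply/eqP.
rewrite (phiD phi) (phiN phi) addrA subrK !(phi_phi H) D_additive_r D_leibniz D_eta.
rewrite DNr !D_xi_eq0 metric0l add0r scaler0 addr0.
by rewrite opprD opprK addrACA addNr add0r subrr.
Qed.

Lemma deriv_phi_Dl i X X' Y : deriv_phi i (X + X') Y = deriv_phi i X Y + deriv_phi i X' Y.
Proof. by rewrite /deriv_phi !DDl (phiD phi) opprD addrACA. Qed.

Lemma deriv_phi_Nl i X Y : deriv_phi i (- X) Y = - deriv_phi i X Y.
Proof. by rewrite /deriv_phi !DNl (phiN phi) opprD. Qed.

Lemma deriv_phi_Zl i f X Y : deriv_phi i (f *: X) Y = f *: deriv_phi i X Y.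
Proof. by rewrite /deriv_phi !DZl (phiZ phi) scalerBr. Qed.

Lemma deriv_phi_Dr i X Y Y' : deriv_phi i X (Y + Y') = deriv_phi i X Y + deriv_phi i X Y'.
Proof. by rewrite /deriv_phi (phiD phi) !D_additive_r (phiD phi) opprD addrACA. Qed.

Lemma deriv_phi_Nr i X Y : deriv_phi i X (- Y) = - deriv_phi i X Y.
Proof. by rewrite /deriv_phi (phiN phi) !DNr (phiN phi) opprD. Qed.

Lemma deriv_phi_Zr i f X Y : deriv_phi i X (f *: Y) = f *: deriv_phi i X Y.
Proof.
rewrite /deriv_phi (phiZ phi) !D_leibniz (phiD phi) !(phiZ phi).
by rewrite opprD addrACA subrr add0r scalerBr.
Qed.

Let Nl := (deriv_phi_Dl, deriv_phi_Nl, deriv_phi_Zl, deriv_phi_Dr, deriv_phi_Nr,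
  deriv_phi_Zr, deriv_phi_xi_r, deriv_phi_xi_l, eta_deriv_phi).

(** The analogue of the fact that almost Kaehler manifolds are quasi-Kaehler. *)
Lemma deriv_phi_phi_l i X Y : deriv_phi i (phi i X) Y = - phi i (deriv_phi i X Y).
Proof.
have K W U V : g (deriv_phi i W (phi i U)) V = g (deriv_phi i W U) (phi i V).
  by rewrite deriv_phi_anti metricNl (metric_phir H).
have KK U V W : g (deriv_phi i (phi i U) (phi i V)) W = - g (deriv_phi i U V) W.
  have c1 := deriv_phi_cyclic i U V W; have c2 := deriv_phi_cyclic i U (phi i V) (phi i W).
  have c3 := deriv_phi_cyclic i (phi i U) (phi i V) W.
  have c4 := deriv_phi_cyclic i (phi i U) V (phi i W).
  have sq X' Y' Z' : g (deriv_phi i X' (phi i Y')) (phi i Z') = - g (deriv_phi i X' Y') Z'.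
    by rewrite -K (phi_phi H) !Nl scaler0 addr0 metricNl.
  move: c2 c3 c4; rewrite !sq -?(K (phi i U)) -?(K (phi i V)) -?(K (phi i W)).
  rewrite -?K => c2 c3 c4.
  apply/eqP; rewrite -subr_eq0 opprK; apply/eqP; apply: smoothfun_double_eq0.
  move: c1 c2 c3 c4; move: (g (deriv_phi i U V) W) (g (deriv_phi i V W) U)
    (g (deriv_phi i W U) V).
  move: (g (deriv_phi i (phi i U) (phi i V)) W) (g (deriv_phi i (phi i V) (phi i W)) U).
  move: (g (deriv_phi i (phi i W) (phi i U)) V) => f d e a b c c1 c2 c3 c4.
  (* The cyclic identity, with [phi i] inserted in no argument or in two of them, gives four linear
     relations between six values; this combination isolates the wanted pair. *)
  have -> : d + a + (d + a) =
      (d + e - c) + (d - b + f) - (- a + e + f) + (a + b + c) by ring.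
  by rewrite c1 c2 c3 c4 subr0 !addr0.
apply: neq => Z; rewrite metricNl -(metric_phir H).
have := KK X (phi i Y) Z.
by rewrite (phi_phi H) !Nl scaler0 addr0 metricNl K => /oppr_inj.
Qed.

Section TripleHitchin.
Variables i j k : 'I_3.
Hypothesis T : even_triple i j k.
Let T1 := even_triple_cycle T.
Let T2 := even_triple_cycle T1.

Lemma deriv_phi_leibniz X Y : deriv_phi i X (phi j Y) + phi i (deriv_phi j X Y) =
  deriv_phi k X Y.
Proof.
by have := D_phi_leibniz T X Y; rewrite !D_xi_eq0 metric0l scale0r scaler0 !addr0.
Qed.

Lemma deriv_phi_leibniz_rev X Y : deriv_phi j X (phi i Y) + phi j (deriv_phi i X Y) =
  - deriv_phi k X Y.
Proof.
by have := D_phi_leibniz_rev T X Y; rewrite !D_xi_eq0 metric0l scale0r scaler0 !addr0.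
Qed.

(** The derivative of the relation by which [phi i] and [phi j] anticommute up to vertical terms,
    which are parallel once [D xi = 0]. *)
Lemma deriv_phi_anticomm_swap X Y : deriv_phi j X (phi i Y) + phi i (deriv_phi j X Y) =
  - (deriv_phi i X (phi j Y) + phi j (deriv_phi i X Y)).
Proof.
have E : deriv_phi i X (phi j Y) + phi i (deriv_phi j X Y) =
    - (deriv_phi j X (phi i Y) + phi j (deriv_phi i X Y)).
  by rewrite deriv_phi_leibniz deriv_phi_leibniz_rev opprK.
apply/eqP; rewrite -addr_eq0 [X in _ + X]addrC addrACA [X in _ + X]addrC E.
by rewrite subrr.
Qed.

Definition anticomm X Y : X_M := deriv_phi j X (phi i Y) + phi i (deriv_phi j X Y).

End TripleHitchin.

Lemma anticomm_phi i j k : even_triple i j k -> forall X Y,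
  anticomm i j (phi i X) Y = - anticomm k i X Y.
Proof.
move=> T X Y; have T2 := even_triple_cycle (even_triple_cycle T).
rewrite /anticomm (deriv_phi_anticomm_swap T) !deriv_phi_phi_l (phiN phi) (phi_ji H T).
rewrite eta_deriv_phi scale0r addr0 opprK; congr (- _).
have -> : phi k Y = phi i (phi j Y) - eta j Y *: xi i by rewrite (phi_ij H T) addrK.
by rewrite deriv_phi_Dr deriv_phi_Nr deriv_phi_Zr deriv_phi_xi_r scaler0 oppr0 addr0
  deriv_phi_anti.
Qed.

Lemma anticomm_phi_cycle i j k : even_triple i j k -> forall X Y,
  anticomm i j (phi k X) Y = - anticomm k i (phi j X) Y.
Proof.
move=> T X Y.
have -> : phi k X = phi i (phi j X) - eta j X *: xi i by rewrite (phi_ij H T) addrK.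
have additive Z f : anticomm i j (Z - f *: xi i) Y = anticomm i j Z Y.
  by rewrite /anticomm !deriv_phi_Dl !deriv_phi_Nl !deriv_phi_Zl !deriv_phi_xi_l !scaler0
    !oppr0 !addr0.
by rewrite additive (anticomm_phi T).
Qed.

(** Three turns of the cyclic rule return to the same expression with sign [(-1)^3]. This settles
    directions in the image of [phi k]; the remaining direction [xi k] contributes nothing. *)
Lemma anticomm_eq0 i j k : even_triple i j k -> forall X Y, anticomm i j X Y = 0.
Proof.
move=> T X Y.
have T1 := even_triple_cycle T; have T2 := even_triple_cycle T1.
have K Z : anticomm i j (phi k Z) Y = 0.
  have E : anticomm i j (phi k Z) Y = - anticomm i j (phi k Z) Y.
    rewrite {1}(anticomm_phi_cycle T) (anticomm_phi_cycle T2).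
    by rewrite (anticomm_phi_cycle T1) opprK.
  apply: (metric_nondeg (a3c_metric H)) => W; apply: smoothfun_double_eq0.
  by rewrite {1}E metricNl addNr.
have -> : X = - phi k (phi k X) + eta k X *: xi k.
  by rewrite (phi_phi H) opprD opprK subrK.
have := K (phi k X); rewrite /anticomm !deriv_phi_Dl !deriv_phi_Nl !deriv_phi_Zl
  !deriv_phi_xi_l.
rewrite !scaler0 !addr0 (phiN phi) => E0.
by rewrite -opprD E0 oppr0.
Qed.

(** The derivative of [phi i] anticommutes with [phi i], [phi j] and [phi k]. Up to vertical terms
    [phi k] is [phi_i phi_j], so it also commutes with [phi k]. Hence [phi k] kills its values,
    which are horizontal, and they vanish. *)
Lemma D_phi_eq0 i X Y : D X (phi i Y) = phi i (D X Y).
Proof.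
have [j [k T]] := even_triple_exists i.
have T1 := even_triple_cycle T; have T2 := even_triple_cycle T1.
apply/eqP; rewrite -subr_eq0 -[_ - _]/(deriv_phi i X Y); apply/eqP.
have anti_k Z : deriv_phi i X (phi k Z) = - phi k (deriv_phi i X Z).
  by apply/eqP; rewrite -addr_eq0; apply/eqP; exact: (anticomm_eq0 T2).
have anti_j Z : deriv_phi i X (phi j Z) = - phi j (deriv_phi i X Z).
  apply/eqP; rewrite -addr_eq0; apply/eqP.
  by rewrite -[LHS]opprK -(deriv_phi_anticomm_swap T) [X in - X](anticomm_eq0 T) oppr0.
have comm_k Z : deriv_phi i X (phi k Z) = phi k (deriv_phi i X Z).
  have -> : phi k Z = phi i (phi j Z) - eta j Z *: xi i by rewrite (phi_ij H T) addrK.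
  rewrite deriv_phi_Dr deriv_phi_Nr deriv_phi_Zr deriv_phi_xi_r scaler0 oppr0 addr0
    deriv_phi_anti anti_j (phiN phi) opprK.
  by rewrite (phi_ij H T) eta_deriv_phi scale0r addr0.
have kN : phi k (deriv_phi i X Y) = 0.
  apply: (metric_nondeg (a3c_metric H)) => W; apply: smoothfun_double_eq0.
  by rewrite -{1}comm_k anti_k metricNl addNr.
by have := phi_phi H k (deriv_phi i X Y); rewrite kN (phi0 phi) eta_deriv_phi scale0r addr0
  => /esym/eqP; rewrite oppr_eq0 => /eqP.
Qed.

End Parallel.

(** * Curvature and Ricci tensor *)

(** Identities in the module of fields become ring identities once evaluated on a function. *)
Ltac vfield_ring :=
  apply: vfield_ext => ?; rewrite !(vfieldDE, vfieldNE, vfieldZE); ring.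

Section Curvature.
Context {R : realType} {m : nat} {M : smoothManifold R m}.
Local Notation C := (smoothfun M).
Local Notation X_M := (vfield M).
Implicit Types (f : C) (X Y Z W : X_M).

Lemma bracketC X Y : bracket X Y = - bracket Y X.
Proof. by apply: vfield_ext => f; rewrite vfieldNE !bracketE opprB. Qed.

Lemma bracketDl X Y Z : bracket (X + Y) Z = bracket X Z + bracket Y Z.
Proof.
apply: vfield_ext => f; rewrite vfieldDE !bracketE !vfieldDE vfieldD.
by rewrite opprD addrACA.
Qed.

Lemma bracketZl f X Y : bracket (f *: X) Y = f *: bracket X Y - (Y f : C) *: X.
Proof.
apply: vfield_ext => h; rewrite vfieldDE vfieldNE !vfieldZE !bracketE !vfieldZE vfieldM.
by ring.
Qed.

Variable D : X_M -> X_M -> X_M.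
Hypothesis D_linear_l : forall f X Y Z, D (f *: X + Y) Z = f *: D X Z + D Y Z.
Hypothesis D_additive_r : forall X Y Z, D X (Y + Z) = D X Y + D X Z.
Hypothesis D_leibniz : forall f X Y, D X (f *: Y) = (X f : C) *: Y + f *: D X Y.

Let Dl := DDl D_linear_l.
Let Zl := DZl D_linear_l.
Let Nl := DNl D_linear_l.
Let Nr := DNr D_additive_r.

Lemma curvatureC X Y Z : curvature D X Y Z = - curvature D Y X Z.
Proof. by rewrite /curvature (bracketC X Y) Nl; vfield_ring. Qed.

Lemma curvatureDl X X' Y Z :
  curvature D (X + X') Y Z = curvature D X Y Z + curvature D X' Y Z.
Proof. by rewrite /curvature bracketDl !Dl D_additive_r; vfield_ring. Qed.

Lemma curvatureZl f X Y Z : curvature D (f *: X) Y Z = f *: curvature D X Y Z.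
Proof. by rewrite /curvature bracketZl Dl Nl !Zl D_leibniz; vfield_ring. Qed.

Lemma curvatureDr X Y Z Z' :
  curvature D X Y (Z + Z') = curvature D X Y Z + curvature D X Y Z'.
Proof. by rewrite /curvature !D_additive_r; vfield_ring. Qed.

Lemma curvatureZr f X Y Z : curvature D X Y (f *: Z) = f *: curvature D X Y Z.
Proof.
rewrite /curvature !D_leibniz !D_additive_r !D_leibniz.
by apply: vfield_ext => h; rewrite !(vfieldDE, vfieldNE, vfieldZE) bracketE; ring.
Qed.

Lemma curvature_skew (g : {symmetric X_M}) X Y Z W :
  (forall X Y Z, X (g Y Z) = g (D X Y) Z + g Y (D X Z)) ->
  g (curvature D X Y Z) W = - g (curvature D X Y W) Z.
Proof.
move=> Dm; have := bracketE X Y (g Z W).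
rewrite !Dm !vfieldD !Dm => E; rewrite /curvature !(metricDl g, metricNl g).
rewrite !(metricC g _ Z).
apply/eqP; rewrite -subr_eq0; move/eqP: E; rewrite -subr_eq0 => /eqP.
by move=> /(congr1 -%R); rewrite oppr0 => E; apply/eqP; apply: etrans E; ring.
Qed.

Lemma curvature_bianchi X Y Z : (forall X Y, D X Y - D Y X = bracket X Y) ->
  curvature D X Y Z + curvature D Y Z X + curvature D Z X Y = 0.
Proof.
move=> tf; rewrite -[RHS]oppr0 -(jacobi X Y Z).
have Dr U V W : D U (D V W) - D U (D W V) = D U (bracket V W).
  by rewrite -tf D_additive_r Nr.
have E U V : bracket U V = D U V - D V U by rewrite tf.
by rewrite (E (bracket X Y)) (E (bracket Y Z)) (E (bracket Z X)) -!Dr /curvature;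
  vfield_ring.
Qed.

End Curvature.

(** * Parallel tensors of [D] and the quadratic curvature term *)

Section CanonicalConnection.
Context {R : realType} {m : nat} {M : smoothManifold R m}.
Local Notation C := (smoothfun M).
Local Notation X_M := (vfield M).
Variables (phi : 'I_3 -> {linear X_M -> X_M}) (xi : 'I_3 -> X_M).
Variables (eta : 'I_3 -> {scalar X_M}) (g : {symmetric X_M}).
Variables (alpha delta : R).
Hypothesis hM : sasaki_3_alpha_delta phi xi eta g alpha delta.
Variable nabla : X_M -> X_M -> X_M.
Hypothesis LC : levi_civita g nabla.
Implicit Types (i j k r s : 'I_3) (f : C) (X Y Z W : X_M).

Let H : almost_3_contact_metric phi xi eta g := s3_almost_3_contact hM.
Let neq := metric_eq (a3c_metric H).
Local Notation omega := (horizontal_form phi xi eta g).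
Local Notation hor := (horizontal_part xi eta).
Local Notation al := (scst M alpha : C).
Local Notation de := (scst M delta : C).
Local Notation deform := (deform phi xi eta g alpha delta).
Local Notation deform_form := (deform_form phi xi eta g alpha delta).
Local Notation D := (canonical_connection phi xi eta g alpha delta nabla).
Let mE := (metricDl g, metricNl g, metricZl g, metricDr g, metricNr g, metricZr g,
  phiD phi, phiN phi, phiZ phi, etaD eta, etaN eta, etaZ eta).

Let gdeform X Y Z : g (deform X Y) Z = deform_form X Y Z.
Proof. exact: (metric_deform hM). Qed.

Lemma hor_linear f X Y : hor (f *: X + Y) = f *: hor X + hor Y.
Proof.
rewrite /horizontal_part scalerBr scaler_sumr addrACA -opprD -big_split /=.
congr (_ - _); apply: eq_bigr => r _.
by rewrite (etaD eta) (etaZ eta) scalerDl scalerA.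
Qed.

Lemma omega_linear_l r f X Y Z : omega r (f *: X + Y) Z = f * omega r X Z + omega r Y Z.
Proof. by rewrite /horizontal_form hor_linear !mE. Qed.

Lemma omega_linear_r r f X Y Z : omega r Z (f *: X + Y) = f * omega r Z X + omega r Z Y.
Proof. by rewrite /horizontal_form !mE. Qed.

Lemma deform_linear_l f X Y Z : deform (f *: X + Y) Z = f *: deform X Z + deform Y Z.
Proof.
apply: neq => W; rewrite !mE !gdeform mulr_sumr -big_split; apply: eq_bigr => r _ /=.
by rewrite !omega_linear_l !mE; ring.
Qed.

Lemma deform_linear_r f X Y Z : deform X (f *: Y + Z) = f *: deform X Y + deform X Z.
Proof.
apply: neq => W; rewrite !mE !gdeform mulr_sumr -big_split; apply: eq_bigr => r _ /=.
by rewrite !omega_linear_l !omega_linear_r !mE; ring.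
Qed.

Lemma deform0r X : deform X 0 = 0.
Proof.
have := deform_linear_r 1 X 0 0; rewrite !scale1r addr0 => /eqP.
by rewrite -subr_eq subrr => /eqP.
Qed.

Lemma deformDr X Y Z : deform X (Y + Z) = deform X Y + deform X Z.
Proof. by have := deform_linear_r 1 X Y Z; rewrite !scale1r. Qed.

Lemma deformZr f X Y : deform X (f *: Y) = f *: deform X Y.
Proof. by have := deform_linear_r f X Y 0; rewrite deform0r !addr0. Qed.

Lemma D_linear_l f X Y Z : D (f *: X + Y) Z = f *: D X Z + D Y Z.
Proof. by rewrite /canonical_connection (lc_linear_l LC) deform_linear_l; vfield_ring. Qed.

Lemma D_additive_r X Y Z : D X (Y + Z) = D X Y + D X Z.
Proof. by rewrite /canonical_connection (lc_additive_r LC) deformDr; vfield_ring. Qed.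

Lemma D_leibniz f X Y : D X (f *: Y) = (X f : C) *: Y + f *: D X Y.
Proof. by rewrite /canonical_connection (lc_leibniz LC) deformZr; vfield_ring. Qed.

Lemma D_metric X Y Z : X (g Y Z) = g (D X Y) Z + g Y (D X Z).
Proof.
rewrite (lc_metric LC) /canonical_connection !mE (metricC g Y (deform X Z)) !gdeform.
by rewrite (deform_form_skew hM X Y Z); ring.
Qed.

Lemma D_parallel_xi r X : D X (xi r) = 0.
Proof.
apply: (D_xi_eq0 H D_linear_l D_additive_r D_leibniz D_metric).
- exact: D_xi_sym hM nabla LC.
- exact: nabla_phi_cyclic hM nabla LC.
Qed.

Lemma D_parallel_phi r X Y : D X (phi r Y) = phi r (D X Y).
Proof.
apply: (D_phi_eq0 H D_linear_l D_additive_r D_leibniz D_metric).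
- exact: D_xi_sym hM nabla LC.
- exact: nabla_phi_cyclic hM nabla LC.
Qed.

Lemma D_parallel_eta r X Y : X (eta r Y) = eta r (D X Y).
Proof.
by rewrite -!(metric_xir H) D_metric D_parallel_xi metric0r addr0.
Qed.

Lemma D_parallel_hor X Y : D X (hor Y) = hor (D X Y).
Proof.
have [j [k T]] := even_triple_exists 0.
have DN := DNr D_additive_r.
rewrite !(horE _ _ T) D_additive_r DN !D_additive_r !D_leibniz !D_parallel_xi.
by rewrite !D_parallel_eta !scaler0 !addr0.
Qed.

Lemma D_parallel_omega r X Y Z :
  X (omega r Y Z) = omega r (D X Y) Z + omega r Y (D X Z).
Proof. by rewrite /horizontal_form D_metric D_parallel_phi D_parallel_hor. Qed.

Lemma D_parallel_deform_form X Y Z W : X (deform_form Y Z W) =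
  deform_form (D X Y) Z W + deform_form Y (D X Z) W + deform_form Y Z (D X W).
Proof.
rewrite vfield_sum -!big_split; apply: eq_bigr => r _ /=.
rewrite !(vfieldD, vfieldM, vfieldN, vfield_scst, D_parallel_omega, D_parallel_eta).
by rewrite D_metric D_parallel_phi; ring.
Qed.

Lemma D_parallel_deform X Y Z :
  D X (deform Y Z) = deform (D X Y) Z + deform Y (D X Z).
Proof.
apply: neq => W; rewrite [RHS](metricDl g) (gdeform (D X Y)) (gdeform Y).
have := D_metric X (deform Y Z) W; rewrite !(gdeform Y) D_parallel_deform_form => E.
by apply: (addIr (deform_form Y Z (D X W))); rewrite -E.
Qed.

(** The difference of the curvatures of [D + deform] and [D] when [deform] is [D]-parallel: a
    commutator, plus [deform] in the direction of the torsion of [D]. *)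
Definition curvature_defect X Y Z : X_M := deform X (deform Y Z) - deform Y (deform X Z)
  + deform (deform Y X - deform X Y) Z.

Local Notation Q := curvature_defect.

Lemma deformDl X Y Z : deform (X + Y) Z = deform X Z + deform Y Z.
Proof. by have := deform_linear_l 1 X Y Z; rewrite !scale1r. Qed.

Lemma deformNl X Z : deform (- X) Z = - deform X Z.
Proof.
have d0 : deform 0 Z = 0.
  have := deformDl 0 0 Z; rewrite addr0 => /eqP.
  by rewrite -subr_eq subrr => /eqP.
by have := deform_linear_l (-1) X 0 Z; rewrite d0 !addr0 !scaleN1r.
Qed.

Lemma curvature_decomposition X Y Z :
  curvature nabla X Y Z = curvature D X Y Z + Q X Y Z.
Proof.
have nE U V : nabla U V = D U V + deform U V by rewrite /canonical_connection subrK.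
have Dl U V W : D (U + V) W = D U W + D V W by exact: (DDl D_linear_l).
have Nl U W : D (- U) W = - D U W by exact: (DNl D_linear_l).
rewrite /curvature /curvature_defect -(lc_torsion_free LC) !nE.
rewrite !(D_additive_r, deformDr, deformDl, deformNl, D_parallel_deform, Dl, Nl).
by move: (D) => D'; vfield_ring.
Qed.

Definition horizontal X : Prop := forall r, eta r X = 0.

Lemma hor_id X : horizontal X -> hor X = X.
Proof.
by move=> hX; rewrite /horizontal_part big1 ?subr0// => r _; rewrite hX scale0r.
Qed.

Lemma hor_xi s : hor (xi s) = 0.
Proof.
rewrite /horizontal_part (bigD1 s)//= big1 => [|r rs].
  by rewrite (eta_xi_same H) scale1r addr0 subrr.
by rewrite (eta_xi H) (negPf rs) scale0r.
Qed.

Lemma horizontal_hor X : horizontal (hor X).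
Proof.
move=> s; rewrite /horizontal_part (etaD eta) (etaN eta) linear_sum (bigD1 s)//= big1.
  by rewrite (etaZ eta) (eta_xi_same H) mulr1 addr0 subrr.
by move=> r rs; rewrite (etaZ eta) (eta_xi H) eq_sym (negPf rs) mulr0.
Qed.

Lemma horizontal_phi r X : horizontal X -> horizontal (phi r X).
Proof.
move=> hX s; have [j [k T]] := even_triple_exists r.
have T2 := even_triple_cycle (even_triple_cycle T).
case: (even_tripleP s T) => ->; first exact: (eta_phi H).
  by rewrite (eta_phi_ji H T) hX oppr0.
by rewrite (eta_phi_ij H T2) hX.
Qed.

Lemma sum_delta_xi s (F : 'I_3 -> X_M) :
  \sum_r (eta r (xi s)) *: F r = F s.
Proof.
rewrite (bigD1 s)//= big1 => [|r rs].
  by rewrite (eta_xi_same H) scale1r addr0.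
by rewrite (eta_xi H) (negPf rs) scale0r.
Qed.

Lemma metric_sum_xi s (F : 'I_3 -> C) : g (\sum_r F r *: xi r) (xi s) = F s.
Proof.
rewrite metric_suml (bigD1 s)//= big1 => [|r rs].
  by rewrite (metricZl g) (metric_xil H) (eta_xi_same H) mulr1 addr0.
by rewrite (metricZl g) (metric_xil H) (eta_xi H) (negPf rs) mulr0.
Qed.

Lemma deform_hh X Y : horizontal X -> horizontal Y ->
  deform X Y = \sum_r (al * g (phi r X) Y) *: xi r.
Proof.
move=> hX hY; apply: eq_bigr => r _; rewrite /horizontal_form !hor_id//.
by rewrite hX hY mulr0 !scale0r subr0 addr0.
Qed.

Lemma deform_hx X s : horizontal X -> deform X (xi s) = - (al *: phi s X).
Proof.
move=> hX; rewrite -(sum_delta_xi s (fun r => - (al *: phi r X))).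
apply: eq_bigr => r _; rewrite /horizontal_form (hor_id hX) (hX r) scale0r addr0.
rewrite (metric_xir H) horizontal_phi// mulr0 scale0r sub0r.
by rewrite scalerN scalerA mulrC.
Qed.

Lemma deform_xh s Y : horizontal Y -> deform (xi s) Y = (de - al) *: phi s Y.
Proof.
move=> hY; rewrite -(sum_delta_xi s (fun r => (de - al) *: phi r Y)).
apply: eq_bigr => r _; rewrite /horizontal_form hor_xi hor_id// hY.
by rewrite (phi0 phi) (metric0l g) !mulr0 !scale0r subr0 add0r scalerBl.
Qed.

Lemma deform_xx s t : deform (xi s) (xi t) = de *: phi s (xi t).
Proof.
rewrite -(sum_delta_xi s (fun r => de *: phi r (xi t))).
apply: eq_bigr => r _; rewrite /horizontal_form !hor_xi.
by rewrite (phi0 phi) (metric0l g) !(mulr0, scaler0, scale0r, oppr0, add0r, addr0).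
Qed.

Lemma metric_Q X Y Z W : g (Q X Y Z) W = g (deform Y W) (deform X Z)
  - g (deform X W) (deform Y Z) + g (deform (deform Y X - deform X Y) Z) W.
Proof.
have E U V U' : g (deform U V) U' = - g (deform U U') V.
  by rewrite !gdeform (deform_form_skew hM U U' V).
by rewrite /curvature_defect !(metricDl g, metricNl g) (E X (deform Y Z))
  (E Y (deform X Z)); ring.
Qed.

Let smE := (scaler0, metric0l g, metric0r g, mulr0, mul0r).

Lemma deform_comm_hh X Y : horizontal X -> horizontal Y ->
  deform Y X - deform X Y = - \sum_r (2 * al * g (phi r X) Y) *: xi r.
Proof.
move=> hX hY; rewrite !deform_hh// -sumrB -sumrN; apply: eq_bigr => r _.
by rewrite (metric_phiC hM r X Y); vfield_ring.
Qed.

Lemma deform_sum_l (F : 'I_3 -> C) Z :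
  deform (\sum_r F r *: xi r) Z = \sum_r F r *: deform (xi r) Z.
Proof.
have d0 : deform 0 Z = 0.
  by have := deformDl 0 0 Z; rewrite addr0 => /eqP; rewrite -subr_eq subrr => /eqP.
rewrite (big_morph (fun U => deform U Z) (fun U V => deformDl U V Z) d0).
apply: eq_bigr => r _; have := deform_linear_l (F r) (xi r) 0 Z.
by rewrite d0 !addr0.
Qed.

(** The terms in [al * al] come from the commutator, through the vertical values of [deform] on
    horizontal pairs; the last term comes from the torsion, which is vertical there. *)
Lemma metric_Q_hhhh X Y Z W :
  horizontal X -> horizontal Y -> horizontal Z -> horizontal W ->
  g (Q X Y Z) W = \sum_r (al * al *
      (g (phi r Y) W * g (phi r X) Z - g (phi r X) W * g (phi r Y) Z)
    - 2 * al * (de - al) * g (phi r X) Y * g (phi r Z) W).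
Proof.
move=> hX hY hZ hW; rewrite metric_Q deform_comm_hh// deformNl deform_sum_l.
have S (F G : 'I_3 -> C) : g (\sum_r F r *: xi r) (\sum_r G r *: xi r) = \sum_r F r * G r.
  rewrite metric_sumr; apply: eq_bigr => r _.
  by rewrite (metricZr g) metric_sum_xi mulrC.
rewrite !deform_hh// !S (metricNl g) metric_suml -!sumrB; apply: eq_bigr => r _.
by rewrite deform_xh// !(metricZl g); ring.
Qed.

Lemma metric_Q_hhxh X Y t W : horizontal X -> horizontal Y -> horizontal W ->
  g (Q X Y (xi t)) W = 0.
Proof.
move=> hX hY hW; rewrite metric_Q deform_comm_hh// deformNl deform_sum_l.
have S (F : 'I_3 -> C) U s : horizontal U ->
    g (\sum_r F r *: xi r) (- (al *: phi s U)) = 0.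
  move=> hU; rewrite metric_suml big1// => r _.
  by rewrite (metricZl g) (metric_xil H) !mE horizontal_phi// mulr0 oppr0 mulr0.
rewrite (deform_hh hX hW) (deform_hh hY hW) (deform_hx t hX) (deform_hx t hY).
rewrite !S// subrr add0r (metricNl g) metric_suml.
rewrite big1 ?oppr0// => r _; rewrite deform_xx !(metricZl g).
have -> : g (phi r (xi t)) W = 0.
  by rewrite -[LHS]opprK -(metric_phir H) (metric_xil H) horizontal_phi// oppr0.
by rewrite !mulr0.
Qed.

Lemma deform_comm_xh s X : horizontal X ->
  deform X (xi s) - deform (xi s) X = - (de *: phi s X).
Proof. by move=> hX; rewrite deform_hx// deform_xh//; vfield_ring. Qed.

Lemma deformZl f X Z : deform (f *: X) Z = f *: deform X Z.
Proof.
have d0 : deform 0 Z = 0.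
  by have := deformDl 0 0 Z; rewrite addr0 => /eqP; rewrite -subr_eq subrr => /eqP.
by have := deform_linear_l f X 0 Z; rewrite d0 !addr0.
Qed.

Lemma metric_Q_xhhx s X Y : horizontal X -> horizontal Y ->
  g (Q (xi s) X Y) (xi s) = al * al * g X Y.
Proof.
move=> hX hY; rewrite metric_Q deform_comm_xh// deformNl deformZl.
rewrite (deform_hx s hX) (deform_xh s hY) deform_xx (phi_xi H).
rewrite (deform_hh (horizontal_phi s hX) hY).
rewrite !(metricNl g, metricZl g, metricZr g) metric_sum_xi !smE.
rewrite (ac_compat (a3c_structure H s)) (phi_phi H) !(hX s) scale0r addr0 mul0r.
by rewrite (metricNl g); ring.
Qed.

Lemma metric_Q_xhxx s X t : horizontal X -> g (Q (xi s) X (xi t)) (xi s) = 0.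
Proof.
move=> hX; rewrite metric_Q deform_comm_xh// deformNl deformZl.
rewrite (deform_hx s hX) (deform_hx t hX) (deform_hx t (horizontal_phi s hX)).
rewrite !deform_xx (phi_xi H).
rewrite !smE !(metricNl g, metricZl g, metricZr g) (ac_compat (a3c_structure H s)).
rewrite !(metric_xir H) !hX (horizontal_phi t (horizontal_phi s hX) s).
by rewrite mul0r subrr; ring.
Qed.

End CanonicalConnection.

(** * Traces of curvature in a frame orthonormal at a point *)

Section Ricci.
Context {R : realType} {m : nat} {M : smoothManifold R m}.
Local Notation C := (smoothfun M).
Local Notation X_M := (vfield M).
Variables (phi : 'I_3 -> {linear X_M -> X_M}) (xi : 'I_3 -> X_M).
Variables (eta : 'I_3 -> {scalar X_M}) (g : {symmetric X_M}).
Variables (alpha delta : R).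
Hypothesis hM : sasaki_3_alpha_delta phi xi eta g alpha delta.
Variable nabla : X_M -> X_M -> X_M.
Hypothesis LC : levi_civita g nabla.
Implicit Types (i j k r s t : 'I_3) (f : C) (X Y Z W : X_M).

Let H : almost_3_contact_metric phi xi eta g := s3_almost_3_contact hM.
Local Notation hor := (horizontal_part xi eta).
Local Notation al := (scst M alpha : C).
Local Notation de := (scst M delta : C).
Local Notation deform := (deform phi xi eta g alpha delta).
Local Notation D := (canonical_connection phi xi eta g alpha delta nabla).
Local Notation Q := (curvature_defect phi xi eta g alpha delta).
Local Notation horizontal := (horizontal eta).

Lemma metric_phi_horizontal r X : g (phi r X) X = 0.
Proof. by apply: smoothfun_double_eq0; rewrite {1}(metric_phiC hM r X X) addNr. Qed.

Lemma metric_phi_phi_horizontal s t X : horizontal X ->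
  g (phi t (phi s X)) X = - ((s == t)%:R * g X X).
Proof.
move=> hX; have sk := metric_phi_horizontal.
have [j [k T]] := even_triple_exists s.
have T2 := even_triple_cycle (even_triple_cycle T).
have [sj _ ks] := even_triple_neq T.
case: (even_tripleP t T) => ->.
- by rewrite (phi_phi H) hX scale0r addr0 eqxx mul1r (metricNl g).
- by rewrite (phi_ji H T) hX scale0r addr0 (metricNl g) sk sj mul0r.
- by rewrite (phi_ij H T2) hX scale0r addr0 sk eq_sym ks mul0r oppr0.
Qed.

Lemma metric_Q_hxxh s t X : horizontal X ->
  g (Q X (xi s) (xi t)) X = (s == t)%:R * (al * al) * g X X.
Proof.
move=> hX; rewrite (metric_Q hM).
have -> : deform (xi s) X - deform X (xi s) = de *: phi s X.
  by rewrite -opprB (deform_comm_xh hM s hX) opprK.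
have -> : deform X X = 0.
  rewrite (deform_hh _ _ _ _ _ hX hX) big1// => r _.
  by rewrite metric_phi_horizontal mulr0 scale0r.
rewrite (deform_hx hM t hX) (deform_xh hM s hX) (deformZl hM).
rewrite (deform_hx hM t (horizontal_phi hM s hX)).
rewrite !(metricNl g, metricNr g, metricZl g, metricZr g, metric0l g).
have -> : g (phi s X) (phi t X) = - g (phi t (phi s X)) X.
  by rewrite (metric_phir H).
by rewrite metric_phi_phi_horizontal//; ring.
Qed.

(** The Ricci tensor of a 3-dimensional space form of curvature [delta ^+ 2], whence the factor 2 =
    3 - 1. *)
Lemma sum_metric_Q_xxx s t : \sum_r g (Q (xi r) (xi s) (xi t)) (xi r) =
  2 * (de * de) * (s == t)%:R.
Proof.
have [j [k T]] := even_triple_exists s.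
have T1 := even_triple_cycle T; have T2 := even_triple_cycle T1.
have [sj jk ks] := even_triple_neq T.
have ndl f r Y : deform (f *: xi r) Y = f *: deform (xi r) Y.
  exact: (deformZl hM).
rewrite (even_triple_sum _ T) !(metric_Q hM) !(deform_xx hM).
rewrite !(phi_xi H, phi_xi_ij H T, phi_xi_ji H T, phi_xi_ij H T1, phi_xi_ji H T1,
  phi_xi_ij H T2, phi_xi_ji H T2) !(scalerN, scaler0, subr0, sub0r, opprK, subrr).
rewrite !(deformDl hM, deformNl hM) !ndl !(deform_xx hM).
have d0 Y : deform 0 Y = 0 by have := deformZl hM 0 0 Y; rewrite !scale0r.
have b1 : true%:R = 1 :> C by [].
have b0 : false%:R = 0 :> C by [].
case: (even_tripleP t T) => ->; rewrite ?eqxx ?sj ?[s == k]eq_sym ?ks ?b0 ?b1;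
rewrite !(d0, tripleE H T, scaler0);
rewrite !(metricDl g, metricDr g, metricNl g, metricNr g, metricZl g, metricZr g,
  metric0l g, metric0r g, metric_xil H, etaN eta, etaZ eta, eta0 eta, tripleE H T);
by ring.
Qed.

Variable p : M.
Variable E : 'I_m -> X_M.
Hypothesis oE : orthonormal_at g p E.

Definition scalar_map (L : X_M -> C) := forall f X Y, L (f *: X + Y) = f * L X + L Y.

Lemma scalar_mapD L X Y : scalar_map L -> L (X + Y) = L X + L Y.
Proof. by move=> hL; have := hL 1 X Y; rewrite scale1r mul1r. Qed.

Lemma scalar_map0 L : scalar_map L -> L 0 = 0.
Proof.
move=> hL; have := scalar_mapD 0 0 hL; rewrite addr0 => /eqP.
by rewrite -subr_eq subrr => /eqP.
Qed.

Lemma scalar_mapZ L f X : scalar_map L -> L (f *: X) = f * L X.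
Proof. by move=> hL; have := hL f X 0; rewrite (scalar_map0 hL) !addr0. Qed.

Lemma scalar_map_sum L I (l : seq I) (P : pred I) (F : I -> X_M) : scalar_map L ->
  L (\sum_(x <- l | P x) F x) = \sum_(x <- l | P x) L (F x).
Proof.
move=> hL; apply: (big_morph L) => [X Y|]; first exact: scalar_mapD.
exact: scalar_map0.
Qed.

Lemma parseval_map L X : scalar_map L -> L X p = \sum_a g X (E a) p * L (E a) p.
Proof.
move=> hL; pose L' : {scalar X_M} := HB.pack L (GRing.isLinear.Build _ _ _ _ L hL).
exact: (parseval L' X oE).
Qed.

Definition bilinear_map (B : X_M -> X_M -> C) :=
  (forall Y, scalar_map (B^~ Y)) /\ (forall X, scalar_map (B X)).

Definition trace (B : X_M -> X_M -> C) : R := \sum_a B (E a) (E a) p.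

Lemma trace_metric U V : trace (fun X Y => g X U * g Y V) = g U V p.
Proof.
have hL : scalar_map (g^~ V) by move=> f X Y; rewrite (metricDl g) (metricZl g).
rewrite (parseval_map U hL); apply: eq_bigr => a _.
by rewrite smoothfunME (metricC g (E a) U).
Qed.

Lemma trace_phi r B : bilinear_map B ->
  trace (fun X Y => B (phi r X) Y) = - trace (fun X Y => B X (phi r Y)).
Proof.
move=> [Bl Br].
have -> : trace (fun X Y => B (phi r X) Y) =
    \sum_a \sum_b g (phi r (E a)) (E b) p * B (E b) (E a) p.
  by apply: eq_bigr => a _; exact: (parseval_map _ (Bl (E a))).
rewrite exchange_big -sumrN; apply: eq_bigr => b _.
rewrite (parseval_map (phi r (E b)) (Br (E b))) -sumrN; apply: eq_bigr => a _.
by rewrite (metric_phiC hM r (E b) (E a)) smoothfunNE mulNr.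
Qed.

(** The frame need not be adapted to the splitting: Parseval turns a trace with a vertical
    projection in one slot into values on the [xi r]. *)
Lemma trace_hor B : bilinear_map B -> trace B =
  trace (fun X Y => B (hor X) (hor Y)) + \sum_r B (xi r) (xi r) p.
Proof.
move=> [Bl Br].
pose v X := \sum_r eta r X *: xi r.
have hv X : X = hor X + v X by rewrite /horizontal_part subrK.
have vlin f X Y : v (f *: X + Y) = f *: v X + v Y.
  rewrite /v scaler_sumr -big_split; apply: eq_bigr => r _ /=.
  by rewrite (etaD eta) (etaZ eta) scalerDl scalerA.
have vxi r : v (xi r) = xi r by rewrite /v (sum_delta_xi hM r xi).
have tv (G : X_M -> X_M -> C) : bilinear_map G ->
    trace (fun X Y => G X (v Y)) = \sum_r G (xi r) (xi r) p.
  move=> [Gl Gr].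
  have -> : trace (fun X Y => G X (v Y)) =
      \sum_a \sum_r g (xi r) (E a) p * G (E a) (xi r) p.
    apply: eq_bigr => a _; rewrite /v (scalar_map_sum _ _ _ (Gr (E a))).
    rewrite smoothfun_sumE; apply: eq_bigr => r _.
    by rewrite (scalar_mapZ _ _ (Gr (E a))) smoothfunME (metric_xil H).
  rewrite exchange_big; apply: eq_bigr => r _.
  by rewrite (parseval_map (xi r) (Gl (xi r))).
have tD (F G : X_M -> X_M -> C) :
    trace (fun X Y => F X Y + G X Y) = trace F + trace G.
  by rewrite /trace -big_split.
have tC (F : X_M -> X_M -> C) : trace (fun X Y => F Y X) = trace F by [].
have -> : trace B = trace (fun X Y => B (hor X) (hor Y) + B (hor X) (v Y))
    + trace (fun X Y => B (v X) Y).
  rewrite -tD; apply: eq_bigr => a _.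
  by rewrite {1}(hv (E a)) (scalar_mapD _ _ (Bl _)) {2}(hv (E a)) (scalar_mapD _ _ (Br _)).
rewrite tD (tv (fun X Y => B (hor X) Y)); last first.
  by split=> [Y f X X'|X]; [rewrite (hor_linear xi eta) Bl|exact: Br].
rewrite [X in _ + X + _]big1 => [|r _]; last first.
  by rewrite (hor_xi hM) (scalar_map0 (Bl _)).
rewrite addr0; congr (_ + _); rewrite -(tC (fun X Y => B (v X) Y))
  (tv (fun X Y => B Y X))//.
Qed.

Local Notation RD := (curvature D).
Let Dl := D_linear_l hM LC.
Let Da := D_additive_r hM LC.
Let Dz := D_leibniz hM LC.
Let Dm := D_metric hM LC.

Lemma curvature_D_xi X Y r : RD X Y (xi r) = 0.
Proof.
by rewrite /curvature !(D_parallel_xi hM LC) !(D0r Da) !subr0.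
Qed.

Lemma curvature_D_phi X Y r Z : RD X Y (phi r Z) = phi r (RD X Y Z).
Proof.
by rewrite /curvature !(D_parallel_phi hM LC) !(phiD phi, phiN phi).
Qed.

Lemma metric_curvature_D_xi X Y Z r : g (RD X Y Z) (xi r) = 0.
Proof. by rewrite (curvature_skew X Y Z (xi r) Dm) curvature_D_xi (metric0l g) oppr0. Qed.

Lemma curvature_D_bilinear X Y : bilinear_map (fun U V => g (RD U X Y) V).
Proof.
split=> [V f U U'|U f V V'].
  by rewrite (curvatureDl Dl Da) (curvatureZl Dl Dz) (metricDl g) (metricZl g).
by rewrite (metricDr g) (metricZr g).
Qed.

Lemma Q_bilinear X Y : bilinear_map (fun U V => g (Q U X Y) V).
Proof.
split=> [V f U U'|U f V V']; last by rewrite (metricDr g) (metricZr g).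
have QE W : Q W X Y = curvature nabla W X Y - RD W X Y.
  by rewrite (curvature_decomposition hM LC) addrC addKr.
have nl := lc_linear_l LC.
rewrite !QE !(curvatureDl Dl Da, curvatureZl Dl Dz).
rewrite !(curvatureDl nl (lc_additive_r LC), curvatureZl nl (lc_leibniz LC)).
by rewrite opprD addrACA -scalerBr (metricDl g) (metricZl g).
Qed.

Definition ricD X Y : R := trace (fun U V => g (RD U X Y) V).

Lemma trace_curvature X Y : trace (fun U V => g (curvature nabla U X Y) V) =
  ricD X Y + trace (fun U V => g (Q U X Y) V).
Proof.
rewrite /ricD /trace -big_split; apply: eq_bigr => a _ /=.
by rewrite (curvature_decomposition hM LC) (metricDl g).
Qed.

Lemma metric_hor_l U X : horizontal X -> g (hor U) X = g U X.
Proof.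
move=> hX; rewrite /horizontal_part (metricDl g) (metricNl g) metric_suml big1 ?subr0//.
by move=> r _; rewrite (metricZl g) (metric_xil H) hX mulr0.
Qed.

(** The first summand is the horizontal trace, where each of the three indices contributes equally
    by Parseval for [phi r X] and [phi r Y]; the second is the contribution of the three [xi r]. *)
Lemma trace_Q_horizontal X Y : horizontal X -> horizontal Y ->
  trace (fun U V => g (Q U X Y) V) =
  (3 * (2 * alpha * (delta - alpha) - alpha ^+ 2) + 3 * alpha ^+ 2) * g X Y p.
Proof.
move=> hX hY; rewrite (trace_hor (Q_bilinear X Y)) mulrDl; congr (_ + _); last first.
  rewrite (eq_bigr (fun=> alpha ^+ 2 * g X Y p)) => [|r _].
    by rewrite sumr_const card_ord -[LHS]mulr_natl mulrA.
  by rewrite (metric_Q_xhhx hM r hX hY) !smoothfunME expr2.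
pose c := 2 * al * (de - al) - al * al.
have -> : trace (fun U V => g (Q (hor U) X Y) (hor V)) =
    trace (fun U V => \sum_r c * (g U (phi r X) * g V (phi r Y))).
  apply: eq_bigr => a _ /=; congr (smoothfun_val _ p).
  have hE := horizontal_hor hM (E a).
  rewrite (metric_Q_hhhh hM hE hX hY hE); apply: eq_bigr => r _.
  rewrite (metric_phi_horizontal r (hor (E a))).
  rewrite -(metric_hor_l _ (horizontal_phi hM r hX))
    -(metric_hor_l _ (horizontal_phi hM r hY)).
  rewrite !(metric_phiC hM r _ (hor (E a))) !(metricC g (phi r _) (hor (E a))).
  by rewrite /c; ring.
have K r : \sum_a (c * (g (E a) (phi r X) * g (E a) (phi r Y))) p =
    (2 * alpha * (delta - alpha) - alpha ^+ 2) * g X Y p.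
  have -> : g X Y p = g (phi r X) (phi r Y) p.
    by rewrite (ac_compat (a3c_structure H r)) hX mul0r subr0.
  rewrite -(trace_metric (phi r X) (phi r Y)) /trace mulr_sumr.
  by apply: eq_bigr => a _; rewrite smoothfunME /c expr2 -scst_nat.
rewrite /trace; under eq_bigr do rewrite smoothfun_sumE.
rewrite exchange_big; rewrite (eq_bigr _ (fun r _ => K r)).
by rewrite sumr_const card_ord -[LHS]mulr_natl mulrA.
Qed.

Lemma trace_metric_self : trace (fun U V => g U V) = m%:R.
Proof.
rewrite /trace (eq_bigr (fun=> 1)) => [|a _]; last by rewrite oE eqxx.
by rewrite sumr_const card_ord.
Qed.

Lemma trace_metric_hor : trace (fun U V => g (hor U) (hor V)) = m%:R - 3.
Proof.
have gb : bilinear_map (fun U V => g U V).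
  split=> [V f U U'|U f V V']; first by rewrite (metricDl g) (metricZl g).
  by rewrite (metricDr g) (metricZr g).
have S : \sum_r g (xi r) (xi r) p = 3.
  rewrite (eq_bigr (fun=> 1)) => [|r _]; first by rewrite sumr_const card_ord.
  by rewrite (metric_xil H) (eta_xi_same H).
by have := trace_hor gb; rewrite trace_metric_self S => ->; rewrite addrK.
Qed.

(** As [D] has torsion, the identity is taken from [nabla]. In the cyclic sum the commutator terms
    give [2 al^2], which completes the torsion coefficient [2 al (de - al)] to [2 al de]. *)
Lemma curvature_D_bianchi X Y Z W :
  horizontal X -> horizontal Y -> horizontal Z -> horizontal W ->
  g (RD X Y Z) W + g (RD Y Z X) W + g (RD Z X Y) W = 2 * al * de *
    \sum_r (g (phi r X) Y * g (phi r Z) W + g (phi r Y) Z * g (phi r X) W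
      + g (phi r Z) X * g (phi r Y) W).
Proof.
move=> hX hY hZ hW.
have := curvature_bianchi (lc_additive_r LC) X Y Z (lc_torsion_free LC).
move=> /(congr1 (fun U => g U W)).
have L3 U1 U2 U3 : g (U1 + U2 + U3) W = g U1 W + g U2 W + g U3 W.
  by rewrite !(metricDl g).
have dec U V U' : g (curvature nabla U V U') W = g (RD U V U') W + g (Q U V U') W.
  by rewrite (curvature_decomposition hM LC) (metricDl g).
rewrite L3 (metric0l g) (dec X Y Z) (dec Y Z X) (dec Z X Y).
rewrite (metric_Q_hhhh hM hX hY hZ hW) (metric_Q_hhhh hM hY hZ hX hW).
rewrite (metric_Q_hhhh hM hZ hX hY hW) => S.
have {}S : g (RD X Y Z) W + g (RD Y Z X) W + g (RD Z X Y) W =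
    - (\sum_r (al * al * (g (phi r Y) W * g (phi r X) Z - g (phi r X) W * g (phi r Y) Z) -
       2 * al * (de - al) * g (phi r X) Y * g (phi r Z) W) +
     \sum_r (al * al * (g (phi r Z) W * g (phi r Y) X - g (phi r Y) W * g (phi r Z) X) -
       2 * al * (de - al) * g (phi r Y) Z * g (phi r X) W) +
     \sum_r (al * al * (g (phi r X) W * g (phi r Z) Y - g (phi r Z) W * g (phi r X) Y) -
       2 * al * (de - al) * g (phi r Z) X * g (phi r Y) W)).
  by apply/eqP; rewrite -addr_eq0; apply/eqP; apply: etrans S; ring.
rewrite S -!big_split -sumrN mulr_sumr; apply: eq_bigr => r _ /=.
rewrite (metric_phiC hM r X Y) (metric_phiC hM r X Z) (metric_phiC hM r Y Z).
by ring.
Qed.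

(** The trace pairing of sp(1) and sp(n) vanishes: the curvature commutes with the [phi], while
    [phi i] is [phi_j phi_k] and also [- phi_k phi_j] up to vertical terms, so the trace equals its
    opposite. *)
Lemma trace_curvature_D_phi i X Y : trace (fun U V => g (RD X Y U) (phi i V)) = 0.
Proof.
have [j [k T]] := even_triple_exists i.
have T1 := even_triple_cycle T.
set t := trace _.
have bil r : bilinear_map (fun U V => g (RD X Y U) (phi r V)).
  split=> [V f U U'|U f V V'].
    by rewrite (curvatureDr Da) (curvatureZr Da Dz) (metricDl g) (metricZl g).
  by rewrite (phiD phi) (phiZ phi) (metricDr g) (metricZr g).
have E1 : t = - trace (fun U V => g (RD X Y (phi j U)) (phi k V)).
  rewrite /t /trace -sumrN; apply: eq_bigr => a _.
  have -> : phi i (E a) = phi j (phi k (E a)) - eta k (E a) *: xi j.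
    by rewrite (phi_ij H T1) addrK.
  rewrite (metricDr g) (metricNr g) (metricZr g) metric_curvature_D_xi mulr0 subr0.
  by rewrite (metric_phir H) curvature_D_phi.
have E2 : t = - trace (fun U V => g (RD X Y U) (phi k (phi j V))).
  rewrite /t /trace -sumrN; apply: eq_bigr => a _.
  rewrite (phi_ji H T1) (metricDr g) (metricNr g) (metricZr g) metric_curvature_D_xi.
  by rewrite mulr0 addr0 smoothfunNE opprK.
have E3 := trace_phi j (bil k).
have tN : t = - t by rewrite {1}E1 E3 opprK E2 opprK.
have : t + t = 0 by rewrite {1}tN addNr.
by move=> /eqP; rewrite -mulr2n mulrn_eq0 /= => /eqP.
Qed.

(** The index [i] contributes [-2] times [g (phi i X) Y], each of the other two [+2]. *)
Lemma sum_metric_phi_phi i X Y : horizontal X -> horizontal Y ->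
  \sum_r (g (phi r X) (phi i (phi r Y)) - g (phi r Y) (phi i (phi r X))) =
  2 * g (phi i X) Y.
Proof.
move=> hX hY; have [j [k T]] := even_triple_exists i.
rewrite (even_triple_sum _ T) !(metricE H T) !(hX, hY).
rewrite !(metric_phiC hM _ X Y).
by ring.
Qed.

(** The Bianchi identity for [X, Y, U, phi i U] is traced over horizontal [U]: the first curvature
    term has trace 0, the other two are Ricci terms. The factor [m - 1] is [m - 3], the horizontal
    rank, plus the 2 of [sum_metric_phi_phi]. *)
Lemma ricD_phi i X Y : horizontal X -> horizontal Y ->
  ricD X (phi i Y) - ricD Y (phi i X) =
  - (2 * (alpha * delta * (m%:R - 1)) * g (phi i X) Y p).
Proof.
move=> hX hY.
have bil : bilinear_map (fun U V => g (RD X Y U) (phi i V)).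
  split=> [V f U U'|U f V V'].
    by rewrite (curvatureDr Da) (curvatureZr Da Dz) (metricDl g) (metricZl g).
  by rewrite (phiD phi) (phiZ phi) (metricDr g) (metricZr g).
have T0 : trace (fun U V => g (RD X Y (hor U)) (phi i (hor V))) = 0.
  rewrite -[RHS](trace_curvature_D_phi i X Y) (trace_hor bil).
  rewrite [X in _ = _ + X]big1 ?addr0// => r _.
  by rewrite curvature_D_xi (metric0l g).
have ricE X' Y' : ricD X' Y' = trace (fun U V => g (RD (hor U) X' Y') (hor V)).
  rewrite /ricD (trace_hor (curvature_D_bilinear X' Y')).
  by rewrite [X in _ + X]big1 ?addr0// => r _; rewrite metric_curvature_D_xi.
pose c := 2 * al * de.
pose G r U V := - (g U (phi r Y) * g V (phi i (phi r X)))
  + g U (phi r X) * g V (phi i (phi r Y)).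
have pt U : horizontal U -> g (RD X Y U) (phi i U) =
    g (RD U X (phi i Y)) U - g (RD U Y (phi i X)) U
    + c * (g (phi i X) Y * g U U + \sum_r G r U U).
  move=> hU; have B := curvature_D_bianchi hX hY hU (horizontal_phi hM i hU).
  have e1 : g (RD Y U X) (phi i U) = g (RD U Y (phi i X)) U.
    by rewrite (metric_phir H) -curvature_D_phi (curvatureC Dl Y U) (metricNl g) opprK.
  have e2 : g (RD U X Y) (phi i U) = - g (RD U X (phi i Y)) U.
    by rewrite (metric_phir H) -curvature_D_phi.
  have e3 : \sum_r (g (phi r X) Y * g (phi r U) (phi i U)
      + g (phi r Y) U * g (phi r X) (phi i U) + g (phi r U) X * g (phi r Y) (phi i U)) =
      g (phi i X) Y * g U U + \sum_r G r U U.
    rewrite big_split /= big_split /= -addrA; congr (_ + _).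
      rewrite (bigD1 i)//= big1 => [|r ri].
        rewrite (metric_phir H) metric_phi_phi_horizontal// eqxx mul1r opprK addr0.
        by [].
      rewrite (metric_phir H) metric_phi_phi_horizontal// (negPf ri) mul0r oppr0 oppr0.
      by rewrite mulr0.
    rewrite -big_split; apply: eq_bigr => r _ /=; rewrite /G.
    rewrite !(metric_phir H _ (phi r _) U) (metric_phiC hM r X U).
    rewrite !(metricC g U); ring.
  rewrite e1 e2 e3 in B.
  apply/eqP; rewrite -subr_eq0; move/eqP: B; rewrite -subr_eq0 => /eqP B.
  by apply/eqP; apply: etrans B; rewrite /c; ring.
have tG r : trace (fun U V => G r (hor U) (hor V)) =
    (g (phi r X) (phi i (phi r Y)) - g (phi r Y) (phi i (phi r X))) p.
  rewrite addrC smoothfunDE smoothfunNE -!trace_metric /trace -sumrN -big_split.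
  apply: eq_bigr => a _ /=.
  have hp s Z : horizontal Z -> g (hor (E a)) (phi s Z) = g (E a) (phi s Z).
    by move=> hZ; rewrite metric_hor_l//; exact: (horizontal_phi hM).
  have hp2 s s' Z : horizontal Z -> g (hor (E a)) (phi s (phi s' Z)) =
      g (E a) (phi s (phi s' Z)).
    by move=> hZ; rewrite hp//; exact: (horizontal_phi hM).
  by rewrite /G (hp2 i r X hX) (hp2 i r Y hY) (hp r Y hY) (hp r X hX).
move: T0; rewrite /trace.
rewrite (eq_bigr (fun a => g (RD (hor (E a)) X (phi i Y)) (hor (E a)) p
   - g (RD (hor (E a)) Y (phi i X)) (hor (E a)) p
   + 2 * alpha * delta * (g (phi i X) Y p * g (hor (E a)) (hor (E a)) p
            + \sum_r G r (hor (E a)) (hor (E a)) p))) => [|a _]; last first.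
  rewrite (pt _ (horizontal_hor hM (E a))) -smoothfun_sumE.
  by rewrite !(smoothfunDE, smoothfunNE, smoothfunME).
rewrite big_split sumrB /= -mulr_sumr big_split /= -mulr_sumr exchange_big /=.
rewrite -/(trace (fun U V => g (RD (hor U) X (phi i Y)) (hor V))).
rewrite -/(trace (fun U V => g (RD (hor U) Y (phi i X)) (hor V))).
rewrite -/(trace (fun U V => g (hor U) (hor V))) -!ricE trace_metric_hor.
rewrite (eq_bigr _ (fun r _ => tG r)) -smoothfun_sumE sum_metric_phi_phi//.
have -> : (2 * g (phi i X) Y) p = 2 * g (phi i X) Y p by rewrite -scst_nat.
move=> S; apply/eqP; rewrite -subr_eq0; apply/eqP.
by apply: etrans S; ring.
Qed.

(* Pointwise in [U], so that no trace is needed for the symmetry of Ricci. *)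
Lemma metric_curvature_sym X Y U :
  g (curvature nabla U X Y) U = g (curvature nabla U Y X) U.
Proof.
have L3 U1 U2 U3 : g (U1 + U2 + U3) U = g U1 U + g U2 U + g U3 U.
  by rewrite !(metricDl g).
have := curvature_bianchi (lc_additive_r LC) U X Y (lc_torsion_free LC).
move=> /(congr1 (fun V => g V U)); rewrite L3 (metric0l g).
have -> : g (curvature nabla X Y U) U = 0.
  apply: smoothfun_double_eq0.
  by rewrite {1}(curvature_skew X Y U U (lc_metric LC)) addNr.
rewrite (curvatureC (lc_linear_l LC) Y U X) (metricNl g) addr0 => /eqP.
by rewrite subr_eq0 => /eqP.
Qed.

(** Symmetry is not automatic for a connection with torsion; it is inherited from [nabla] because
    the trace of the quadratic term is symmetric. *)
Lemma ricD_sym X Y : horizontal X -> horizontal Y -> ricD X Y = ricD Y X.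
Proof.
move=> hX hY; have := trace_curvature X Y.
have -> : trace (fun U V => g (curvature nabla U X Y) V) =
    trace (fun U V => g (curvature nabla U Y X) V).
  by apply: eq_bigr => a _; rewrite metric_curvature_sym.
rewrite trace_curvature !trace_Q_horizontal// (metricC g Y X).
by move=> /addIr ->.
Qed.

Lemma ricDN X Y : ricD X (- Y) = - ricD X Y.
Proof.
rewrite /ricD /trace -sumrN; apply: eq_bigr => a _.
rewrite -scaleN1r (curvatureZr Da Dz) scaleN1r (metricNl g).
by rewrite smoothfunNE.
Qed.

Lemma ricD_horizontal X Y : horizontal X -> horizontal Y ->
  ricD X Y = alpha * delta * (m%:R - 1) * g X Y p.
Proof.
pose c := alpha * delta * (m%:R - 1).
pose S X Y := ricD X Y - c * g X Y p.
have Sphi i X' Y' : horizontal X' -> horizontal Y' ->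
    S X' (phi i Y') = S Y' (phi i X').
  move=> hX' hY'; have := ricD_phi i hX' hY'; rewrite -/c /S => E0.
  apply/eqP; rewrite -subr_eq0; apply/eqP; move/eqP: E0; rewrite -subr_eq0 => /eqP E0.
  rewrite (metric_phir H i X' Y') (metric_phir H i Y' X') (metric_phiC hM i X' Y').
  rewrite !smoothfunNE; apply: etrans E0; ring.
have Sphi2 i X' Y' : horizontal X' -> horizontal Y' ->
    S (phi i X') (phi i Y') = - S X' Y'.
  move=> hX' hY'; rewrite Sphi//; last exact: (horizontal_phi hM).
  rewrite (phi_phi H) hX' scale0r addr0 /S ricDN (metricNr g) smoothfunNE.
  by rewrite (ricD_sym hY' hX') (metricC g Y' X'); ring.
move=> hX hY; apply/eqP; rewrite -subr_eq0 -/c -/(S X Y); apply/eqP.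
have [j [k T]] := even_triple_exists 0.
have phik Z : horizontal Z -> phi k Z = phi 0 (phi j Z).
  by move=> hZ; rewrite (phi_ij H T) hZ scale0r addr0.
have SN : S X Y = - S X Y.
  have e : S (phi 0 (phi j X)) (phi 0 (phi j Y)) = S X Y.
    rewrite (Sphi2 0 _ _ (horizontal_phi hM j hX) (horizontal_phi hM j hY)).
    by rewrite (Sphi2 j _ _ hX hY) opprK.
  by rewrite -{1}e -(phik X hX) -(phik Y hY) (Sphi2 k _ _ hX hY).
have : S X Y + S X Y = 0 by rewrite {1}SN addNr.
by move=> /eqP; rewrite -mulr2n mulrn_eq0 /= => /eqP.
Qed.

Lemma trace_curvature_horizontal X Y : horizontal X -> horizontal Y ->
  trace (fun U V => g (curvature nabla U X Y) V) =
  (alpha * delta * (m%:R + 5) - 6 * alpha ^+ 2) * g X Y p.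
Proof.
by move=> hX hY; rewrite trace_curvature ricD_horizontal// trace_Q_horizontal//; ring.
Qed.

(** The curvature of [D] kills [xi t], so everything comes from the quadratic term: [alpha ^+ 2] for
    each horizontal direction and [2 * delta ^+ 2] from the vertical ones. *)
Lemma trace_curvature_xi X t :
  trace (fun U V => g (curvature nabla U X (xi t)) V) =
  ((m%:R - 3) * alpha ^+ 2 + 2 * delta ^+ 2) * eta t X p.
Proof.
have bil X' : bilinear_map (fun U V => g (curvature nabla U X' (xi t)) V).
  split=> [V f U U'|U f V V']; last by rewrite (metricDr g) (metricZr g).
  rewrite (curvatureDl (lc_linear_l LC) (lc_additive_r LC)).
  by rewrite (curvatureZl (lc_linear_l LC) (lc_leibniz LC)) (metricDl g) (metricZl g).
have QE U X' : curvature nabla U X' (xi t) = Q U X' (xi t).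
  by rewrite (curvature_decomposition hM LC) curvature_D_xi add0r.
have lin U V : scalar_map (fun X' => g (curvature nabla U X' (xi t)) V).
  move=> f X1 X2; rewrite !(curvatureC (lc_linear_l LC) U).
  rewrite (curvatureDl (lc_linear_l LC) (lc_additive_r LC)).
  rewrite (curvatureZl (lc_linear_l LC) (lc_leibniz LC)).
  by rewrite !(metricNl g) (metricDl g) (metricZl g); ring.
have tH X' : horizontal X' -> trace (fun U V => g (curvature nabla U X' (xi t)) V) = 0.
  move=> hX'; rewrite (trace_hor (bil X')) /trace big1 ?add0r => [|a _].
    by rewrite big1// => r _; rewrite QE (metric_Q_xhxx hM).
  by rewrite QE (metric_Q_hhxh hM)//; exact: (horizontal_hor hM).
have tX s : trace (fun U V => g (curvature nabla U (xi s) (xi t)) V) =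
    ((m%:R - 3) * alpha ^+ 2 + 2 * delta ^+ 2) * (s == t)%:R.
  rewrite (trace_hor (bil (xi s))) mulrDl; congr (_ + _).
    rewrite -trace_metric_hor /trace !mulr_suml; apply: eq_bigr => a _.
    rewrite QE (metric_Q_hxxh _ _ (horizontal_hor hM (E a))).
    by rewrite -scst_nat !smoothfunME /=; ring.
  under eq_bigr do rewrite QE.
  rewrite -smoothfun_sumE (sum_metric_Q_xxx) -!scst_nat !smoothfunME /=.
  by rewrite expr2.
pose L X' : R := trace (fun U V => g (curvature nabla U X' (xi t)) V).
have LD X1 X2 : L (X1 + X2) = L X1 + L X2.
  rewrite /L /trace -big_split; apply: eq_bigr => a _ /=.
  by rewrite (scalar_mapD _ _ (lin _ _)).
have LZ f X' : L (f *: X') = f p * L X'.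
  rewrite /L /trace mulr_sumr; apply: eq_bigr => a _.
  by rewrite (scalar_mapZ _ _ (lin _ _)) smoothfunME.
rewrite -/(L X).
have XE : X = hor X + \sum_r eta r X *: xi r by rewrite /horizontal_part subrK.
have [j [k T]] := even_triple_exists t.
have [tj _ kt] := even_triple_neq T.
rewrite {1}XE (LD (hor X)) [L (hor X)](tH _ (horizontal_hor hM X)) add0r.
rewrite (even_triple_sum _ T) !LD !LZ /L !tX eqxx (eq_sym j t) tj kt /= !mulr0 !addr0 mulr1.
by rewrite mulrC.
Qed.

End Ricci.

(** * Assembly of the Ricci tensor and the Einstein condition *)

Section RicciFormula.
Context {R : realType} {m : nat} {M : smoothManifold R m}.
Local Notation X_M := (vfield M).
Variables (phi : 'I_3 -> {linear X_M -> X_M}) (xi : 'I_3 -> X_M).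
Variables (eta : 'I_3 -> {scalar X_M}) (g : {symmetric X_M}).
Variables (alpha delta : R).
Hypothesis hM : sasaki_3_alpha_delta phi xi eta g alpha delta.
Variable nabla : X_M -> X_M -> X_M.
Hypothesis LC : levi_civita g nabla.
Implicit Types (r s t : 'I_3) (X Y Z : X_M) (p : M).

Let H : almost_3_contact_metric phi xi eta g := s3_almost_3_contact hM.
Local Notation hor := (horizontal_part xi eta).
Local Notation horizontal := (horizontal eta).

Let oE p : orthonormal_at g p (frame_at g p) :=
  frame_at_orthonormal p (a3c_metric H).

Lemma ricciC X Y p : ricci g nabla X Y p = ricci g nabla Y X p.
Proof. by apply: eq_bigr => a _; rewrite (metric_curvature_sym LC). Qed.

Lemma ricciDr X Y Z p :
  ricci g nabla X (Y + Z) p = ricci g nabla X Y p + ricci g nabla X Z p.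
Proof.
rewrite -big_split; apply: eq_bigr => a _ /=.
by rewrite (curvatureDr (lc_additive_r LC)) (metricDl g).
Qed.

Lemma ricciZr X f Y p : ricci g nabla X (f *: Y) p = f p * ricci g nabla X Y p.
Proof.
rewrite mulr_sumr; apply: eq_bigr => a _ /=.
by rewrite (curvatureZr (lc_additive_r LC) (lc_leibniz LC)) (metricZl g).
Qed.

Lemma ricci_xi X t p : ricci g nabla X (xi t) p =
  ((m%:R - 3) * alpha ^+ 2 + 2 * delta ^+ 2) * eta t X p.
Proof. exact: (trace_curvature_xi hM LC (oE p)). Qed.

Lemma ricci_horizontal X Y p : horizontal X -> horizontal Y ->
  ricci g nabla X Y p =
  (alpha * delta * (m%:R + 5) - 6 * alpha ^+ 2) * g X Y p.
Proof. exact: (trace_curvature_horizontal hM LC (oE p)). Qed.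

(** Only [Y] has to be split for the vertical values, which are known against every [X]; symmetry of
    Ricci reduces the horizontal part of [Y] to horizontal pairs. *)
Lemma ricciE X Y p : ricci g nabla X Y p =
  (alpha * delta * (m%:R + 5) - 6 * alpha ^+ 2) * g X Y p
  + ((m%:R - 3) * alpha ^+ 2 + 2 * delta ^+ 2
     - (alpha * delta * (m%:R + 5) - 6 * alpha ^+ 2)) *
    \sum_r eta r X p * eta r Y p.
Proof.
have split Z : Z = hor Z + \sum_r eta r Z *: xi r by rewrite /horizontal_part subrK.
have sumr (F : 'I_3 -> X_M) Z :
    ricci g nabla Z (\sum_r F r) p = \sum_r ricci g nabla Z (F r) p.
  by rewrite !big_ord_recl !big_ord0 !addr0 !ricciDr.
have main Z W : horizontal W -> ricci g nabla Z W p =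
    (alpha * delta * (m%:R + 5) - 6 * alpha ^+ 2) * g Z W p.
  move=> hW; rewrite ricciC {1}(split Z) (ricciDr W (hor Z)) sumr big1 ?addr0 => [|r _].
    rewrite (ricci_horizontal p hW (horizontal_hor hM Z)).
    by rewrite (metricC g W) (metric_hor_l hM).
  by rewrite ricciZr ricci_xi hW mulr0 mulr0.
rewrite {1}(split Y) (ricciDr X (hor Y)) sumr (main _ _ (horizontal_hor hM Y)).
have -> : g X (hor Y) p = g X Y p - \sum_r eta r X p * eta r Y p.
  rewrite /horizontal_part (metricDr g) (metricNr g) smoothfunDE smoothfunNE; congr (_ - _).
  rewrite metric_sumr smoothfun_sumE; apply: eq_bigr => r _.
  by rewrite (metricZr g) (metric_xir H) smoothfunME mulrC.
have -> : \sum_r ricci g nabla X (eta r Y *: xi r) p =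
    ((m%:R - 3) * alpha ^+ 2 + 2 * delta ^+ 2) * \sum_r eta r X p * eta r Y p.
  rewrite mulr_sumr; apply: eq_bigr => r _.
  by rewrite ricciZr ricci_xi; ring.
by ring.
Qed.

Lemma sum_eta_xi s t p : \sum_r eta r (xi s) p * eta r (xi t) p = (s == t)%:R.
Proof.
rewrite (bigD1 s)//= big1 => [|r rs].
  by rewrite !(eta_xi H) eqxx addr0; case: (s == t); rewrite ?mul1r ?mulr0.
by rewrite !(eta_xi H) (negPf rs) mul0r.
Qed.

Lemma trace_sum_eta p :
  \sum_a \sum_r eta r (frame_at g p a) p * eta r (frame_at g p a) p = 3.
Proof.
rewrite exchange_big (eq_bigr (fun=> 1)) => [|r _]; first by rewrite sumr_const card_ord.
have := trace_metric (oE p) (xi r) (xi r).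
rewrite (metric_xil H) (eta_xi_same H) => S; rewrite -[RHS]S /trace.
by apply: eq_bigr => a _; rewrite !(metric_xir H).
Qed.

(* Evaluating on [xi 0] and tracing over a frame give [A + B = lambda] and
   [A m + 3 B = lambda m], hence [B (m - 3) = 0]. *)
Lemma einstein_eta_metric A B : m%:R - 3 != 0 :> R ->
  (forall X Y p, ricci g nabla X Y p =
    A * g X Y p + B * \sum_r eta r X p * eta r Y p) ->
  einstein g nabla <-> B = 0.
Proof.
move=> m3 ricE; split=> [[l El]|B0]; last first.
  by exists A => X Y p; rewrite ricE B0 mul0r addr0.
pose p : M := point.
have e1 : A + B = l.
  have := ricE (xi 0) (xi 0) p; rewrite El sum_eta_xi (metric_xil H) (eta_xi_same H).
  by rewrite eqxx !mulr1.
have e2 : l * m%:R = A * m%:R + B * 3.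
  have gE : \sum_a g (frame_at g p a) (frame_at g p a) p = m%:R.
    exact: (trace_metric_self (oE p)).
  rewrite -gE -(trace_sum_eta p) !mulr_sumr -big_split; apply: eq_bigr => a _ /=.
  by rewrite -El ricE.
have : B * (m%:R - 3) = 0.
  by rewrite mulrBr; apply/eqP; rewrite subr_eq0; apply/eqP/(addrI (A * m%:R));
     rewrite -e2 -e1 mulrDl.
by move=> /eqP; rewrite mulf_eq0 (negPf m3) orbF => /eqP.
Qed.

End RicciFormula.

(** * The underlying quaternionic contact structure *)

Section Forms.
Context {R : realType} {m : nat} {M : smoothManifold R m}.
Local Notation C := (smoothfun M).
Local Notation X_M := (vfield M).

Definition scale_form (c : C) (eta : {scalar X_M}) (X : X_M) : C := c * eta X.

Lemma scale_form_scalar c eta : scalar (scale_form c eta).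
Proof. by move=> f X Y; rewrite /scale_form linearD scalar_formZ; ring. Qed.

HB.instance Definition _ (c : C) (eta : {scalar X_M}) :=
  GRing.isLinear.Build C X_M C *%R (scale_form c eta) (scale_form_scalar c eta).

Lemma extd_scale_form a (eta : {scalar X_M}) X Y :
  extd (scale_form (scst M a) eta) X Y = scst M a * extd eta X Y.
Proof. by rewrite /extd /= /scale_form !vfieldM !vfield_scst; ring. Qed.

(** One construction for symmetric forms ([eps = false]) and skew-symmetric forms ([eps = true]). *)
Lemma form_hermitian (U : lmodType C) (eps : bool) (B : U -> U -> C) :
  (forall Y, scalar (B^~ Y)) -> (forall X Y, B X Y = (-1) ^+ eps * B Y X) ->
  exists w : {hermitian U for eps & idfun}, forall X Y, w X Y = B X Y.
Proof.
move=> Bl Bs.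
have Br X : scalar (B X).
  by move=> f Y Z; rewrite !(Bs X) Bl; ring.
pose w : {hermitian U for eps & idfun} := HB.pack B
  (bilinear_isBilinear.Build C U U C *%R (idfun \; *%R) B (Bl, Br))
  (isHermitianSesquilinear.Build C U eps idfun B Bs).
by exists w.
Qed.
End Forms.

Section UnderlyingQC.
Context {R : realType} {m : nat} {M : smoothManifold R m}.
Local Notation C := (smoothfun M).
Local Notation X_M := (vfield M).
Variables (phi : 'I_3 -> {linear X_M -> X_M}) (xi : 'I_3 -> X_M).
Variables (eta : 'I_3 -> {scalar X_M}) (g : {symmetric X_M}).
Variables (alpha delta : R).
Hypothesis hM : sasaki_3_alpha_delta phi xi eta g alpha delta.
Implicit Types (i j k r s : 'I_3) (X Y : X_M).

Let H : almost_3_contact_metric phi xi eta g := s3_almost_3_contact hM.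
Local Notation horizontal := (horizontal eta).
Local Notation omega := (horizontal_form phi xi eta g).
Local Notation ai := (scst M (- alpha^-1) : C).

Lemma omega_hermitian i : exists w : {skew_symmetric X_M},
  forall X Y, w X Y = omega i X Y.
Proof.
have [j [k T]] := even_triple_exists i.
apply: form_hermitian => [Y f X X'|X Y].
  by rewrite /horizontal_form (hor_linear xi eta) (phiD phi) (phiZ phi) (metricDl g)
    (metricZl g).
rewrite expr1 mulN1r !(omegaE H T) /wedge (metric_phiC hM i X Y); ring.
Qed.

Lemma extd_eta_omega i j k : even_triple i j k -> forall X Y,
  extd (eta i) X Y =
  - 2 * scst M alpha * omega i X Y - 2 * scst M delta * wedge (eta j) (eta k) X Y.
Proof.
by move=> T X Y; rewrite (extd_eta hM T) (omegaE H T); ring.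
Qed.

Lemma extd_eta_vertical i r f X : horizontal X -> extd (eta i) (f *: xi r) X = 0.
Proof.
move=> hX; have [j [k T]] := even_triple_exists i.
rewrite (extd_eta hM T) /wedge !hX !mulr0 !mul0r subrr mulr0 addr0.
rewrite (phiZ phi) (metricZl g) -[g _ _]opprK -(metric_phir H) (metric_xil H).
by rewrite (horizontal_phi hM i hX) oppr0 !mulr0.
Qed.

Definition qc_form i : {scalar X_M} := scale_form ai (eta i).

Lemma qc_horizontal (X : hsection qc_form) : horizontal X.
Proof.
have /asboolP hX := hsectionP X => i.
have a0 : - alpha^-1 != 0 by rewrite oppr_eq0 invr_eq0 (s3_alpha hM).
exact: (scst_mulI a0 (etrans (hX i) (esym (mulr0 _)))).
Qed.

Lemma horizontal_qc X : horizontal X -> X \in horizontal_pred qc_form.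
Proof. by move=> hX; apply/asboolP => i; rewrite /= /scale_form hX mulr0. Qed.

Definition qc_endo r (X : hsection qc_form) : hsection qc_form :=
  HSection (horizontal_qc (horizontal_phi hM r (qc_horizontal X))).

Lemma qc_endo_linear r : linear (qc_endo r).
Proof. by move=> f X Y; apply/val_inj; rewrite /= linearP. Qed.

Definition qc_endo_map r : {linear hsection qc_form -> hsection qc_form} :=
  HB.pack (qc_endo r) (GRing.isLinear.Build C _ _ _ (qc_endo r) (qc_endo_linear r)).

Lemma qc_metric : exists G : {symmetric (hsection qc_form)},
  forall X Y : hsection qc_form, G X Y = g X Y.
Proof.
apply: form_hermitian => [Y f X X'|X Y]; first by rewrite /= (metricDl g) (metricZl g).
by rewrite expr0 mul1r (metricC g).
Qed.

Lemma scst_alpha_inv : ai * scst M (- alpha) = 1.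
Proof.
rewrite -scstM mulrNN mulVf ?(s3_alpha hM) //.
exact: val_inj.
Qed.

Lemma underlying_qc_einstein : exists2 Q : qcStructure M, underlying_qc alpha phi eta g Q
  & qc_einstein Q (2 * alpha * delta).
Proof.
have [G GE] := qc_metric.
(* The factor is the inverse of [- alpha^-1], as duality with the rescaled forms demands. *)
pose zeta r := scst M (- alpha) *: xi r.
have zetaE i r : qc_form i (zeta r) = (i == r)%:R.
  by rewrite /= /scale_form (etaZ eta) mulrA scst_alpha_inv mul1r (eta_xi H).
have ex i r (X : hsection qc_form) : extd (qc_form i) (zeta r) X = 0.
  by rewrite extd_scale_form (extd_eta_vertical _ _ _ (qc_horizontal X)) mulr0.
have a0 : alpha != 0 := s3_alpha hM.
(* Scaling [d eta_i] by [- 1 / alpha] leaves [2 delta / alpha] in front of the wedge of [eta_j] and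
   [eta_k], and that wedge is [alpha^2] times the wedge of the rescaled forms; hence the constant
   [2 alpha delta]. *)
have exE i j k : even_triple i j k -> forall X Y, extd (qc_form i) X Y =
    2 * omega i X Y + scst M (2 * alpha * delta) * wedge (qc_form j) (qc_form k) X Y.
  move=> T X Y; rewrite extd_scale_form (extd_eta_omega T) /wedge /= /scale_form.
  have aa : scst M alpha * scst M alpha^-1 = 1 by rewrite -scstM divff// scst1.
  rewrite !scstM !scst_nat !scstN; set b := scst M alpha^-1 in aa *.
  apply/eqP; rewrite -subr_eq0; apply/eqP.
  (* The difference of the two sides is a multiple of [alpha * alpha^-1 - 1]. *)
  transitivity (2 * (scst M alpha * b - 1) * (omega i X Y
    + scst M delta * b * (eta k X * eta j Y - eta j X * eta k Y))); first by ring.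
  by rewrite aa subrr mulr0 mul0r.
have hY_omega i (X Y : hsection qc_form) : omega i X Y = g (phi i X) Y.
  have [j [k T]] := even_triple_exists i.
  by rewrite (omegaE H T) /wedge !(qc_horizontal X); ring.
have exh i (X Y : hsection qc_form) : extd (qc_form i) X Y = 2 * omega i X Y.
  have [j [k T]] := even_triple_exists i.
  by rewrite (exE _ _ _ T) /wedge /= /scale_form !(qc_horizontal X); ring.
have posG p (X : hsection qc_form) : nonzero_at p X -> 0 < G X X p.
  by move=> X0; rewrite GE; exact: (a3c_metric H).
have codim p (c : 'I_3 -> R) :
    (forall X : X_M, \sum_i c i * qc_form i X p = 0) -> forall i, c i = 0.
  move=> c0 i; have := c0 (zeta i); rewrite (bigD1 i)// big1 => [|j /andP[_ ji]].
    by rewrite zetaE eqxx /= addr0 mulr1.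
  by rewrite zetaE (negPf ji) mulr0.
have I2 r (X : hsection qc_form) : qc_endo_map r (qc_endo_map r X) = - X.
  by apply/val_inj; rewrite /= (phi_phi H) (qc_horizontal X) scale0r addr0.
have T012 : even_triple 0 1 2 by exists 1%g; rewrite ?odd_perm1 ?perm1.
have I123 (X : hsection qc_form) : qc_endo_map 0 (qc_endo_map 1 X) = qc_endo_map 2 X.
  by apply/val_inj; rewrite /= (phi_ij H T012) (qc_horizontal X) scale0r addr0.
have Iiso r (X Y : hsection qc_form) : G (qc_endo_map r X) (qc_endo_map r Y) = G X Y.
  by rewrite !GE /= (ac_compat (a3c_structure H r)) (qc_horizontal X) mul0r subr0.
have exI i (X Y : hsection qc_form) : 2 * G (qc_endo_map i X) Y = extd (qc_form i) X Y.
  by rewrite GE exh hY_omega.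
have reeb : reeb_fields qc_form zeta.
  by split=> // i j X; rewrite !ex oppr0.
pose Q := QCStructure codim posG I2 I123 Iiso exI reeb.
have [w wE] := choice omega_hermitian.
exists Q; first by split.
exists w; split=> [i r X|i X Y|i j k T X Y].
- rewrite wE /horizontal_form -[qc_xi Q r]/(zeta r) -[zeta r]addr0 (hor_linear xi eta).
  rewrite (hor_xi hM) scaler0 add0r /horizontal_part big1 => [|s _].
    by rewrite subr0 (phi0 phi) (metric0l g).
  by rewrite (eta0 eta) scale0r.
- by rewrite wE exh.
- by rewrite wE (exE _ _ _ T).
Qed.

End UnderlyingQC.

Theorem proposition2p3p3 (R : realType) (n : nat) (hn : (0 < n)%N)
    (M : smoothManifold R (4 * n + 3)%N) (alpha delta : R)
    (phi : 'I_3 -> {linear vfield M -> vfield M}) (xi : 'I_3 -> vfield M)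
    (eta : 'I_3 -> {scalar (vfield M)}) (g : {symmetric (vfield M)})
    (hM : sasaki_3_alpha_delta phi xi eta g alpha delta) :
  (exists2 Q : qcStructure M, underlying_qc alpha phi eta g Q
     & qc_einstein Q (2 * alpha * delta)) /\
  forall nabla : vfield M -> vfield M -> vfield M, levi_civita g nabla ->
    (forall (X Y : vfield M) (p : M),
      ricci g nabla X Y p =
        2 * alpha * (2 * delta * (n%:R + 2) - 3 * alpha) * g X Y p
        + 2 * (alpha - delta) * ((2 * n%:R + 3) * alpha - delta)
          * \sum_(i < 3) eta i X p * eta i Y p) /\
    (einstein g nabla <-> delta = alpha \/ delta = (2 * n%:R + 3) * alpha).
Proof.
split; first exact: (underlying_qc_einstein hM).
move=> nabla LC.
have mE : (4 * n + 3)%:R = 4 * n%:R + 3 :> R by rewrite natrD natrM.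
have ricE X Y p : ricci g nabla X Y p =
    2 * alpha * (2 * delta * (n%:R + 2) - 3 * alpha) * g X Y p
    + 2 * (alpha - delta) * ((2 * n%:R + 3) * alpha - delta)
      * \sum_(i < 3) eta i X p * eta i Y p.
  (* With [m = 4n + 3] one has [m + 5 = 4 (n + 2)] and [m - 3 = 4n], and the vertical minus the
     horizontal coefficient factors as stated. *)
  by rewrite (ricciE hM LC) mE; congr (_ * _ + _ * _); ring.
(* The horizontal rank [4n] is nonzero, which is where [n >= 1] enters. *)
split=> //; have m3 : (4 * n + 3)%:R - 3 != 0 :> R.
  by rewrite mE addrK mulf_neq0// pnatr_eq0 -lt0n.
rewrite (einstein_eta_metric hM m3 ricE); split=> [/eqP|[->|->]]; last 2 first.
- by rewrite subrr mulr0 mul0r.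
- by rewrite subrr mulr0.
rewrite !mulf_eq0 pnatr_eq0 /= !subr_eq0 => /orP[] /eqP ->; first by left.
by right.
Qed.
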